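(* Let $f:X\to X$ be a conservative, exact, topologically mixing Markov map with topologically mixing Gibbs-Markov first return map $F=f^\tau:Y\to Y$, and with $\sigma$-finite absolutely continuous invariant measure $\mu$ satisfying $\mu(X)=\infty$ (all as specified in the context). Let $d\ge1$ be an integer and suppose: (i) there exist fixed points $\xi_1,\dots,\xi_d\in X$ of $f$ such that $\mu\big(X\setminus(B_\varepsilon(\xi_1)\cup\dots\cup B_\varepsilon(\xi_d))\big)<\infty$ for all $\varepsilon>0$; (ii) there exist constants $\alpha\in(0,1]$, $c_1,\dots,c_d>0$ and a measurable partition $X_1,\dots,X_d$ of $X\setminus Y$ such that (a) $\xi_k\in\operatorname{Int}X_k$ for $k=1,\dots,d$; (b) for $k\ne\ell$, orbits cannot pass from $X_k$ to $X_\ell$ without first entering $Y$ (if $x\in X_k$, $n\ge1$ and $f^nx\in X_\ell$ then $f^jx\in Y$ for some $0<j<n$); (c) $\mu(\tau^{(k)}>n)\sim c_kn^{-\alpha}$ as $n\to\infty$ for $k=1,\dots,d$, where $\tau^{(k)}(y)=\operatorname{Card}\{1\le n\le\tau(y):f^ny\in X_k\}$ for $y\in Y$; (iii) there exist $\theta\in(0,1)$ and a dense subset $K(X)\subset L^1(X,m)$ such that $Q_r^\rho\in\mathcal B_\theta(Y)$ for all $\rho\in K(X)$ and $r\ge0$; (iv) if $\alpha\in(0,1/2]$, then $\mu(\tau=n)=O(n^{-(1+\alpha)})$. Let $\bar p=(c_1+\dots+c_d)^{-1}(c_1,\dots,c_d)$ and $\nu_{\bar p}=\sum_{k=1}^d\bar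 p_k\delta_{\xi_k}$. Then $\lim_{n\to\infty}f^n_*\lambda=\nu_{\bar p}$ (weak-$*$) for every Borel probability measure $\lambda$ on $X$ absolutely continuous with respect to $m$.
   Context: Setting. $X$ is a compact metric space with Borel probability measure $m$, and $f:X\to X$ is measurable and nonsingular ($m(f^{-1}E)=0$ for every null set $E$). Conservative: for every measurable $E$ with $m(E)>0$, a.e. $x\in E$ satisfies $f^nx\in E$ for infinitely many $n$. Exact: every set in $\bigcap_{n\ge0}f^{-n}\mathcal B$ ($\mathcal B$ the Borel $\sigma$-algebra) has $m$-measure $0$ or $1$ (so $f$ is ergodic). Markov: there is a countable partition $\mathcal P$ of $X$ into positive measure sets such that the restriction of $f$ to each element is a measurable bijection onto a union of elements of $\mathcal P$. For $\theta\in(0,1)$, $d_\theta(x,y)=\theta^{s(x,y)}$ where $s(x,y)=\inf\{n\ge0:f^nx,f^ny\text{ lie in different elements of }\mathcal P\}$; it is assumed that $s(x,y)=\infty$ iff $x=y$. Topologically mixing: for all $a,b\in\mathcal P$ there is $N\ge1$ with $f^na\cap b\neq\emptyset$ for all $n\ge N$. $Y\subset X$ is a (nonempty) union of elements of $\mathcal P$; $\tau(y)=\inf\{n\ge1:f^ny\in Y\}$ and $F(y)=f^{\tau(y)}y$ for $y\in Y$ (defined a.e.). $\mathcal P_Y$ is the partition of $Y$ into the sets $\big(\bigcap_{j=0}^{n-1}f^{-j}a_j\big)\cap f^{-n}Y$ with $a_j\in\mathcal P$, $a_0\subset Y$, $a_1,\dots,a_{n-1}\subset X\setminus Y$; $F$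 is Markov for $\mathcal P_Y$. On $Y$, $d_\theta$ denotes the symbolic metric defined using $F$ and $\mathcal P_Y$, and topological mixing of $F$ is with respect to $\mathcal P_Y$. $F$ is Gibbs-Markov if $\operatorname{Card}\{Fa:a\in\mathcal P_Y\}<\infty$ and for some $\theta\in(0,1)$, $C>0$ the function $\log\frac{dm}{dm\circ F}$ is $d_\theta$-Lipschitz, with constant $C$, on each element of $\mathcal P_Y$. $\mathcal B_\theta(Y)$ is the space of functions $Y\to\mathbb R$ that are Lipschitz with respect to $d_\theta$. Known fact: such an $f$ preserves a unique (up to scaling) $\sigma$-finite measure $\mu\ll m$; $\mu$ is equivalent to $m$, $\mu(Y)<\infty$, and $h=d\mu/dm$ satisfies $h|_Y,(h|_Y)^{-1}\in\mathcal B_\theta(Y)$. The functions $Q_r^\rho$. For $r\ge0$ let $\mathcal P_r^*$ be the collection of cylinders $a=[a_0,\dots,a_r]=\bigcap_{j=0}^rf^{-j}a_j$ with $a_j\in\mathcal P$, $a_0,\dots,a_{r-1}\not\subset Y$, $a_r\subset Y$. For $\rho\in L^1(X,m)$, $$Q_r^\rho:Y\to\mathbb R,\qquad Q_r^\rho=\sum_{a\in\mathcal P_r^*}1_{f^ra}\cdot\frac{\rho}{Jf^r}\circ f^r|_a^{-1},\qquad Jf^r=\frac{dm\circ f^r}{dm}.$$ $B_\varepsilon(x)$ is the open ball; $a_n\sim b_n$ means $a_n/b_n\to1$; $f^n_*\lambda$ is the pushforward. *)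

(* Defs.v *)
(* MathComp-Analysis *)
From HB Require Import structures.
From mathcomp Require Import all_boot all_order all_algebra.
From mathcomp Require Import all_classical all_reals all_analysis.

Set Implicit Arguments.
Unset Strict Implicit.
Unset Printing Implicit Defensive.

Import Order.TTheory GRing.Theory Num.Theory numFieldNormedType.Exports.

Local Open Scope classical_set_scope.
Local Open Scope ring_scope.

(* The two structures on the carrier are not linked here: that the measurable
   sets are the Borel sets is a separate hypothesis. *)
#[short(type="measurableMetricType")]
HB.structure Definition MeasurableMetric (d : measure_display)
    (R : numDomainType) :=
  {T of Measurable d T & Metric R T}.

(* Infimum in {0, 1, ..., +oo}; [None] is +oo, the infimum of the empty set. *)
Definition inf_nat (A : set nat) : option nat :=
  if pselect (exists n, n \in A) is left h then Some (ex_minn h) else None.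

Section symbolic.
Context {R : realType} {X : Type}.
Implicit Types (g : X -> X) (P : set (set X)) (A B Y : set X) (x y : X).

Definition union_of P B := exists2 S, S `<=` P & B = \bigcup_(a in S) a.

Definition topologically_mixing g P :=
  forall a b, P a -> P b -> exists2 N, (1 <= N)%N &
    forall n, (N <= n)%N -> (iter n g @` a) `&` b !=set0.

Definition separation_time g P x y : option nat :=
  inf_nat [set n | exists a b,
    [/\ P a, P b, a <> b, a (iter n g x) & b (iter n g y)]].

Definition d_theta g P (theta : R) x y : R :=
  if separation_time g P x y is Some n then theta ^+ n else 0.

Definition lipschitz_dist (dist : X -> X -> R) A (C : R) (u : X -> R) :=
  forall x y, A x -> A y -> `|u x - u y| <= C * dist x y.

Section return_map.
Variables (f : X -> X) (P : set (set X)) (Y : set X).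

Definition tau y : option nat :=
  inf_nat [set n | (1 <= n)%N /\ Y (iter n f y)].

(* Where tau = +oo, [first_return] is the identity. Such a point of Y lies in no
   element of [induced_partition]. *)
Definition first_return y : X :=
  if tau y is Some n then iter n f y else y.

(* The points of Y at which all iterates of the first return map are defined.
   When f is conservative this is Y up to a null set. *)
Definition recurrent_part : set X :=
  [set y | Y y /\ forall N, exists2 n, (N <= n)%N & Y (iter n f y)].

Definition induced_partition : set (set X) :=
  [set b | b !=set0 /\ exists n (a : nat -> set X),
    [/\ (1 <= n)%N,
        forall j, (j < n)%N -> P (a j),
        a 0%N `<=` Y,
        forall j, (1 <= j < n)%N -> a j `<=` ~` Y &
        b = (\bigcap_(j in [set j | (j < n)%N]) (iter j f @^-1` a j))
            `&` (iter n f @^-1` Y)]].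

(* Number of visits to A at times 1, ..., tau y; the value 0 at the points where
   tau = +oo is arbitrary. *)
Definition visits A y : nat :=
  if tau y is Some n then (\sum_(1 <= j < n.+1) (iter j f y \in A))%N else 0%N.

(* d_theta for the first return map is a metric on [recurrent_part] only, so
   the Lipschitz condition is imposed there. *)
Definition return_dist (theta : R) : X -> X -> R :=
  d_theta first_return induced_partition theta.

Definition B_theta (theta : R) : set (X -> R) :=
  [set u | exists C, lipschitz_dist (return_dist theta) recurrent_part C u].

(* The cylinders [a_0, ..., a_r] that enter Y at time r and not before. *)
Definition entry_cylinders (r : nat) : set (set X) :=
  [set b | exists a : nat -> set X,
    [/\ forall j, (j <= r)%N -> P (a j),
        forall j, (j < r)%N -> ~ (a j `<=` Y),
        a r `<=` Y &
        b = \bigcap_(j in [set j | (j <= r)%N]) (iter j f @^-1` a j)]].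

End return_map.
End symbolic.

(* Sum of an absolutely summable family of reals over a possibly infinite set of
   indices. *)
Definition abs_sum (R : realType) (I : choiceType) (D : set I) (u : I -> R) : R :=
  fine (\esum_(i in D) (Num.max (u i) 0)%:E)%E
  - fine (\esum_(i in D) (Num.max (- u i) 0)%:E)%E.

Section measured.
Context {d : measure_display} {R : realType} {X : measurableMetricType d R}.
Implicit Types (m mu : {measure set X -> \bar R}) (f g : X -> X).
Implicit Types (P : set (set X)) (D Y : set X).

Definition nonsingular_map m f :=
  forall E, measurable E -> m E = 0%E -> m (f @^-1` E) = 0%E.

Definition conservative_map m f :=
  forall E, measurable E -> (0 < m E)%E ->
    {ae m, forall x, E x ->
      forall N, exists2 n, (N <= n)%N & E (iter n f x)}.

Definition exact_map m f :=
  forall E, (forall n, exists2 B, measurable B & E = iter n f @^-1` B) ->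
    m E = 0%E \/ m E = 1%E.

Definition markov_map m f P :=
  [/\ countable P,
      partition P id [set: X],
      forall a, P a -> measurable a /\ (0 < m a)%E &
      forall a, P a ->
        set_inj a f /\ union_of P (f @` a)].

(* m o g on D, for g injective on D. If g is Borel and X is Polish, images under
   g of Borel subsets of D are Borel (Lusin-Souslin), so this is a measure. *)
Definition image_measure m g D : set X -> \bar R :=
  fun A => m (g @` (A `&` D)).

(* u is a version on D of the Radon-Nikodym derivative dnu/dmu. *)
Definition is_density (nu mu : set X -> \bar R) D (u : X -> R) :=
  [/\ measurable_fun D u,
      forall x, D x -> 0 <= u x &
      forall A, measurable A -> A `<=` D ->
        nu A = (\int[mu]_(x in A) (u x)%:E)%E].

Definition gibbs_markov m f P Y :=
  let F := first_return f Y in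
  let PY := induced_partition f P Y in
  finite_set [set F @` a | a in PY] /\
  exists theta C : R, [/\ 0 < theta < 1, 0 < C &
    forall a, PY a -> exists u : X -> R,
      [/\ is_density m (image_measure m F a) a u,
          forall x, a x -> 0 < u x &
          lipschitz_dist (return_dist f P Y theta)
            (a `&` recurrent_part f Y) C (fun x => ln (u x))]].

(* A version of dm o g/dm on D. *)
Definition jacobian m g D : X -> R :=
  xget (cst 1) [set u | is_density (image_measure m g D) m D u].

(* Determined by the class of rho only up to a null set, like the Jacobians. *)
Definition Q_op m f P Y (r : nat) (rho : X -> R) (y : X) : R :=
  abs_sum (entry_cylinders f P Y r) (fun a =>
    let x := 'pinv_id a (iter r f) y in
    \1_(iter r f @` a) y * (rho x / jacobian m (iter r f) a x)).

Definition dense_L1 m (K : set (X -> R)) :=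
  (forall rho, K rho -> m.-integrable setT (EFin \o rho)) /\
  forall (rho : X -> R) (eps : R),
    m.-integrable setT (EFin \o rho) -> 0 < eps ->
    exists2 k, K k & (\int[m]_x `|rho x - k x|%:E < eps%:E)%E.

Definition atomic_measure (n : nat) (xi : 'I_n -> X) (p : 'I_n -> R) :
    set X -> \bar R :=
  fun A => (\sum_(k < n) (p k)%:E * \d_(xi k) A)%E.

(* Weak-* convergence of measures on a compact space. *)
Definition weak_cvg (nus : nat -> set X -> \bar R) (nu : set X -> \bar R) :=
  forall phi : X -> R, continuous phi ->
    (\int[nus n]_x (phi x)%:E)%E @[n --> \oo] --> (\int[nu]_x (phi x)%:E)%E.

End measured.

(* Main.v *)
Require Import Defs.
From HB Require Import structures.
From mathcomp Require Import all_boot all_order all_algebra.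
From mathcomp Require Import all_classical all_reals all_analysis.
From mathcomp Require Import measurable_realfun.
From mathcomp Require Import zify ring lra.

(** The mass of an absolutely continuous law leaves every set of finite [mu]-measure
    and so concentrates at the fixed points; what has to be found is the proportion
    of it near each of them.

    Exactness removes the dependence on the initial law. For two absolutely
    continuous laws the probabilities of [iter n f @^-1` A n] merge as [n] grows,
    whatever the sets [A n] ([merging]): otherwise convex combinations of indicators
    of these preimages would converge to a function of the tail sigma-algebra which
    is not constant. Comparison with [mu] normalised on a set of large measure gives
    the escape of mass ([finite_measure_escape]), and the limit of the probability
    of being in [Xk k] at time [n] may be computed for one convenient law: [mu]
    normalised on the set [Z] of the points of [Y] that return infinitely often.

    Every excursion out of [Y] stays in one of the sets [Xk k], and the probability
    that it is in [Xk k] and lasts longer than [i] is asymptotic to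
    [c k * i%:R `^ (- alpha)], up to a common factor. So among the excursions that
    are long the proportion of those in [Xk k] is
    [p k := c k / \sum_l c l]. If successive excursions were independent, then a
    renewal decomposition over the last visit to [Z] before time [n] would give the
    sum over [i] of [u (n - i)], the probability of a visit at time [n - i], times
    the probability of an excursion in [Xk k] longer than [i]. The latter is about
    [p k] times the probability of any excursion longer than [i], and the
    corresponding sum over all excursions is at most 1 because these events are
    disjoint for different [i]. Thus the limsup would be at most [p k]; the values
    of [u] enter only through that sum and through their convergence to 0, which is
    the escape of mass. Since the [p k] add up to 1, upper bounds suffice
    ([limsup_total_cvg]).

    Independence is replaced by the loss of memory of the first return map. The laws
    whose densities have a logarithm that is Lipschitz on every cell form a cone,
    which the induced map contracts ([cone_contraction]), and which is stable under
    conditioning on return times ([cone_push_adapted]). Whenever a visit occurs,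
    [g.+1] returns later the law of the point is therefore close to the invariant
    law, relatively to it ([induced_regular]). Accordingly the decomposition is made
    at the visit [g.+1] returns before the last one ([channel_decomposition]); the
    intermediate returns take a time at most [L] up to a small probability, and a
    bounded delay does not change the tails asymptotically ([tail_ratio]). This
    leads to the upper bound ([channel_limsup]).

    Two identifications are needed on the way. The invariant law provided by the
    cone is [mu] normalised on [Z]: the restriction of [mu] is invariant under the
    first return map ([induced_invariant]), and there is only one such law because
    the points that visit a given set infinitely often form an invariant set, to
    which exactness applies ([invariant_measure_unique]). And the Gibbs-Markov
    condition speaks of the measures of images, which are Borel sets by the theorem
    of Lusin and Souslin ([measurable_image_inj]). *)

Set Implicit Arguments.
Unset Strict Implicit.
Unset Printing Implicit Defensive.

Import Order.TTheory GRing.Theory Num.Theory numFieldNormedType.Exports.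

Local Open Scope classical_set_scope.
Local Open Scope ring_scope.

(** * Suslin sets and images of Borel sets *)

Section suslin.
Context {T : topologicalType}.
Implicit Types (A : set T) (K : nat -> (nat -> nat) -> set T).

Definition agree (N : nat) (s s' : nat -> nat) :=
  forall i, (i < N)%N -> s i = s' i.

(** The locally constant dependence on [s] encodes a scheme of closed sets
    indexed by finite sequences, without fixing at which depth the [n]-th set is
    decided; this makes countable unions and intersections a mere recoding of
    the sequence. *)
Definition suslin_scheme K :=
  (forall n s, closed (K n s)) /\
  (forall n s, exists N, forall s', agree N s s' -> K n s' = K n s).

Definition suslin A := exists K,
  suslin_scheme K /\ A = [set t | exists s, forall n, K n s t].

Lemma suslin_closed A : closed A -> suslin A.
Proof.
move=> cA; exists (fun _ _ => A); split; first by split => // n s; exists 0%N.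
apply/seteqP; split => [t At|t [s At]]; last exact: (At 0%N).
by exists (fun=> 0%N).
Qed.

Lemma suslin_bigcup (A : nat -> set T) :
  (forall i, suslin (A i)) -> suslin (\bigcup_i A i).
Proof.
move=> /choice[K KA].
exists (fun n s => K (s 0%N) n (fun i => s i.+1)); split.
  split=> n s; first exact: (KA _).1.1.
  have [N HN] := (KA (s 0%N)).1.2 n (fun i => s i.+1).
  exists N.+1 => s' ss'; rewrite -(ss' 0%N)//; apply: HN => i iN.
  exact: ss'.
apply/seteqP; split => [t [i _]|t [s Ks]].
  rewrite (KA i).2 => -[s Ks].
  by exists (fun j => if j is j'.+1 then s j' else i).
by exists (s 0%N) => //; rewrite (KA _).2; exists (fun i => s i.+1).
Qed.

Lemma suslin_bigcap (A : nat -> set T) :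
  (forall i, suslin (A i)) -> suslin (\bigcap_i A i).
Proof.
move=> /choice[K KA].
(* one sequence codes a sequence for every [i], and one number a pair of numbers *)
pose pr n : nat * nat := odflt (0%N, 0%N) (unpickle n).
have prK p : pr (pickle p) = p by rewrite /pr pickleK.
pose sub (i : nat) (s : nat -> nat) := fun j : nat => s (pickle (i, j)).
exists (fun n s => K (pr n).1 (pr n).2 (sub (pr n).1 s)); split.
  split=> n s; first exact: (KA _).1.1.
  have [N HN] := (KA (pr n).1).1.2 (pr n).2 (sub (pr n).1 s).
  exists (\max_(j < N) (pickle ((pr n).1, val j)).+1)%N => s' ss'.
  apply: HN => i iN; apply: ss'.
  exact: (leq_bigmax (Ordinal iN)).
apply/seteqP; split => [t At|t [s Ks] i _].
  have /choice[s Hs] : forall i, exists s, forall n, K i n s t.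
    by move=> i; have := At i I; rewrite (KA i).2.
  exists (fun k => s (pr k).1 (pr k).2) => n /=.
  rewrite (_ : sub _ _ = s (pr n).1) //.
  by apply/funext => j; rewrite /sub prK.
rewrite (KA i).2; exists (sub i s) => n.
by have := Ks (pickle (i, n)); rewrite prK.
Qed.

Lemma suslin_setI (A B : set T) : suslin A -> suslin B -> suslin (A `&` B).
Proof.
move=> sA sB.
rewrite (_ : _ `&` _ = \bigcap_i (if i is 0%N then A else B)).
  by apply: suslin_bigcap => -[].
apply/seteqP; split => [t [At Bt] [|i] _ //|t h].
by split; [exact: (h 0%N)|exact: (h 1%N)].
Qed.

End suslin.

Lemma suslin_preimage (T U : topologicalType) (p : T -> U) (A : set U) :
  continuous p -> suslin A -> suslin (p @^-1` A).
Proof.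
move=> cp [K [[cK lK] ->]]; exists (fun n s => p @^-1` K n s); split => //.
split=> n s.
  by apply: preimage_closed => [x _|]; [exact: cp|exact: cK].
by have [N HN] := lK n s; exists N => s' /HN ->.
Qed.

Section suslin_borel.
Context {R : realType} {T : pseudoMetricType R}.

Lemma suslin_open (U : set T) : open U -> suslin U.
Proof.
move=> oU.
pose C n := closure [set x | ball x (n.+1%:R^-1 : R) `<=` U].
rewrite (_ : U = \bigcup_n C n).
  by apply: suslin_bigcup => n; apply: suslin_closed; exact: closed_closure.
apply/seteqP; split => [x Ux|x [n _ Cx]].
  have /nbhs_ballP[e /= e0 eU] : nbhs x U by exact: open_nbhs_nbhs.
  have [n] := ltr_add_invr e0; rewrite add0r => ne.
  exists n => //; apply: subset_closure => /= y xy; apply: eU.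
  exact: le_ball (ltW ne) _ xy.
have [|y [/= yU xy]] := Cx (ball x (n.+1%:R^-1 : R)).
  by apply: nbhsx_ballx; rewrite invr_gt0.
by apply: yU; exact: ball_sym.
Qed.

Lemma suslin_borel (A : set T) :
  <<s [set U : set T | open U] >> A -> suslin A.
Proof.
move=> bA; suff [] : suslin A /\ suslin (~` A) by [].
move: A bA; apply: (@smallest_sub _ _ _ [set A | suslin A /\ suslin (~` A)]).
  split=> /=.
  - split; first by apply: suslin_closed; exact: closed0.
    by rewrite setC0; apply: suslin_closed; exact: closedT.
  - by move=> A [sA sAC]; rewrite setTD setCK.
  - move=> A /all_and2[sA sAC]; split; first exact: suslin_bigcup.
    by rewrite setC_bigcup; exact: suslin_bigcap.
move=> U /= oU; split; first exact: suslin_open.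
by apply: suslin_closed; exact: open_closedC.
Qed.

End suslin_borel.

(** Otherwise the decreasing finite intersections would all meet the compact
    complement of [U], and so would their intersection. *)
Lemma compact_bigcap_sub (T : topologicalType) (K : nat -> set T) (U : set T) :
  compact [set: T] -> (forall n, closed (K n)) -> open U ->
  \bigcap_n K n `<=` U ->
  exists N, [set t | forall n, (n < N)%N -> K n t] `<=` U.
Proof.
move=> /compact_near_coveringP cT cK oU KU.
pose Q N t := U t \/ exists2 n, (n < N)%N & ~ K n t.
have [t _|N _ HN] := cT nat \oo Q _.
  have [Ut|nUt] := pselect (U t).
    exists (U, setT); first by split => //=; [exact: open_nbhs_nbhs|exists 0%N].
    by move=> [x n] /= [Ux _]; left.
  have : ~ (\bigcap_n K n) t by move=> /KU.
  move=> /existsNP[n /not_implyP[_ Kn]].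
  exists (~` K n, [set N | (n < N)%N]).
    split => /=; last by exists n.+1.
    by apply: open_nbhs_nbhs; split => //; exact: closed_openC.
  by move=> [x N] /= [Kx nN]; right; exists n.
exists N => t Kt; have [//|[n nN []]] := HN N (leqnn N) t I.
exact: Kt.
Qed.

Lemma compact_finite_balls (R : numFieldType) (T : pseudoMetricType R) (e : R) :
  compact [set: T] -> 0 < e ->
  exists l : seq T, forall x, exists2 c, c \in l & (ball c e)° x.
Proof.
move=> /compact_near_coveringP cT e0.
pose F := filter_from setT (fun l0 : seq T => [set l : seq T | {subset l0 <= l}]).
pose Q (l : seq T) x := exists2 c, c \in l & (ball c e)° x.
have FF : Filter F.
  apply: filter_from_filter; first by exists [::].
  move=> l1 l2 _ _; exists (l1 ++ l2) => // l h.
  by split => x xl; apply: h; rewrite mem_cat xl ?orbT.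
have [x _|l _ Hl] := cT (seq T) F Q FF.
  exists ((ball x e)°, [set l : seq T | x \in l]).
    split=> /=; last by exists [:: x] => // l /=; apply; rewrite inE.
    by apply: nbhs_interior; exact: nbhsx_ballx.
  by move=> [y l] /= [xy xl]; exists x.
by exists l => x; exact: (Hl l _ x I).
Qed.

Section separation.
Context {d : measure_display} {R : realType} {X : measurableMetricType d R}.
Hypothesis X_borel : @measurable d X = <<s [set U : set X | open U] >>.
Hypothesis X_compact : compact [set: X].

Lemma open_measurable_metric (U : set X) : open U -> measurable U.
Proof. by move=> oU; rewrite X_borel; exact: sub_sigma_algebra. Qed.

Definition borel_separated (S1 S2 : set X) :=
  exists2 B, measurable B & S1 `<=` B /\ S2 `<=` ~` B.

Lemma borel_separated_bigcup (S1 S2 : nat -> set X) :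
  (forall i j, borel_separated (S1 i) (S2 j)) ->
  borel_separated (\bigcup_i S1 i) (\bigcup_j S2 j).
Proof.
move=> h.
have /choice[B HB] : forall ij : nat * nat, exists B,
    [/\ measurable B, S1 ij.1 `<=` B & S2 ij.2 `<=` ~` B].
  by move=> [i j]; have [B mB [? ?]] := h i j; exists B.
exists (\bigcup_i \bigcap_j B (i, j)).
  apply: bigcup_measurable => i _; apply: bigcap_measurable => [|j _].
    by exists 0%N.
  by have [] := HB (i, j).
split => [x [i _ Sx]|x [j _ Sx] [i _ Bx]].
  by exists i => // j _; have [_ h1 _] := HB (i, j); exact: h1.
by have [_ _ h2] := HB (i, j); exact: (h2 _ Sx (Bx j I)).
Qed.

Section scheme.
Context {T : topologicalType} (p : T -> X).
Hypotheses (T_compact : compact [set: T]) (p_cts : continuous p).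

Let part (K : nat -> (nat -> nat) -> set T) N s :=
  p @` [set t | exists2 s', agree N s s' & forall n, K n s' t].

Let upd (s : nat -> nat) (N a : nat) := fun i => if i == N then a else s i.

Let part_split K N s : part K N s = \bigcup_a part K N.+1 (upd s N a).
Proof.
apply/seteqP; split => [x [t [s' ss' Kt] <-]|x [a _ [t [s' ss' Kt] <-]]].
  exists (s' N) => //; exists t => //; exists s' => // i.
  rewrite ltnS leq_eqVlt /upd => /orP[/eqP ->|iN]; first by rewrite eqxx.
  by rewrite ifN ?ss' // ltn_eqF.
exists t => //; exists s' => // i iN; rewrite -ss' ?(ltnW iN)//.
  by rewrite /upd ifN // ltn_eqF.
by rewrite ltnS ltnW.
Qed.

(** If no Borel set separated the two images, then neither would one separate
    the images of some branch of the first scheme from those of some branch of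
    the second, down to every depth. But along two full branches the closed sets
    decrease to disjoint compact images, which have disjoint open
    neighbourhoods. *)
Lemma suslin_separation (A1 A2 : set T) : suslin A1 -> suslin A2 ->
  p @` A1 `&` p @` A2 = set0 -> borel_separated (p @` A1) (p @` A2).
Proof.
move=> [K [[cK lK] A1E]] [L [[cL lL] A2E]] A12; apply: contrapT => nsep.
pose bad N (st : (nat -> nat) * (nat -> nat)) :=
  ~ borel_separated (part K N st.1) (part L N st.2).
have next N st : bad N st -> exists ab : nat * nat,
    bad N.+1 (upd st.1 N ab.1, upd st.2 N ab.2).
  move=> b; apply: contrapT => /forallNP h; apply: b.
  rewrite !part_split; apply: borel_separated_bigcup => a b.
  by have /= /contrapT := h (a, b).
pose S := {Nst : nat * ((nat -> nat) * (nat -> nat)) | bad Nst.1 Nst.2}.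
have b0 : bad 0%N (cst 0%N, cst 0%N).
  have part0 M s : part M 0%N s = p @` [set t | exists s', forall n, M n s' t].
    apply/seteqP; split => [x [t [s' _ h] <-]|x [t [s' h] <-]].
      by exists t => //; exists s'.
    by exists t => //; exists s'.
  by rewrite /bad /= !part0 -A1E -A2E.
have /choice[stp stpP] : forall Nst : S, exists ab : nat * nat,
    bad (sval Nst).1.+1 (upd (sval Nst).2.1 (sval Nst).1 ab.1,
                         upd (sval Nst).2.2 (sval Nst).1 ab.2).
  by move=> [[N st] /= b]; exact: next.
pose nextS (u : S) : S := exist (fun Nst => bad Nst.1 Nst.2)
  ((sval u).1.+1, (upd (sval u).2.1 (sval u).1 (stp u).1,
                   upd (sval u).2.2 (sval u).1 (stp u).2)) (stpP u).
pose it n : S := iter n nextS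
  (exist (fun Nst => bad Nst.1 Nst.2) (0%N, (cst 0%N, cst 0%N)) b0).
have itN n : (sval (it n)).1 = n by elim: n => //= n ->.
pose s1 i := (sval (it i.+1)).2.1 i; pose s2 i := (sval (it i.+1)).2.2 i.
have mono n k i : (i < n)%N -> (sval (it (n + k)%N)).2.1 i = (sval (it n)).2.1 i
    /\ (sval (it (n + k)%N)).2.2 i = (sval (it n)).2.2 i.
  move=> lin; elim: k => [|k IH]; first by rewrite addn0.
  rewrite addnS /= /upd !itN ifN; last by rewrite ltn_eqF// ltn_addr.
  by rewrite ifN // ltn_eqF// ltn_addr.
have agr n : agree n s1 (sval (it n)).2.1 /\ agree n s2 (sval (it n)).2.2.
  by split => i lin; have := mono i.+1 (n - i.+1)%N i; rewrite subnKC//;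
    case=> // -> ->.
have bads n : ~ borel_separated (part K n s1) (part L n s2).
  have part_agree M s s' : agree n s s' -> part M n s = part M n s'.
    move=> ss'; apply/seteqP; split => x [t [u su h] <-]; exists t => //;
      exists u => // i lin; first by rewrite -ss'// su.
    by rewrite ss'// su.
  have := svalP (it n); rewrite /bad itN; have [a1 a2] := agr n.
  by rewrite (part_agree K _ _ a1) (part_agree L _ _ a2).
have cl (M : nat -> (nat -> nat) -> set T) s : (forall n s, closed (M n s)) -> closed (p @` (\bigcap_n M n s)).
  move=> cM; apply: compact_closed; first exact: metric_hausdorff.
  apply: continuous_compact; first exact: continuous_subspaceT.
  apply: (subclosed_compact _ T_compact) => //.
  exact: closed_bigI.
have nX : normal_space X.
  by apply: compact_normal => //; exact: metric_hausdorff.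
have disj : p @` (\bigcap_n K n s1) `&` p @` (\bigcap_n L n s2) = set0.
  apply/seteqP; split => // x [[t Kt <-] [t' Lt' tt']].
  have : (p @` A1 `&` p @` A2) (p t).
    split; first by exists t => //; rewrite A1E; exists s1 => n; exact: Kt.
    by rewrite -tt'; exists t' => //; rewrite A2E; exists s2 => n; exact: Lt'.
  by rewrite A12.
have [U [V [oU oV KU LV UV]]] :=
  (@normal_openP R _).1 nX _ _ (cl K s1 cK) (cl L s2 cL) disj.
have find (M : nat -> (nat -> nat) -> set T) s W : (forall n s, closed (M n s)) ->
    (forall n s, exists N, forall s', agree N s s' -> M n s' = M n s) ->
    open W -> p @` (\bigcap_n M n s) `<=` W ->
    exists N, forall N', (N <= N')%N -> part M N' s `<=` W.
  move=> cM lM oW MW.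
  have [|||N HN] := @compact_bigcap_sub T (fun n => M n s) (p @^-1` W) T_compact.
  - by move=> n; exact: cM.
  - by apply: open_comp => // x _; exact: p_cts.
  - by move=> t Mt; apply: MW; exists t.
  have /choice[B HB] := lM^~ s.
  exists (\max_(j < N) B j)%N => N' BN' x [t [s' ss' Mt] <-]; apply: HN => n nN.
  rewrite -(HB n s') // => i iB; apply: ss'.
  apply: (leq_trans iB); apply: leq_trans BN'.
  exact: (leq_bigmax (Ordinal nN)).
have [N1 H1] := find K s1 U cK lK oU KU.
have [N2 H2] := find L s2 V cL lL oV LV.
apply: (bads (maxn N1 N2)); exists U; first exact: open_measurable_metric.
split; first exact/H1/leq_maxl.
move=> x /(H2 _ (leq_maxr _ _)) Vx Ux.
by have : (U `&` V) x by []; rewrite UV.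
Qed.

End scheme.

Lemma suslin_graph (g : X -> X) : measurable_fun setT g ->
  suslin [set xy : X * X | g xy.1 = xy.2].
Proof.
move=> mg.
have [x0|nX] := pselect (exists x0 : X, True); last first.
  rewrite (_ : [set _ | _] = set0); first exact/suslin_closed/closed0.
  by apply/seteqP; split => // -[x y] _; apply: nX; exists x.
have {x0} /choice[c Hc] : forall n : nat, exists c : nat -> X,
    forall x, exists i, (ball (c i) (n.+1%:R^-1 : R))° x.
  move=> n; have [x1 _] := x0.
  have [//|l Hl] := @compact_finite_balls R X n.+1%:R^-1 X_compact.
  exists (nth x1 l) => x; have [y yl yx] := Hl x.
  by exists (index y l); rewrite nth_index.
have -> : [set xy : X * X | g xy.1 = xy.2] =
    \bigcap_n \bigcup_i
      ((fst @^-1` (g @^-1` (ball (c n i) (n.+1%:R^-1 : R))°)) `&`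
       (snd @^-1` (ball (c n i) (n.+1%:R^-1 : R))°)).
  apply/seteqP; split => [[x y] /= <- n _|[x y] /= h].
    by have [i Hi] := Hc n (g x); exists i.
  apply: (close_eq (@metric_hausdorff _ X)); rewrite ball_close => e.
  have [n] := ltr_add_invr (divr_gt0 (gt0 e) (ltr0Sn R 1)); rewrite add0r => ne.
  have [i _ [/= /interior_subset gx /interior_subset cy]] := h n I.
  rewrite (splitr e%:num); apply: ball_triangle (le_ball (ltW ne) cy).
  by apply: ball_sym; exact: le_ball (ltW ne) _ gx.
apply: suslin_bigcap => n; apply: suslin_bigcup => i; apply: suslin_setI.
  apply: suslin_preimage; first by move=> x; exact: cvg_fst.
  apply: suslin_borel; rewrite -X_borel -[_ @^-1` _]setTI; apply: mg => //.
  by apply: open_measurable_metric; exact: open_interior.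
apply: suslin_preimage; first by move=> x; exact: cvg_snd.
by apply: suslin_open; exact: open_interior.
Qed.

(** The images of the two parts of [b] are disjoint Suslin sets with Borel union,
    so a Borel set separating them cuts the image of [A] out of [g @` b]. *)
Lemma measurable_image_inj (g : X -> X) (b A : set X) :
  measurable_fun setT g -> measurable b -> set_inj b g -> measurable (g @` b) ->
  measurable A -> A `<=` b -> measurable (g @` A).
Proof.
move=> mg mb gi mgb mA Ab.
pose G := [set xy : X * X | g xy.1 = xy.2].
have imE (E : set X) : snd @` (G `&` (fst @^-1` E)) = g @` E.
  apply/seteqP; split => [y [[x y'] [/= Gx Ex] <-]|y [x Ex <-]].
    by exists x.
  by exists (x, g x).
have sus (E : set X) : measurable E -> suslin (G `&` (fst @^-1` E)).
  move=> mE; apply: suslin_setI; first exact: suslin_graph.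
  apply: suslin_preimage; first by move=> x; exact: cvg_fst.
  by apply: suslin_borel; rewrite -X_borel.
have mbA : measurable (b `\` A) by exact: measurableD.
have cXX : compact [set: X * X].
  by have := compact_setX X_compact X_compact; rewrite setXTT.
have csnd : continuous (snd : X * X -> X) by move=> x; exact: cvg_snd.
have disj : snd @` (G `&` (fst @^-1` A)) `&` snd @` (G `&` (fst @^-1` (b `\` A))) = set0.
  rewrite !imE; apply/seteqP; split => // y [[x Ax <-] [x' [bx' nAx'] gx]].
  by apply: nAx'; rewrite (gi _ _ _ _ gx) ?inE//; exact: Ab.
have [B mB [AB bAB]] := suslin_separation cXX csnd (sus _ mA) (sus _ mbA) disj.
rewrite !imE in AB bAB.
rewrite (_ : g @` A = (g @` b) `&` B); first exact: measurableI.
apply/seteqP; split => [y Ay|y [[x bx <-] Bx]].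
  by split; [case: Ay => x Ax <-; exists x => //; exact: Ab|exact: AB].
have [Ax|nAx] := pselect (A x); first by exists x.
by exfalso; apply: (bAB (g x)) => //; exists x.
Qed.

End separation.

(** * Exact maps merge absolutely continuous laws *)

Section bounded_integrals.
Context {d : measure_display} {R : realType} {X : measurableType d}.
Implicit Types (l : probability X R) (g h : X -> R).

Definition unit_valued g := measurable_fun setT g /\ forall x, 0 <= g x <= 1.

Lemma bounded_integrable l g (M : R) : measurable_fun setT g ->
  (forall x, `|g x| <= M) -> l.-integrable setT (EFin \o g).
Proof.
move=> mg gM; apply: measurable_bounded_integrable => //.
  by apply: le_lt_trans (probability_le1 l measurableT) _; rewrite ltry.
exists M; split; first by rewrite num_real.
by move=> t Mt x _ /=; exact: le_trans (gM x) (ltW Mt).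
Qed.

Lemma unit_integrable l g : unit_valued g -> l.-integrable setT (EFin \o g).
Proof.
move=> [mg g01]; apply: (@bounded_integrable _ _ 1) => // x.
by have /andP[g0 g1] := g01 x; rewrite ger0_norm.
Qed.

Lemma unit_indic (B : set X) : measurable B -> unit_valued (\1_B : X -> R).
Proof.
move=> mB; split; first exact: measurable_indic.
by move=> x; rewrite indicE ler0n lern1 leq_b1.
Qed.

Lemma unit_mid g h : unit_valued g -> unit_valued h ->
  unit_valued (fun x => (g x + h x) / 2).
Proof.
move=> [mg g01] [mh h01]; split.
  by apply: measurable_funM => //; apply: measurable_funD.
by move=> x; have /andP[? ?] := g01 x; have /andP[? ?] := h01 x; lra.
Qed.

Lemma unit_sqr g : unit_valued g -> unit_valued (fun x => g x ^+ 2).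
Proof.
move=> [mg g01]; split; first exact: measurable_funX.
by move=> x; have /andP[? ?] := g01 x; rewrite sqr_ge0/= expr_le1.
Qed.

Lemma Rintegral_indic l (B : set X) : measurable B ->
  \int[l]_x (\1_B x : R) = fine (l B).
Proof.
by move=> mB; rewrite /Rintegral integral_indic// setIT.
Qed.

Lemma Rintegral_unit l g : unit_valued g -> 0 <= \int[l]_x g x <= 1.
Proof.
move=> ug; apply/andP; split.
  by apply: Rintegral_ge0 => x _; have /andP[] := ug.2 x.
have -> : 1 = \int[l]_(x in setT) (cst 1 x) :> R.
  rewrite Rintegral_cst// mul1r.
  by have /= -> := probability_setT l.
apply: le_Rintegral => //; first exact: unit_integrable.
  by apply: unit_integrable; split => // x; rewrite ler01 lexx.
by move=> x _; have /andP[] := ug.2 x.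
Qed.

Lemma Rintegral_mid l g h : unit_valued g -> unit_valued h ->
  \int[l]_x ((g x + h x) / 2) = (\int[l]_x g x + \int[l]_x h x) / 2.
Proof.
move=> ug uh.
under eq_Rintegral do rewrite mulrC.
rewrite RintegralZl//; last first.
  apply: (@bounded_integrable _ _ 2); first by apply: measurable_funD; [case: ug|case: uh].
  move=> x; have /andP[? ?] := ug.2 x; have /andP[? ?] := uh.2 x.
  by rewrite ger0_norm; lra.
rewrite RintegralD//; [|exact: unit_integrable|exact: unit_integrable].
by rewrite mulrC.
Qed.

(** The parallelogram identity. *)
Lemma Rintegral_sqr_sub l g h : unit_valued g -> unit_valued h ->
  \int[l]_x ((g x - h x) ^+ 2) = 2 * \int[l]_x (g x ^+ 2)
    + 2 * \int[l]_x (h x ^+ 2) - 4 * \int[l]_x (((g x + h x) / 2) ^+ 2).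
Proof.
move=> ug uh.
have i2 (u : X -> R) : unit_valued u -> l.-integrable setT (EFin \o (fun x => u x ^+ 2)).
  by move=> uu; apply/unit_integrable/unit_sqr.
have i3 (u : X -> R) (c : R) : unit_valued u ->
    l.-integrable setT (EFin \o (fun x => c * u x ^+ 2)).
  move=> uu; rewrite (_ : _ \o _ = (fun x => (c%:E * (u x ^+ 2)%R%:E)%E))//.
  by apply: integrableZl => //; exact: i2.
rewrite -!RintegralZl//; [|exact/i2/unit_mid|exact: i2|exact: i2].
rewrite -RintegralD//; [|exact: i3|exact: i3].
rewrite -RintegralB//; [|..|apply: (i3 (fun x => (g x + h x) / 2)); exact: unit_mid]; last first.
  by apply: (integrableD measurableT (i3 g 2 ug) (i3 h 2 uh)).
by apply: eq_Rintegral => x _; field.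
Qed.

Lemma chebyshev_sqr l g (c : R) : 0 < c -> measurable_fun setT g ->
  (forall x, `|g x| <= 1) ->
  fine (l [set x | c <= `|g x|]) <= c ^- 2 * \int[l]_x (g x ^+ 2).
Proof.
move=> c0 mg g1.
have mS : measurable [set x | c <= `|g x|].
  rewrite -[X in measurable X]setTI; apply: measurable_fun_ler => //.
  exact: measurableT_comp.
have ug : unit_valued (fun x => g x ^+ 2).
  split; first exact: measurable_funX.
  by move=> x; rewrite sqr_ge0/= -[g x ^+ 2]real_normK ?num_real// expr_le1.
rewrite -Rintegral_indic// -RintegralZl//; last exact: unit_integrable.
apply: le_Rintegral => //; first exact/unit_integrable/unit_indic.
  rewrite (_ : _ \o _ = (fun x => ((c ^- 2)%R%:E * (g x ^+ 2)%R%:E)%E))//.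
  by apply: integrableZl => //; exact: unit_integrable.
move=> x _; rewrite indicE; case: (boolP (x \in _)) => [|_].
  rewrite inE /= => cg; rewrite mulrC ler_pdivlMr ?exprn_gt0// mul1r.
  by rewrite -[g x ^+ 2]real_normK ?num_real// lerXn2r// nnegrE ltW.
by rewrite mulr_ge0// ?sqr_ge0// invr_ge0 exprn_ge0// ltW.
Qed.

End bounded_integrals.

Section merging.
Context {d : measure_display} {R : realType} {X : measurableMetricType d R}.
Variables (m : probability X R) (f : X -> X).
Hypotheses (f_meas : measurable_fun setT f) (f_exact : exact_map m f).

Lemma measurable_iter n : measurable_fun setT (iter n f).
Proof.
elim: n => [|n IH]; first exact: measurable_id.
exact: measurableT_comp.
Qed.

Lemma measurable_iter_preimage n (A : set X) : measurable A ->
  measurable (iter n f @^-1` A).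
Proof. by move=> mA; rewrite -[_ @^-1` _]setTI; exact: measurable_iter. Qed.

(** Each sublevel set of the limit belongs to the tail, so has measure 0 or 1. *)
Lemma exact_limit_constant (g : nat -> X -> R) :
  (forall j, unit_valued (g j)) ->
  (forall n, exists N, forall j, (N <= j)%N ->
     exists2 phi : X -> R, measurable_fun setT phi & g j = phi \o iter n f) ->
  {ae m, forall x, cvgn (g ^~ x)} ->
  exists t : R, {ae m, forall x, g j x @[j --> \oo] --> t}.
Proof.
move=> ug tailg cg.
pose E c := [set x | exists K, forall j, (K <= j)%N -> g j x <= c].
have E01 c : measurable (E c) /\ (m (E c) = 0%E \/ m (E c) = 1%E).
  have tE n : exists2 B, measurable B & E c = iter n f @^-1` B.
    have [N HN] := tailg n.
    have /choice[phi Hphi] : forall j, exists phi : X -> R, measurable_fun setT phi /\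
        ((N <= j)%N -> g j = phi \o iter n f).
      move=> j; have [/HN[phi mphi ->]|_] := boolP (N <= j)%N; first by exists phi.
      by exists (cst 0); split.
    exists (\bigcup_K \bigcap_(j in [set j | (maxn K N <= j)%N]) [set x | phi j x <= c]).
      apply: bigcup_measurable => K _; apply: bigcap_measurable.
        by exists (maxn K N) => /=.
      move=> j _; rewrite -[X in measurable X]setTI.
      by apply: measurable_fun_ler => //; exact: (Hphi j).1.
    apply/seteqP; split => [x [K HK]|x [K _ HK]].
      exists K => // j /=; rewrite geq_max => /andP[Kj Nj].
      by have := HK j Kj; rewrite (Hphi j).2.
    exists (maxn K N) => j Kj; have := HK j Kj => /=.
    by rewrite (Hphi j).2//; move: Kj; rewrite geq_max => /andP[].
  split; last exact: f_exact.
  by have [B mB ->] := tE 0%N.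
have monoE c c' : c <= c' -> E c `<=` E c'.
  by move=> cc' x [K HK]; exists K => j /HK gc; exact: le_trans cc'.
pose S := [set c | m (E c) = 0%E].
have E1 : E 1 = setT.
  by apply/seteqP; split => // x _; exists 0%N => j _; case/andP: ((ug j).2 x).
have EN1 : E (-1) = set0.
  apply/seteqP; split => // x [K /(_ K (leqnn _))] gK.
  by have /andP[] := (ug K).2 x; move: gK; lra.
have Sub : has_ubound S.
  exists 1 => c Sc; rewrite leNgt; apply/negP => c1; move: Sc.
  rewrite /S/= (_ : E c = setT) ?probability_setT//; first by move=> /eqP; rewrite onee_eq0.
  by apply/seteqP; split => // x _; apply: (monoE 1); rewrite ?E1// ltW.
have supS : has_sup S by split => //; exists (-1); rewrite /S/= EN1 measure0.
have tl c : c < sup S -> m (E c) = 0%E.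
  rewrite -subr_gt0 => cS; have [c' Sc'] := sup_adherent cS supS.
  rewrite opprB addrCA subrr addr0 => cc'.
  apply: (subset_measure0 (E01 c).1 (E01 c').1) => //.
  exact/monoE/ltW.
have tr c : sup S < c -> m (E c) = 1%E.
  move=> Sc; have [_ [E0|//]] := E01 c.
  by have := ub_le_sup Sub E0; rewrite leNgt Sc.
exists (sup S).
have aeE (n : nat) : {ae m, forall x, ~ E (sup S - n.+1%:R^-1) x /\ E (sup S + n.+1%:R^-1) x}.
  have n0 : 0 < n.+1%:R^-1 :> R by rewrite invr_gt0.
  exists (E (sup S - n.+1%:R^-1) `|` ~` E (sup S + n.+1%:R^-1)); split.
  - by apply: measurableU; [exact: (E01 _).1|exact/measurableC/(E01 _).1].
  - apply/eqP; rewrite -measure_le0 (le_trans (measureU2 _ _ _))//.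
    + exact: (E01 _).1.
    + exact/measurableC/(E01 _).1.
    + rewrite [X in (X + _)%E](_ : _ = 0%E); last by apply: tl; rewrite ltrBlDr ltrDl.
      rewrite [X in (_ + X)%E](_ : _ = 0%E) ?adde0//.
      have /= -> := probability_setC m (E01 (sup S + n.+1%:R^-1)).1.
      have /= -> := tr (sup S + n.+1%:R^-1) ; last by rewrite ltrDl.
      by rewrite subee.
  - move=> x /= /not_andP[/contrapT|]; first by left.
    by right.
move: cg (ae_foralln aeE); apply: filterS2 => x cgx Ex.
suff <- : limn (g^~ x) = sup S by [].
apply/eqP; rewrite eq_le !leNgt; apply/andP; split; apply/negP.
  move=> /ltr_add_invr[n]; rewrite ltNge => /negP; apply.
  have [_ [K HK]] := Ex n; apply: limr_le => //.
  by exists K.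
move=> /ltr_add_invr[n]; rewrite -ltrBrDr => Ln.
have [/(_ _)[]] := Ex n.
have [K _ HK] := cvgr_le _ cgx _ Ln.
by exists K => j /HK.
Qed.

Section near_minimal_norm.
Variables (l1 l2 : probability X R) (A : nat -> set X) (e : R).
Hypotheses (mA : forall n, measurable (A n)).

Let B n := iter n f @^-1` A n.

(** Convex combinations of the indicators of the sets [B k] with [n <= k] on
    which the two laws differ by at least [e]; midpoints are enough for the
    minimisation below. *)
Inductive dyadic_hull (n : nat) : (X -> R) -> Prop :=
| hull_indic k : (n <= k)%N -> e <= fine (l1 (B k)) - fine (l2 (B k)) ->
    dyadic_hull n (\1_(B k))
| hull_mid g h : dyadic_hull n g -> dyadic_hull n h ->
    dyadic_hull n (fun x => (g x + h x) / 2).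

Let mB k : measurable (B k). Proof. exact: measurable_iter_preimage. Qed.

Lemma dyadic_hull_unit n g : dyadic_hull n g -> unit_valued g.
Proof.
by elim=> [k _ _|{}g h _ ug _ uh]; [exact: unit_indic|exact: unit_mid].
Qed.

Lemma dyadic_hull_sub n n' g : (n <= n')%N -> dyadic_hull n' g -> dyadic_hull n g.
Proof.
move=> nn'; elim=> [k nk ek|{}g h _ ? _ ?]; last exact: hull_mid.
by apply: hull_indic => //; exact: leq_trans nk.
Qed.

Lemma dyadic_hull_tail n g : dyadic_hull n g ->
  exists2 phi : X -> R, measurable_fun setT phi & g = phi \o iter n f.
Proof.
elim=> [k nk _|{}g h _ [phi mphi ->] _ [psi mpsi ->]].
  exists (\1_(iter (k - n) f @^-1` A k)).
    exact/measurable_indic/measurable_iter_preimage.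
  apply/funext => x; rewrite /= !indicE; congr ((nat_of_bool _)%:R).
  by apply/idP/idP; rewrite !inE /B /preimage /= -iterD subnK.
exists (fun x => (phi x + psi x) / 2) => //.
by apply: measurable_funM => //; apply: measurable_funD.
Qed.

Lemma dyadic_hull_gap n g : dyadic_hull n g ->
  e <= \int[l1]_x g x - \int[l2]_x g x.
Proof.
elim=> [k _|{}g h gg eg hh eh]; first by rewrite !Rintegral_indic.
have ug := dyadic_hull_unit gg; have uh := dyadic_hull_unit hh.
by rewrite !Rintegral_mid//; lra.
Qed.

(** Near-minimisers of the quadratic norm over the decreasing hulls are close to
    one another, by the parallelogram identity. *)
Lemma near_minimal_sequence :
  (forall n, exists2 k, (n <= k)%N & e <= fine (l1 (B k)) - fine (l2 (B k))) ->
  exists2 g : nat -> X -> R, (forall j, dyadic_hull j (g j)) &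
    forall j, \int[m]_x ((g j x - g j.+1 x) ^+ 2) <= 8 ^- j.
Proof.
move=> infe.
pose q (g : X -> R) := \int[m]_x (g x ^+ 2).
pose a n := inf (q @` dyadic_hull n).
have q01 n g : dyadic_hull n g -> 0 <= q g <= 1.
  by move=> /dyadic_hull_unit/unit_sqr/(Rintegral_unit m).
have ne n : q @` dyadic_hull n !=set0.
  by have [k nk ek] := infe n; exists (q (\1_(B k))), (\1_(B k)) => //; exact: hull_indic.
have lb n : has_lbound (q @` dyadic_hull n).
  by exists 0 => _ [g /q01/andP[? _] <-].
have aq n g : dyadic_hull n g -> a n <= q g by move=> hg; apply: ge_inf => //; exists g.
have amono : {homo a : n n' / (n <= n')%N >-> n <= n'}.
  move=> n n' nn'; apply: lb_le_inf => // _ [g hg <-].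
  by apply: aq; exact: dyadic_hull_sub hg.
have aub : has_ubound (range a).
  exists 1 => _ [n _ <-]; have [_ [g hg _]] := ne n.
  by apply: le_trans (aq _ _ hg) _; have /andP[] := q01 _ _ hg.
pose s := sup (range a).
pose dl j : R := 8 ^- j.+1.
have dl0 j : 0 < dl j by rewrite invr_gt0 exprn_gt0.
have /choice[N HN] : forall j, exists N, forall n, (N <= n)%N -> s - dl j <= a n.
  move=> j; have [|_ [N _ <-] sN] := @sup_adherent _ (range a) _ (dl0 j).
    by split => //; exists (a 0%N); exact: imageP.
  by exists N => n /amono; exact: le_trans (ltW sN).
(* increasing indices from which on [a] is within [dl j] of its supremum *)
pose n_ j := (\sum_(i < j.+1) (N i).+1)%N.
have nj j : (maxn j (N j) <= n_ j)%N.
  rewrite geq_max; apply/andP; split; last first.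
    by rewrite /n_ big_ord_recr /= (leq_trans (leqnSn _))// leq_addl.
  rewrite /n_; elim: j => // j IH; rewrite big_ord_recr /= addnS ltnS.
  exact: leq_trans IH (leq_addr _ _).
have njS j : (n_ j <= n_ j.+1)%N by rewrite /n_ [X in (_ <= X)%N]big_ord_recr leq_addr.
have /choice[g Hg] : forall j, exists g, dyadic_hull (n_ j) g /\ q g <= s + dl j.
  move=> j; have [//|_ [g hg <-] qg] := @inf_adherent _ (q @` dyadic_hull (n_ j)) _ (dl0 j).
  exists g; split => //; apply: le_trans (ltW qg) _; rewrite lerD2r.
  by apply: ub_le_sup => //; exists (n_ j).
exists g => j.
  apply: dyadic_hull_sub (Hg j).1; apply: leq_trans (nj j); exact: leq_maxl.
have hS : dyadic_hull (n_ j) (g j.+1) by exact: dyadic_hull_sub (Hg j.+1).1.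
rewrite Rintegral_sqr_sub; [|exact: dyadic_hull_unit (Hg j).1|exact: dyadic_hull_unit hS].
rewrite -!/(q _).
have := aq _ _ (hull_mid (Hg j).1 hS).
have := HN j (n_ j) (leq_trans (leq_maxr _ _) (nj j)).
have := (Hg j).2; have := (Hg j.+1).2.
have -> : dl j.+1 = dl j / 8 by rewrite /dl exprS invfM mulrC.
have -> : 8 ^- j = 8 * dl j by rewrite /dl [8 ^+ j.+1]exprS invfM mulrA divff ?mul1r.
have := dl0 j; lra.
Qed.

End near_minimal_norm.

(** By Chebyshev's inequality and the Borel-Cantelli lemma, at almost every point the
    increments are eventually below [2 ^- j]. *)
Lemma ae_cvg_sqr_summable (g : nat -> X -> R) : (forall j, unit_valued (g j)) ->
  (forall j, \int[m]_x ((g j x - g j.+1 x) ^+ 2) <= 8 ^- j) ->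
  {ae m, forall x, cvgn (g ^~ x)}.
Proof.
move=> ug gsum.
pose D j := [set x | 2 ^- j <= `|g j x - g j.+1 x|].
have mg j : measurable_fun setT (fun x => g j x - g j.+1 x).
  by apply: measurable_funB; [exact: (ug j).1|exact: (ug j.+1).1].
have mD j : measurable (D j).
  rewrite -[X in measurable X]setTI; apply: measurable_fun_ler => //.
  exact: measurableT_comp.
have Dsmall j : (m (D j) <= (2 / (2 ^ j.+1)%:R)%:E)%E.
  rewrite -[m (D j)]fineK ?fin_num_measure// lee_fin.
  apply: le_trans (chebyshev_sqr m _ (mg j) _) _; first by rewrite invr_gt0 exprn_gt0.
    move=> x; have /andP[? ?] := (ug j).2 x; have /andP[? ?] := (ug j.+1).2 x.
    by rewrite ler_norml; lra.
  apply: le_trans (ler_wpM2l _ (gsum j)) _.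
    by rewrite invr_ge0 exprn_ge0// invr_ge0 exprn_ge0.
  have -> : 8 ^- j = (2 ^- j) ^+ 3 :> R.
    by rewrite (_ : 8 = 2 ^+ 3); [rewrite exprAC exprVn|rewrite -natrX].
  have -> : 2 / (2 ^ j.+1)%:R = 2 ^- j :> R.
    by rewrite natrX exprS invfM mulrA divff// mul1r.
  have : 2 ^- j != 0 :> R by rewrite invr_neq0// expf_neq0.
  by set a := 2 ^- j => a0; rewrite le_eqVlt; apply/orP; left; apply/eqP; field.
have lim0 : m (lim_sup_set D) = 0%E.
  apply: lim_sup_set_cvg0 => //.
  apply: (@le_lt_trans _ _ 2%:E); last exact: ltry.
  apply: le_trans (epsilon_trick0 xpredT (ltW (ltr0Sn R 1))).
  by apply: lee_nneseries => n *; [exact: measure_ge0|exact: Dsmall].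
exists (lim_sup_set D); split => //.
  apply: bigcap_measurable; first by exists 0%N.
  by move=> k _; apply: bigcup_measurable.
move=> x; apply: contra_notP => /existsNP[K /not_implyP[_ nD]].
have gK j : (K <= j)%N -> `|g j x - g j.+1 x| <= 2 ^- j.
  move=> Kj; rewrite leNgt; apply/negP => h; apply: nD; exists j => //.
  exact: ltW.
pose u j := g (j + K)%N x.
suff cu : cvgn u by apply/cvg_ex; have /cvg_ex[l ul] := cu; exists l; rewrite -(cvg_shiftn K).
have -> : u = (fun n => series (telescope u) n + u 0%N).
  by apply/funext => n; rewrite telescopeK /= subrK.
apply: is_cvgD; last exact: is_cvg_cst.
apply: normed_cvg.
apply: (@series_le_cvg _ _ (fun k => 2 / (2 ^ (k + 1))%:R)) => [n|n|n|].
- exact: normr_ge0.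
- by rewrite divr_ge0.
- rewrite /= /telescope /u distrC addSn; apply: le_trans (gK _ _) _; first exact: leq_addl.
  rewrite addn1 natrX exprS invfM mulrA divff// mul1r -!exprVn exprD ler_piMr// ?exprn_ge0//.
  by rewrite exprn_ile1//; lra.
exact: cvgP (@cvg_geometric_series_half R 2 0).
Qed.

(** Along near-minimisers of the quadratic norm, convex combinations of indicators
    of late preimages converge almost everywhere to a function of the tail, which
    exactness makes constant. Their integrals against the two laws then have the
    same limit, although they differ by at least [e]. *)
Lemma merging_lt (l1 l2 : probability X R) (A : nat -> set X) (e : R) :
  l1 `<< m -> l2 `<< m -> (forall n, measurable (A n)) -> 0 < e ->
  \forall n \near \oo,
    fine (l1 (iter n f @^-1` A n)) - fine (l2 (iter n f @^-1` A n)) < e.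
Proof.
move=> l1m l2m mA e0; apply: contrapT => nfar.
have [n|g hg gsum] := @near_minimal_sequence l1 l2 A e mA.
  apply: contrapT => /forall2NP h; apply: nfar; exists n => // k nk.
  by have [//|/negP] := h k; rewrite -ltNge.
have ug j := dyadic_hull_unit mA (hg j).
have [t gt] : exists t : R, {ae m, forall x, g j x @[j --> \oo] --> t}.
  apply: exact_limit_constant => //; last exact: ae_cvg_sqr_summable.
  move=> n; exists n => j nj; apply: (dyadic_hull_tail mA).
  exact: dyadic_hull_sub (hg j).
have lim (l : probability X R) : l `<< m -> \int[l]_x g j x @[j --> \oo] --> t.
  move=> lm.
  have lgt : {ae l, forall x, setT x -> (EFin \o g j) x @[j --> \oo] --> (t%:E : \bar R)}.
    have [N [mN N0 sN]] := gt; exists N; split => //.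
      by have /null_content_dominatesP/(_ N mN N0) := lm.
    move=> x h; apply: sN => /= gx; apply: h => _.
    exact: cvg_comp gx _.
  have [||||_ _] := @dominated_convergence _ _ _ l setT measurableT
    (fun j => EFin \o g j) (cst t%:E) (cst 1%E) _ _ lgt.
  - by move=> n; apply/measurable_EFinP; exact: (ug n).1.
  - exact: measurable_cst.
  - exact: finite_measure_integrable_cst.
  - apply: aeW => x n _; have /andP[? ?] := (ug n).2 x.
    by rewrite /= lee_fin ger0_norm.
  rewrite integral_cst//; have /= -> := probability_setT l.
  by rewrite mule1 => /fine_cvg.
have := cvgB (lim l1 l1m) (lim l2 l2m); rewrite subrr => /(_ _)/cvgr_lt /(_ _ e0) => -[K _ /(_ K (leqnn _)) /=].
by rewrite ltNge (dyadic_hull_gap mA (hg K)).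
Qed.

(** The sets [A n] are free to vary with [n]: the total variation distance of the
    two laws at time [n] tends to 0. *)
Theorem merging (l1 l2 : probability X R) (A : nat -> set X) :
  l1 `<< m -> l2 `<< m -> (forall n, measurable (A n)) ->
  fine (l1 (iter n f @^-1` A n)) - fine (l2 (iter n f @^-1` A n))
    @[n --> \oo] --> (0 : R).
Proof.
move=> l1m l2m mA; apply/cvgr0Pnorm_lt => e e0.
near=> n; rewrite ltr_norml; apply/andP; split; last first.
  by near: n; exact: merging_lt.
by rewrite ltrNl opprB; near: n; exact: merging_lt.
Unshelve. all: by end_near. Qed.

End merging.

(** * Gibbs-Markov maps: contraction of the cone of regular measures *)

Section finite_set_functions.
Context {d : measure_display} {R : realType} {X : measurableType d}.
Implicit Types (nu : set X -> R) (A B : set X).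

(** Finite measures with real values. Unlike bundled measures they can be
    subtracted, scaled and passed to the limit freely; continuity at [set0]
    stands for countable additivity. *)
Definition fmeas nu :=
  [/\ forall A, measurable A -> 0 <= nu A,
      forall A B, measurable A -> measurable B -> A `&` B = set0 ->
        nu (A `|` B) = nu A + nu B &
      forall A : nat -> set X, (forall n, measurable (A n)) ->
        (forall n n', (n <= n')%N -> A n' `<=` A n) -> \bigcap_n A n = set0 ->
        nu (A n) @[n --> \oo] --> 0].

Lemma fmeas_set0 nu : fmeas nu -> nu set0 = 0.
Proof.
move=> [_ addnu _].
have := addnu set0 set0 measurable0 measurable0; rewrite setI0 setU0 => /(_ erefl).
by move=> h; lra.
Qed.

Lemma fmeas_split nu A B : fmeas nu -> measurable A -> measurable B ->
  nu A = nu (A `&` B) + nu (A `\` B).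
Proof.
move=> [_ addnu _] mA mB; rewrite -addnu ?setUIDK //.
- exact: measurableI.
- exact: measurableD.
- by apply/seteqP; split => // x [[_ Bx] [_ /(_ Bx)]].
Qed.

Lemma fmeas_le nu A B : fmeas nu -> measurable A -> measurable B ->
  A `<=` B -> nu A <= nu B.
Proof.
move=> fnu mA mB AB; rewrite (fmeas_split fnu mB mA) setIidr// lerDl.
by have [nu0 _ _] := fnu; apply: nu0; exact: measurableD.
Qed.

Lemma fmeasD nu1 nu2 : fmeas nu1 -> fmeas nu2 -> fmeas (fun A => nu1 A + nu2 A).
Proof.
move=> [p1 a1 c1] [p2 a2 c2]; split.
- by move=> A mA; rewrite addr_ge0// ?p1// p2.
- by move=> A B mA mB AB; rewrite a1// a2//; lra.
- move=> A mA dA cA; rewrite -[X in _ --> X]addr0.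
  by apply: cvgD; [exact: c1|exact: c2].
Qed.

Lemma fmeasZ r nu : 0 <= r -> fmeas nu -> fmeas (fun A => r * nu A).
Proof.
move=> r0 [p a c]; split.
- by move=> A mA; rewrite mulr_ge0// p.
- by move=> A B mA mB AB; rewrite a// mulrDr.
- move=> A mA dA cA; rewrite -[X in _ --> X](mulr0 r).
  by apply: cvgM; [exact: cvg_cst|exact: c].
Qed.

Lemma fmeasB nu1 nu2 : fmeas nu1 -> fmeas nu2 ->
  (forall A, measurable A -> nu2 A <= nu1 A) -> fmeas (fun A => nu1 A - nu2 A).
Proof.
move=> [p1 a1 c1] [p2 a2 c2] le21; split.
- by move=> A mA; rewrite subr_ge0 le21.
- by move=> A B mA mB AB; rewrite a1// a2//; lra.
- move=> A mA dA cA; rewrite -[X in _ --> X](subr0 0).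
  by apply: cvgB; [exact: c1|exact: c2].
Qed.

Lemma fmeas_preimage nu (phi : set X -> set X) : fmeas nu ->
  (forall A, measurable A -> measurable (phi A)) ->
  (forall A B, A `<=` B -> phi A `<=` phi B) ->
  (forall A B, phi (A `|` B) = phi A `|` phi B) ->
  (forall A B, A `&` B = set0 -> phi A `&` phi B = set0) ->
  (forall A : nat -> set X, \bigcap_n A n = set0 -> \bigcap_n phi (A n) = set0) ->
  fmeas (fun A => nu (phi A)).
Proof.
move=> [p a c] mphi phiS phiU phiI phic; split.
- by move=> A mA; exact/p/mphi.
- move=> A B mA mB AB; rewrite phiU a//; [exact: mphi|exact: mphi|exact: phiI].
- move=> A mA dA cA; apply: c; last exact: phic.
    by move=> n; exact: mphi.
  by move=> n n' nn'; apply: phiS; exact: dA.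
Qed.

(** Continuity at [set0] disposes of the cells beyond the [n]-th. *)
Lemma fmeas_cell_le nu1 nu2 (Z : set X) (c : nat -> set X) A1 A2 (r1 r2 : R) :
  fmeas nu1 -> fmeas nu2 -> (forall k, measurable (c k)) ->
  trivIset setT c -> \bigcup_k c k = Z ->
  measurable A1 -> measurable A2 -> A1 `<=` Z -> 0 <= r1 -> 0 <= r2 ->
  (forall k, r1 * nu1 (c k `&` A1) <= r2 * nu2 (c k `&` A2)) ->
  r1 * nu1 A1 <= r2 * nu2 A2.
Proof.
move=> f1 f2 mc tc Zc m1 m2 AZ r10 r20 le12.
pose U n := \bigcup_(k in [set k | (n <= k)%N]) c k.
have mU n : measurable (U n) by apply: bigcup_measurable.
have US n : U n = c n `|` U n.+1.
  apply/seteqP; split => [x [k /= nk cx]|x [cx|[k /= nk cx]]].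
  - move: nk; rewrite leq_eqVlt => /orP[/eqP ->|nk]; first by left.
    by right; exists k.
  - by exists n => /=.
  - by exists k => //=; exact: ltnW.
have cU n : c n `&` U n.+1 = set0.
  apply/seteqP; split => // x [cx [k /= nk ckx]].
  have nk' : n = k by apply: (tc n k I I); exists x.
  by move: nk; rewrite nk' ltnn.
have dec nu A n : fmeas nu -> measurable A -> A `<=` Z ->
    nu A = \sum_(k < n) nu (c k `&` A) + nu (U n `&` A).
  move=> fnu mA sA; elim: n => [|n IH].
    rewrite big_ord0 add0r setIidr // => x /sA.
    by rewrite -Zc => -[k _ cx]; exists k.
  rewrite big_ord_recr /= IH -addrA US setIUl; congr (_ + _).
  have [_ add _] := fnu; rewrite add//; [exact: measurableI|exact: measurableI|].
  by rewrite setIACA cU set0I.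
have ub n : r1 * nu1 A1 <= r2 * nu2 A2 + r1 * nu1 (U n `&` A1).
  rewrite (dec _ _ n f1 m1 AZ) mulrDr lerD2r mulr_sumr.
  apply: le_trans (_ : \sum_(k < n) r2 * nu2 (c k `&` A2) <= _).
    by apply: ler_sum => k _; exact: le12.
  rewrite -mulr_sumr ler_wpM2l//.
  have -> : \sum_(k < n) nu2 (c k `&` A2) = \sum_(k < n) nu2 (c k `&` (A2 `&` Z)).
    apply: eq_bigr => k _; congr nu2; apply/seteqP; split=> x [cx].
      by move=> Ax; split => //; split => //; rewrite -Zc; exists k.
    by case.
  have mZ : measurable Z by rewrite -Zc; exact: bigcup_measurable.
  have mAZ : measurable (A2 `&` Z) by exact: measurableI.
  apply: le_trans (_ : nu2 (A2 `&` Z) <= _); last exact: fmeas_le.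
  rewrite [leRHS](dec _ _ n f2 mAZ (@subIsetr _ _ _)) lerDl.
  by have [p _ _] := f2; apply: p; exact: measurableI.
have lim : r1 * nu1 (U n `&` A1) @[n --> \oo] --> (0 : R).
  rewrite -[X in _ --> X](mulr0 r1); apply: cvgM; first exact: cvg_cst.
  have [_ _ cnt] := f1; apply: cnt.
  - by move=> n; exact: measurableI.
  - move=> n n' nn' x [[k /= nk cx] Ax]; split => //; exists k => //=.
    exact: leq_trans nk.
  - apply/seteqP; split => // x h; have [[k _ cx] _] := h 0%N I.
    have [[k' /= kk' ck'x] _] := h k.+1 I.
    have : (c k `&` U k.+1) x by split => //; exists k'.
    by rewrite cU.
apply/ler_addgt0Pr => e e0.
have [n _ /(_ n (leqnn _)) /= hn] := cvgr_le _ lim _ e0.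
by apply: le_trans (ub n) _; rewrite lerD2l.
Qed.

End finite_set_functions.

Section gibbs_markov_cone.
Context {d : measure_display} {R : realType} {X : measurableType d}.
Implicit Types (nu : set X -> R) (E G H : set X).
Variables (Z : set X) (F : X -> X) (c : nat -> set X) (m : set X -> R).
Variables (theta C eta : R).
Hypotheses (mZ : measurable Z) (FZ : forall x, Z x -> Z (F x)).
Hypothesis mF : forall A, measurable A -> measurable (Z `&` F @^-1` A).
Hypotheses (mc : forall k, measurable (c k)) (tc : trivIset setT c).
Hypothesis Zc : \bigcup_k c k = Z.
Hypotheses (fm : fmeas m) (mZ1 : m Z = 1).
Hypotheses (theta01 : 0 < theta < 1) (C0 : 0 <= C) (eta0 : 0 < eta).

Local Notation J k := (F @` c k).

Hypothesis mJ : forall k, measurable (J k).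
Hypothesis markov : forall k l, J k `&` c l !=set0 -> c l `<=` J k.
Hypothesis c_pos : forall k, c k !=set0 -> 0 < m (c k).
Hypothesis J_big : forall k, c k !=set0 -> eta <= m (J k).

(** [G] and [G'] lie in one cylinder of length [q]; quantifying over the points
    avoids naming it. *)
Definition cylinder_close q (G G' : set X) := forall x y i k,
  G x -> G' y -> (i < q)%N -> c k (iter i F x) -> c k (iter i F y).

Hypothesis distortion : forall k q G G', measurable G -> measurable G' ->
  G `<=` J k -> G' `<=` J k -> cylinder_close q G G' ->
  m (c k `&` F @^-1` G) * m G' <=
    expR (C * theta ^+ q) * m (c k `&` F @^-1` G') * m G.

(** Measures whose density with respect to [m] has a logarithm that is Lipschitz
    with constant [B] on every cell, expressed through ratios of masses so that
    no version of the density need be chosen. *)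
Definition cone (B : R) (nu : set X -> R) := fmeas nu /\
  forall q G G', (1 <= q)%N -> measurable G -> measurable G' ->
    G `<=` Z -> G' `<=` Z -> cylinder_close q G G' ->
    nu G * m G' <= expR (B * theta ^+ q) * nu G' * m G.

Let cZ k : c k `<=` Z. Proof. by move=> x cx; rewrite -Zc; exists k. Qed.

Let JZ k : J k `<=` Z. Proof. by move=> _ [x /cZ/FZ ? <-]. Qed.

Let m_ge0 A : measurable A -> 0 <= m A. Proof. by have [p _ _] := fm; exact: p. Qed.

Let mpre E A : measurable E -> E `<=` Z -> measurable A ->
  measurable (E `&` F @^-1` A).
Proof.
move=> mE EZ mA; rewrite -(setIidl EZ) -setIA; apply: measurableI => //.
exact: mF.
Qed.

Lemma restricted_iter n x : Z x -> Z (iter n F x).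
Proof. by move=> Zx; elim: n => //= n; exact: FZ. Qed.

Lemma measurable_restricted_iter n E A : measurable E -> E `<=` Z -> measurable A ->
  measurable (E `&` iter n F @^-1` A).
Proof.
elim: n E A => [|n IH] E A mE EZ mA; first exact: measurableI.
rewrite (_ : _ `&` _ = E `&` F @^-1` (Z `&` iter n F @^-1` A)).
  by apply: mpre => //; exact: IH.
apply/seteqP; split => x [Ex]; rewrite /preimage/= -iterS iterSr.
  by split => //; split => //; exact/FZ/EZ.
by case.
Qed.

Lemma fmeas_push n E nu : measurable E -> E `<=` Z -> fmeas nu ->
  fmeas (fun A => nu (E `&` iter n F @^-1` A)).
Proof.
move=> mE EZ fnu; apply: (@fmeas_preimage _ _ _ nu (fun A => E `&` iter n F @^-1` A)) => //.
- by move=> A mA; exact: measurable_restricted_iter.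
- by move=> A B AB x [Ex Ax]; split => //; exact: AB.
- by move=> A B; rewrite preimage_setU setIUr.
- move=> A B AB; apply/seteqP; split => // x [[_ Ax] [_ Bx]].
  by have : (A `&` B) (iter n F x) by []; rewrite AB.
- move=> A A0; apply/seteqP; split => // x h.
  have : (\bigcap_n A n) (iter n F x) by move=> i _; have [] := h i I.
  by rewrite A0.
Qed.

Let cell_le nu1 nu2 A1 A2 r1 r2 : fmeas nu1 -> fmeas nu2 ->
  measurable A1 -> measurable A2 -> A1 `<=` Z -> 0 <= r1 -> 0 <= r2 ->
  (forall k, r1 * nu1 (c k `&` A1) <= r2 * nu2 (c k `&` A2)) ->
  r1 * nu1 A1 <= r2 * nu2 A2.
Proof. by move=> *; apply: (fmeas_cell_le (c := c) (Z := Z)). Qed.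

Lemma cylinder_close_pre k q G G' : cylinder_close q G G' ->
  cylinder_close q.+1 (c k `&` F @^-1` G) (c k `&` F @^-1` G').
Proof.
move=> h x y [|i] l [cx Gx] [cy Gy] iq /=.
  by move=> clx; have <- : k = l by apply: (tc I I); exists x.
by rewrite -!iterS !iterSr; exact: h.
Qed.

(** The distortion of one inverse branch adds to that inherited from [nu], which
    the extra symbol has already contracted by the factor [theta]. *)
Lemma cone_cell_push B nu k q G G' : 0 <= B -> cone B nu ->
  measurable G -> measurable G' -> G `<=` J k -> G' `<=` J k ->
  cylinder_close q G G' ->
  nu (c k `&` F @^-1` G) * m G' <=
    expR ((B * theta + C) * theta ^+ q) * nu (c k `&` F @^-1` G') * m G.
Proof.
move=> B0 [fnu cnu] mG mG' GJ G'J GG'.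
have nu0 A : measurable A -> 0 <= nu A by have [p _ _] := fnu; exact: p.
have mpG : measurable (c k `&` F @^-1` G) by apply: mpre.
have mpG' : measurable (c k `&` F @^-1` G') by apply: mpre.
have sub H : c k `&` F @^-1` H `<=` Z by move=> x [/cZ].
have h1 := cnu q.+1 _ _ isT mpG mpG' (sub _) (sub _) (cylinder_close_pre (k := k) GG').
have h2 := distortion mG mG' GJ G'J GG'.
have [m0|m0] := eqVneq (m (c k `&` F @^-1` G')) 0.
  suff -> : m G' = 0.
    by rewrite mulr0 mulr_ge0 ?m_ge0// mulr_ge0 ?expR_ge0 ?nu0.
  have [ck0|/set0P ck0] := eqVneq (c k) set0.
    have -> : G' = set0 by apply/seteqP; split => // y /G'J; rewrite ck0 => -[].
    exact: fmeas_set0.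
  have := @distortion k 0 (J k) G' (mJ k) mG' (@subset_refl _ _) G'J.
  rewrite m0 mulr0 mul0r setIidl; last by move=> x cx; exists x.
  move=> /(_ _) h; have {}h : m (c k) * m G' <= 0 by apply: h => x y.
  by apply/eqP; rewrite eq_le m_ge0// andbT -(pmulr_rle0 _ (c_pos ck0)).
have {}m0 : 0 < m (c k `&` F @^-1` G') by rewrite lt_neqAle eq_sym m0 m_ge0.
have -> : (B * theta + C) * theta ^+ q = B * theta ^+ q.+1 + C * theta ^+ q.
  by rewrite mulrDl -mulrA -exprS.
rewrite expRD -(ler_pM2r m0).
have h3 : nu (c k `&` F @^-1` G) * m (c k `&` F @^-1` G') * m G' <=
    expR (B * theta ^+ q.+1) * nu (c k `&` F @^-1` G') *
      (m (c k `&` F @^-1` G) * m G').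
  by rewrite mulrA; apply: ler_wpM2r => //; exact: m_ge0.
rewrite mulrAC; apply: le_trans h3 _.
apply: le_trans (ler_wpM2l _ h2) _.
  by rewrite mulr_ge0 ?expR_ge0 ?nu0.
by rewrite le_eqVlt; apply/orP; left; apply/eqP; ring.
Qed.

(** The solution of [B * theta + C = B - 1]: pushing forward improves the constant
    by 1, which leaves room for the subtraction of a multiple of [m]. *)
Definition cone_const : R := (C + 1) / (1 - theta).

Let B := cone_const.

Lemma cone_constE : B * theta + C = B - 1.
Proof.
have t1 : 1 - theta != 0 by rewrite subr_eq0; have /andP[_ /lt_eqF] := theta01; rewrite eq_sym => ->.
by rewrite /B /cone_const; field.
Qed.

Lemma cone_const_ge1 : 1 <= B.
Proof.
have /andP[t0 t1] := theta01.
by rewrite /B /cone_const ler_pdivlMr ?subr_gt0//; have := C0; lra.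
Qed.

Let B_ge0 : 0 <= B. Proof. exact: le_trans ler01 cone_const_ge1. Qed.

Lemma cone_weaken B1 B2 nu : B1 <= B2 -> cone B1 nu -> cone B2 nu.
Proof.
move=> B12 [fnu cnu]; split => // q G G' q1 mG mG' GZ G'Z GG'.
apply: le_trans (cnu q G G' q1 mG mG' GZ G'Z GG') _.
apply: ler_wpM2r; first exact: m_ge0.
apply: ler_wpM2r; first by have [p _ _] := fnu; exact: p.
rewrite ler_expR ler_wpM2r// exprn_ge0//.
by have /andP[/ltW] := theta01.
Qed.

Lemma cone_base : cone B m.
Proof.
split => // q G G' _ mG mG' _ _ _; rewrite -mulrA [m G' * _]mulrC.
rewrite ler_peMl ?mulr_ge0 ?m_ge0// -expR0 ler_expR mulr_ge0//.
by rewrite exprn_ge0//; have /andP[/ltW] := theta01.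
Qed.

(** Cell by cell, the two sets lie in the same element, hence both or neither in
    the image of the cell. *)
Lemma cone_push_cell k nu : cone B nu ->
  cone (B - 1) (fun A => nu (c k `&` F @^-1` A)).
Proof.
move=> cnu; have fnu := cnu.1; split.
  exact: (@fmeas_push 1 _ nu (mc k) (@cZ k) fnu).
move=> q G G' q1 mG mG' GZ G'Z GG'.
have [[y [Gy Jy]]|nG] := pselect (exists y, G y /\ J k y); last first.
  rewrite (_ : _ `&` _ = set0) ?fmeas_set0// ?mul0r.
    rewrite mulr_ge0 ?m_ge0// mulr_ge0 ?expR_ge0//.
    by have [p _ _] := fnu; apply: p; exact: mpre.
  apply/seteqP; split => // x [cx Gx]; apply: nG; exists (F x).
  by split => //; exists x.
have G'J : G' `<=` J k.
  move=> y' Gy'; have := GZ _ Gy; rewrite -Zc => -[l _ cly].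
  apply: (@markov k l); first by exists y.
  exact: (GG' y y' 0%N l).
have [[y' Gy']|nG'] := pselect (exists y', G' y'); last first.
  rewrite (_ : G' = set0); first by rewrite (fmeas_set0 fm) mulr0 preimage_set0 setI0
      (fmeas_set0 fnu) mulr0 mul0r.
  by apply/seteqP; split => // x G'x; apply: nG'; exists x.
have GJ : G `<=` J k.
  move=> z Gz; have := GZ _ Gz; rewrite -Zc => -[l _ clz].
  apply: (@markov k l) => //; exists y'; split; first exact: G'J.
  exact: (GG' z y' 0%N l).
by rewrite -cone_constE; exact: cone_cell_push.
Qed.

Lemma cone_sum_cells B' nu E phi : cone B nu -> measurable E -> E `<=` Z ->
  fmeas (fun A => nu (E `&` phi A)) ->
  (forall A, measurable A -> A `<=` Z -> measurable (E `&` phi A)) ->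
  (forall k, cone B' (fun A => nu (c k `&` (E `&` phi A)))) ->
  cone B' (fun A => nu (E `&` phi A)).
Proof.
move=> [fnu _] mE EZ fphi mphi ck; split => // q G G' q1 mG mG' GZ G'Z GG'.
have -> : expR (B' * theta ^+ q) * nu (E `&` phi G') * m G =
    (expR (B' * theta ^+ q) * m G) * nu (E `&` phi G') by rewrite mulrAC.
rewrite mulrC; apply: cell_le => //.
- exact: mphi.
- exact: mphi.
- by move=> x [/EZ].
- exact: m_ge0.
- by rewrite mulr_ge0 ?expR_ge0 ?m_ge0.
- by move=> k; rewrite mulrC mulrAC; exact: (ck k).2.
Qed.

Lemma cone_push nu : cone B nu -> cone (B - 1) (fun A => nu (Z `&` F @^-1` A)).
Proof.
move=> cnu; apply: cone_sum_cells => //.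
- exact: (@fmeas_push 1 Z nu mZ _ cnu.1).
- by move=> A mA _; exact: mF.
- move=> k; rewrite (_ : (fun A => _) = (fun A => nu (c k `&` F @^-1` A))).
    exact: cone_push_cell.
  by apply/funext => A; rewrite setIA (setIidl (@cZ k)).
Qed.

Lemma cone_push_iter n nu : cone B nu ->
  cone B (fun A => nu (Z `&` iter n F @^-1` A)).
Proof.
elim: n nu => [|n IH] nu cnu.
  split; first exact: (@fmeas_push 0 Z nu mZ (@subset_refl _ _) cnu.1).
  move=> q G G' q1 mG mG' GZ G'Z GG'.
  by rewrite !setIidr//; exact: cnu.2.
rewrite (_ : (fun A => _) = (fun A =>
    nu (Z `&` F @^-1` (Z `&` iter n F @^-1` A)))).
  by apply: (IH (fun A => nu (Z `&` F @^-1` A))); apply: cone_weaken (cone_push cnu);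
     rewrite gerBl.
apply/funext => A; congr (nu _); apply/seteqP; split => x; last first.
  by move=> [Zx [_ Ax]]; split => //; move: Ax; rewrite /preimage /= -iterS iterSr.
move=> [Zx Ax]; split => //; split; first exact: FZ.
by move: Ax; rewrite /preimage /= -iterS iterSr.
Qed.

(** Unions of cylinders of length [g]. The sets on which the first [g] return times
    are prescribed are of this kind. *)
Fixpoint adapted (g : nat) (E : set X) : Prop :=
  if g is g'.+1 then [/\ measurable E, E `<=` Z & forall k, exists2 E',
    adapted g' E' & c k `&` E = c k `&` F @^-1` E']
  else E = Z \/ E = set0.

Lemma adapted_measurable g E : adapted g E -> measurable E /\ E `<=` Z.
Proof.
case: g => [|g []//]; case=> ->; split => //; exact: measurable0.
Qed.

Let adapted_cell g E E' A k : adapted g E' -> c k `&` E = c k `&` F @^-1` E' ->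
  c k `&` (E `&` iter g.+1 F @^-1` A) = c k `&` F @^-1` (E' `&` iter g F @^-1` A).
Proof.
move=> aE' EE'; rewrite setIA EE' -setIA; congr (_ `&` _).
by rewrite preimage_setI; congr (_ `&` _); apply/funext => x; rewrite /preimage /= -iterS iterSr.
Qed.

(** The restriction to cylinders of length [g] is undone by [g] steps, cell by
    cell; so laws conditioned on return times stay in the cone. *)
Lemma cone_push_adapted g E nu : adapted g E -> cone B nu ->
  cone B (fun A => nu (E `&` iter g F @^-1` A)).
Proof.
elim: g E nu => [|g IH] E nu aE cnu.
  case: aE => ->; first exact: cone_push_iter 0%N nu cnu.
  split; first exact: (@fmeas_push 0 set0 nu measurable0 (@sub0set _ _) cnu.1).
  by move=> q G G' *; rewrite !set0I (fmeas_set0 cnu.1) !(mulr0, mul0r).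
have [mE EZ] := adapted_measurable aE.
apply: cone_sum_cells => //.
- exact: (@fmeas_push g.+1 E nu mE EZ cnu.1).
- by move=> A mA AZ; exact: measurable_restricted_iter.
move=> k; have [_ _ /(_ k)[E' aE' EE']] := aE.
rewrite (_ : (fun A => _) = (fun A => nu (c k `&` F @^-1` (E' `&` iter g F @^-1` A)))).
  have ck : cone B (fun A => nu (c k `&` F @^-1` A)).
    by apply: cone_weaken (cone_push_cell k cnu); rewrite gerBl.
  exact: (IH _ _ aE' ck).
by apply/funext => A; rewrite (adapted_cell _ aE' EE').
Qed.

(** In the cone a density oscillates at most by the factor [expR B] on the image of
    a cell, and this image has measure at least [eta]. *)
Definition sup_const : R := expR B / eta.

Let K := sup_const.

Lemma sup_const_gt0 : 0 < K. Proof. by rewrite divr_gt0 ?expR_gt0. Qed.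

Let nu_J nu k H : fmeas nu -> nu (c k `&` F @^-1` H) = nu (c k `&` F @^-1` (H `&` J k)).
Proof.
move=> _; congr nu; apply/seteqP; split => x [cx]; last by case.
by move=> Hx; split => //; split => //; exists x.
Qed.

Lemma cone_cell_upper k G nu : cone B nu -> measurable G -> G `<=` Z ->
  nu (c k `&` F @^-1` G) <= K * nu (c k) * m G.
Proof.
move=> cnu mG GZ; have fnu := cnu.1.
have nu0 A : measurable A -> 0 <= nu A by have [p _ _] := fnu; exact: p.
have [ck0|/set0P ck0] := eqVneq (c k) set0.
  by rewrite ck0 set0I (fmeas_set0 fnu) mulr0 mul0r.
rewrite (nu_J _ _ fnu).
have mGJ : measurable (G `&` J k) by exact: measurableI.
have GJ : G `&` J k `<=` J k by move=> x [].
have /(_ _) := @cone_cell_push B nu k 0 _ _ B_ge0 cnu mGJ (mJ k) GJ (@subset_refl _ _).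
move=> /(_ (fun x y i l _ _ h => False_ind _ (notF h))).
rewrite cone_constE expr0 mulr1 (setIidl (_ : c k `<=` F @^-1` J k)); last first.
  by move=> x cx; exists x.
move=> h; rewrite (_ : K * _ * _ = expR B * nu (c k) * m G / eta); last first.
  by rewrite /K /sup_const; ring.
rewrite ler_pdivlMr//.
apply: le_trans (ler_wpM2l (nu0 _ _) (J_big ck0)) _; first exact: mpre.
apply: le_trans h _.
apply: ler_pM => //; rewrite ?mulr_ge0 ?expR_ge0 ?m_ge0 ?nu0//.
  by rewrite ler_wpM2r ?nu0// ler_expR gerBl.
by apply: fmeas_le => // x [].
Qed.

Lemma cone_upper_adapted g E G nu : adapted g.+1 E -> cone B nu ->
  measurable G -> G `<=` Z ->
  nu (E `&` iter g.+1 F @^-1` G) <= K * nu E * m G.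
Proof.
elim: g E nu => [|g IH] E nu aE cnu mG GZ.
all: have [mE EZ] := adapted_measurable aE; have fnu := cnu.1.
all: have nu0 A : measurable A -> 0 <= nu A by have [p _ _] := fnu; exact: p.
all: rewrite mulrAC -[leLHS]mul1r; apply: cell_le => //.
all: try by (move=> x [/EZ]).
all: try by (rewrite mulr_ge0 ?m_ge0// ltW// sup_const_gt0).
all: try by exact: measurable_restricted_iter.
all: move=> k; have [_ _ /(_ k)[E' aE' EE']] := aE.
- rewrite (@adapted_cell 0 E E' G k aE' EE') mul1r EE' mulrAC.
  case: aE' => ->; last by rewrite set0I preimage_set0 setI0 (fmeas_set0 fnu) mulr0 mul0r.
  rewrite [in leRHS](setIidl (_ : c k `<=` F @^-1` Z)); last by move=> x /cZ/FZ.
  by rewrite (setIidr (_ : iter 0 F @^-1` G `<=` Z))//; exact: cone_cell_upper.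
- rewrite (@adapted_cell g.+1 E E' G k aE' EE') mul1r EE' mulrAC.
  have ck : cone B (fun A => nu (c k `&` F @^-1` A)).
    by apply: cone_weaken (cone_push_cell k cnu); rewrite gerBl.
  exact: IH aE' ck mG GZ.
Qed.

Lemma finite_eventually (T : choiceType) (S : set T) (Q : T -> nat -> Prop) :
  finite_set S -> (forall s, S s -> exists N, forall n, (N <= n)%N -> Q s n) ->
  exists N, forall n s, (N <= n)%N -> S s -> Q s n.
Proof.
move=> /finite_seqP[s ->]; elim: s => [|t s IH] H; first by exists 0%N.
have [N1 H1] := H t (mem_head _ _).
have [t' ts|N2 H2] := IH; first by apply: H; rewrite /= inE; apply/orP; right.
exists (maxn N1 N2) => n t'; rewrite geq_max => /andP[n1 n2] /=.
by rewrite inE => /orP[/eqP ->|]; [exact: H1|exact: H2].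
Qed.

(** By distortion, each step of an orbit keeps a definite proportion of the mass
    that ends in [G]. *)
Lemma path_lower n k x : c k x -> exists2 dl : R, 0 < dl &
  forall l G, c l (iter n F x) -> measurable G -> G `<=` J l ->
    dl * m G <= m (c k `&` iter n.+1 F @^-1` G).
Proof.
have step k' x' : c k' x' -> exists2 dl : R, 0 < dl &
    forall G, measurable G -> G `<=` J k' -> dl * m G <= m (c k' `&` F @^-1` G).
  move=> cx; have ck0 : c k' !=set0 by exists x'.
  exists (m (c k') / expR C); first by rewrite divr_gt0 ?expR_gt0 ?c_pos.
  move=> G mG GJ.
  have /(_ _) := @distortion k' 0 (J k') G (mJ k') mG (@subset_refl _ _) GJ.
  move=> /(_ (fun x y i l _ _ h => False_ind _ (notF h))).
  rewrite setIidl; last by move=> y cy; exists y.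
  rewrite expr0 mulr1 => h; rewrite mulrAC ler_pdivrMr ?expR_gt0//.
  apply: le_trans h _; rewrite mulrC [leRHS]mulrC; apply: ler_piMl.
    by rewrite mulr_ge0 ?expR_ge0 ?m_ge0//; exact: mpre.
  by rewrite -mZ1; exact: fmeas_le.
elim: n k x => [|n IH] k x ckx.
  have [dl dl0 H] := step k x ckx; exists dl => // l G clx mG GJ /=.
  have kl : l = k by apply: (tc I I); exists x.
  by apply: H => //; rewrite -kl.
have : Z (F x) by exact/FZ/cZ/ckx.
rewrite -Zc => -[k' _ ckFx].
have [d1 d10 H1] := step k x ckx; have [d2 d20 H2] := IH k' (F x) ckFx.
exists (d1 * d2); first by rewrite mulr_gt0.
move=> l G clx mG GJ.
have mG' : measurable (c k' `&` iter n.+1 F @^-1` G).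
  exact: measurable_restricted_iter.
have ck'J : c k' `<=` J k by apply: markov; exists (F x); split => //; exists x.
rewrite -mulrA; apply: le_trans (ler_wpM2l (ltW d10) (H2 l G _ mG GJ)) _.
  by rewrite -iterSr.
apply: le_trans (H1 _ mG' _) _; first by move=> y [/ck'J].
apply: fmeas_le => //.
- exact: mpre.
- exact: measurable_restricted_iter.
by move=> y [cy [_ Gy]]; split => //; move: Gy; rewrite /preimage /= -!iterSr -!iterS.
Qed.

Hypothesis finJ : finite_set [set J k | k in [set k | c k !=set0]].
Hypothesis mixing : forall k l, c k !=set0 -> c l !=set0 -> exists N,
  forall n, (N <= n)%N -> exists x, c k x /\ c l (iter n F x).

(** The images of cells are finitely many, so that one length and one constant
    serve for the paths between any two of them. *)
Lemma image_lower : exists (N : nat) (dl : R), 0 < dl /\ forall k G,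
  c k !=set0 -> measurable G -> G `<=` Z ->
  dl * m G <= m (J k `&` iter N F @^-1` G).
Proof.
pose S := [set J k | k in [set k | c k !=set0]].
pose Q (s s' : set X) n := exists2 dl : R, 0 < dl &
  forall G, measurable G -> G `<=` s' -> dl * m G <= m (s `&` iter n F @^-1` G).
have Q1 s s' : S s -> S s' -> exists N, forall n, (N <= n)%N -> Q s s' n.
  move=> [k [x ckx] <-] [k' ck' <-].
  have : Z (F x) by exact/FZ/cZ/ckx.
  rewrite -Zc => -[l _ clFx].
  have clJ : c l `<=` J k by apply: markov; exists (F x); split => //; exists x.
  have [N HN] := mixing (ex_intro _ _ clFx : c l !=set0) ck'.
  exists N.+1 => -[//|n] Nn; have [x' [clx' ck'x']] := HN n Nn.
  have [dl dl0 H] := path_lower n clx'.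
  exists dl => // G mG GJ; apply: le_trans (H _ _ ck'x' mG GJ) _.
  apply: fmeas_le => //.
  - exact: measurable_restricted_iter.
  - by apply: measurable_restricted_iter.
  by move=> y [/clJ].
have [N HN] : exists N, forall s s', S s -> S s' -> Q s s' N.
  have [s Ss|N HN] := @finite_eventually _ S (fun s n => forall s', S s' -> Q s s' n) finJ.
    have [N HN] := @finite_eventually _ S (fun s' n => Q s s' n) finJ (fun s' => Q1 s s' Ss).
    by exists N => n Nn s' Ss'; exact: HN.
  by exists N => s s' Ss; exact: HN.
(* constants among the inverses of integers, to choose one for all pairs of images *)
pose P (s s' : set X) j := forall G, measurable G -> G `<=` s' ->
  j.+1%:R^-1 * m G <= m (s `&` iter N F @^-1` G).
have P1 s s' : S s -> S s' -> exists j0, forall j, (j0 <= j)%N -> P s s' j.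
  move=> Ss Ss'; have [dl dl0 H] := HN s s' Ss Ss'.
  have [j0] := ltr_add_invr dl0; rewrite add0r => Kdl.
  exists j0 => j Kj G mG Gs'; apply: le_trans (H G mG Gs').
  rewrite ler_wpM2r ?m_ge0//; apply: le_trans (ltW Kdl).
  by rewrite lef_pV2 ?posrE// ler_nat.
have [j0 Hj] : exists j0, forall s s', S s -> S s' -> P s s' j0.
  have [s Ss|j0 Hj] := @finite_eventually _ S (fun s n => forall s', S s' -> P s s' n) finJ.
    have [j0 Hj] := @finite_eventually _ S (fun s' n => P s s' n) finJ (fun s' => P1 s s' Ss).
    by exists j0 => n Kn s' Ss'; exact: Hj.
  by exists j0 => s s' Ss; exact: Hj.
exists N, j0.+1%:R^-1; split => // k G ck mG GZ.
pose nu A := m (J k `&` iter N F @^-1` A).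
have fnu : fmeas nu by apply: fmeas_push.
rewrite -/(nu G) -[leRHS]mul1r; apply: cell_le => // l.
have [cl0|/set0P cl0] := eqVneq (c l) set0.
  by rewrite cl0 !set0I (fmeas_set0 fm) (fmeas_set0 fnu) !mulr0.
rewrite mul1r.
have [M HM] := mixing cl0 cl0; have [x [clx clx']] := HM M.+1 (leqnSn M).
have : Z (iter M F x) by exact/restricted_iter/cZ/clx.
rewrite -Zc => -[k' _ ck'].
have clJ : c l `<=` J k'.
  by apply: markov; exists (iter M.+1 F x); split => //; exists (iter M F x).
apply: (Hj (J k) (J k')).
- by exists k.
- by exists k' => //; exists (iter M F x).
- exact: measurableI.
- by move=> y [/clJ].
Qed.

(** After one step the mass of each cell has been spread over a whole image, from
    where a fixed number of steps reaches every part of [Z]. *)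
Lemma cone_minorized : exists (N : nat) (dl : R), 0 < dl <= 1 /\
  forall nu G, cone B nu -> measurable G -> G `<=` Z ->
  dl * nu Z * m G <= nu (Z `&` iter N.+1 F @^-1` G).
Proof.
have [N [dl [dl0 Hdl]]] := image_lower.
have main nu G : cone B nu -> measurable G -> G `<=` Z ->
    (expR (- B) * dl) * nu Z * m G <= nu (Z `&` iter N.+1 F @^-1` G).
  move=> cnu mG GZ; have fnu := cnu.1.
  have nu0 A : measurable A -> 0 <= nu A by have [p _ _] := fnu; exact: p.
  rewrite mulrAC -[leRHS]mul1r; apply: cell_le => //.
  - exact: measurable_restricted_iter.
  - by rewrite !mulr_ge0 ?expR_ge0 ?m_ge0// ltW.
  move=> k; rewrite mul1r (setIidl (@cZ k)) setIA (setIidl (@cZ k)).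
  have [ck0|/set0P ck0] := eqVneq (c k) set0.
    by rewrite ck0 !set0I (fmeas_set0 fnu) mulr0.
  pose H := J k `&` iter N F @^-1` G.
  have mH : measurable H by apply: measurable_restricted_iter.
  have HJ : H `<=` J k by move=> y [].
  have /(_ _) := @cone_cell_push B nu k 0 _ _ B_ge0 cnu (mJ k) mH (@subset_refl _ _) HJ.
  move=> /(_ (fun x y i l _ _ h => False_ind _ (notF h))).
  rewrite cone_constE expr0 mulr1 (setIidl (_ : c k `<=` F @^-1` J k)); last first.
    by move=> x cx; exists x.
  move=> h.
  have mcH : measurable (c k `&` F @^-1` H) by exact: mpre.
  apply: le_trans (_ : nu (c k `&` F @^-1` H) <= _); last first.
    apply: fmeas_le => //; first exact: measurable_restricted_iter.
    by move=> x [cx [_ Gx]]; split => //; move: Gx; rewrite /preimage /= -iterSr.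
  rewrite (_ : _ * _ * _ * _ = nu (c k) * (dl * m G) / expR B); last first.
    by rewrite expRN; ring.
  rewrite ler_pdivrMr ?expR_gt0//.
  apply: le_trans (_ : nu (c k) * m H <= _).
    by rewrite ler_wpM2l ?nu0//; exact: Hdl.
  apply: le_trans h _; rewrite mulrC.
  apply: le_trans (_ : 1 * (expR (B - 1) * nu (c k `&` F @^-1` H)) <= _).
    rewrite ler_wpM2r ?mulr_ge0 ?expR_ge0 ?nu0//.
    by rewrite -mZ1; exact: fmeas_le.
  by rewrite mul1r mulrC ler_wpM2l ?nu0// ler_expR gerBl.
exists N, (expR (- B) * dl); split => //.
rewrite mulr_gt0 ?expR_gt0//=.
have := main m Z cone_base mZ (@subset_refl _ _).
rewrite mZ1 !mulr1 => h; apply: le_trans h _.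
by rewrite -mZ1; apply: fmeas_le => //; exact: measurable_restricted_iter.
Qed.

(** Removing a small multiple of [m] costs part of the regularity that pushing
    forward has gained. *)
Lemma cone_subtract dl nu : 0 < dl -> cone (B - 1) nu ->
  (forall A, measurable A -> dl * m (A `&` Z) <= nu A) ->
  cone B (fun A => nu A - dl / (2 * B) * m (A `&` Z)).
Proof.
move=> dl0 [fnu cnu] lo; have B1 := cone_const_ge1.
have B0 : 0 < B by exact: lt_le_trans ltr01 B1.
pose ka := dl / (2 * B).
have ka0 : 0 < ka by rewrite divr_gt0// mulr_gt0.
have kaB : ka * (2 * B) = dl by rewrite /ka divfK// mulf_neq0// gt_eqF.
have nu0 A : measurable A -> 0 <= nu A by have [p _ _] := fnu; exact: p.
have fmZ : fmeas (fun A => m (A `&` Z)).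
  apply: (@fmeas_preimage _ _ _ m (fun A => A `&` Z)) => //.
  - by move=> A mA; exact: measurableI.
  - by move=> A A' AA' x [/AA'].
  - by move=> A A'; rewrite setIUl.
  - by move=> A A' AA'; rewrite setIACA AA' set0I.
  - move=> A A0; apply/seteqP; split => // x h.
    have : (\bigcap_n A n) x by move=> i _; have [] := h i I.
    by rewrite A0.
split.
  apply: fmeasB => //; first by apply: fmeasZ => //; exact: ltW.
  move=> A mA; apply: le_trans (lo A mA).
  apply: ler_wpM2r; first by apply: m_ge0; exact: measurableI.
  have : dl <= dl * (2 * B) by rewrite ler_peMr ?ltW//; lra.
  by move=> h; rewrite ler_pdivrMr//; exact: mulr_gt0.
move=> q G G' q1 mG mG' GZ G'Z GG'; rewrite -/ka (setIidl GZ) (setIidl G'Z).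
have h := cnu q G G' q1 mG mG' GZ G'Z GG'.
have := lo G' mG'; rewrite (setIidl G'Z) -kaB => Ylo.
have /andP[tt0 tt1] := theta01.
have t0 : 0 <= theta ^+ q by rewrite exprn_ge0 ?ltW.
have t1 : theta ^+ q <= 1 by rewrite exprn_ile1 ?ltW.
have a0 := m_ge0 mG; have b0 := m_ge0 mG'; have Y0 := nu0 _ mG'.
move: (m G) (m G') (nu G) (nu G') (theta ^+ q) h Ylo t0 t1 a0 b0 Y0
  => a b U Y t h Ylo t0 t1 a0 b0 Y0.
have e1 : expR ((B - 1) * t) = expR (B * t) * expR (- t).
  by rewrite -expRD; congr expR; ring.
have e2 : expR (- t) <= 1 - t / 2.
  have p1 : 0 < 1 + t by lra.
  rewrite expRN -div1r ler_pdivrMr ?expR_gt0//.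
  apply: le_trans (_ : (1 - t / 2) * (1 + t) <= _); first by nra.
  rewrite ler_wpM2l//; last exact: expR_ge1Dx.
  lra.
have e3 : expR (B * t) * (1 - B * t) <= 1.
  rewrite -[leRHS](expRxMexpNx_1 (B * t)) ler_wpM2l ?expR_ge0//.
  exact: expR_ge1Dx.
set E := expR (B * t) in e1 e3 *.
have E0 : 0 < E by exact: expR_gt0.
have h' : U * b <= E * (1 - t / 2) * Y * a.
  apply: le_trans h _; rewrite e1.
  by rewrite !ler_wpM2r// ler_wpM2l// ltW.
(* it suffices that [ka * b * (E - 1)] is at most [E * t / 2 * Y] *)
have key : ka * b * (E - 1) <= E * (t / 2) * Y.
  apply: le_trans (_ : E * (t / 2) * (ka * (2 * B) * b) <= _); last first.
    by rewrite ler_wpM2l// mulr_ge0 ?divr_ge0// ltW.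
  have -> : E * (t / 2) * (ka * (2 * B) * b) = ka * b * (E * (B * t)) by field.
  rewrite ler_wpM2l//; last lra.
  by rewrite mulr_ge0// ltW.
have := ler_wpM2r a0 key; nra.
Qed.

Lemma cone_scale r nu : 0 <= r -> cone B nu -> cone B (fun A => r * nu A).
Proof.
move=> r0 [fnu cnu]; split; first exact: fmeasZ.
move=> q G G' q1 mG mG' GZ G'Z GG'.
have -> : expR (B * theta ^+ q) * (r * nu G') * m G =
  r * (expR (B * theta ^+ q) * nu G' * m G) by ring.
by rewrite -[leLHS]mulrA; apply: ler_wpM2l => //; exact: cnu.
Qed.

Lemma push_iterD n n' nu A :
  nu (Z `&` iter n F @^-1` (Z `&` iter n' F @^-1` A)) = nu (Z `&` iter (n + n') F @^-1` A).
Proof.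
congr (nu _); apply/seteqP; split => x.
  by move=> [Zx [_ Ax]]; split => //; move: Ax; rewrite /preimage /= -iterD addnC.
move=> [Zx Ax]; split => //; split; first exact: restricted_iter.
by move: Ax; rewrite /preimage /= -iterD addnC.
Qed.

(** At each round the same multiple of [m], proportional to the mass, is removed from
    both measures, and what remains is again in the cone. *)
Lemma cone_contraction : exists (N : nat) (r dl : R),
  [/\ 0 <= r < 1, 0 < dl,
    (forall nu G, cone B nu -> measurable G -> G `<=` Z ->
      dl * nu Z * m G <= nu (Z `&` iter N.+1 F @^-1` G)) &
    forall j nu1 nu2 G, cone B nu1 -> cone B nu2 -> nu1 Z = nu2 Z ->
      measurable G -> G `<=` Z ->
      nu1 (Z `&` iter (j * N.+1).+1 F @^-1` G)
        - nu2 (Z `&` iter (j * N.+1).+1 F @^-1` G) <= K * nu1 Z * r ^+ j * m G].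
Proof.
have [N [dl [/andP[dl0 dl1] lo]]] := cone_minorized.
have B1 := cone_const_ge1.
have B0 : 0 < B by exact: lt_le_trans ltr01 B1.
pose ka := dl / (2 * B).
have ka0 : 0 < ka by rewrite divr_gt0// mulr_gt0.
have ka1 : ka <= 1 by rewrite ler_pdivrMr; [lra|exact: mulr_gt0].
exists N, (1 - ka), dl; split => //; first by apply/andP; split; lra.
elim=> [|j IH] nu1 nu2 G c1 c2 M12 mG GZ.
  have aZ : adapted 1 Z.
    split => // k; exists Z; first by left.
    by rewrite (setIidl (@cZ k)) (setIidl (_ : c k `<=` F @^-1` Z))// => x /cZ/FZ.
  have := cone_upper_adapted aZ c1 mG GZ; rewrite mul0n expr0 mulr1.
  have : 0 <= nu2 (Z `&` iter 1 F @^-1` G).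
    by have [p _ _] := c2.1; apply: p; exact: measurable_restricted_iter.
  lra.
pose M := nu1 Z.
have M0 : 0 <= M by have [p _ _] := c1.1; exact: p.
pose nu' nu A := nu (Z `&` iter N.+1 F @^-1` A) - (dl * M) / (2 * B) * m (A `&` Z).
have [M00|Mpos] := eqVneq M 0.
  have z1 : nu1 (Z `&` iter (j.+1 * N.+1).+1 F @^-1` G) <= 0.
    by rewrite -M00; apply: fmeas_le => //; [exact: c1.1|exact: measurable_restricted_iter].
  have : 0 <= nu2 (Z `&` iter (j.+1 * N.+1).+1 F @^-1` G).
    by have [p _ _] := c2.1; apply: p; exact: measurable_restricted_iter.
  by rewrite -/M M00 mulr0 !mul0r; lra.
have {}Mpos : 0 < M by rewrite lt_neqAle eq_sym Mpos M0.
have cnu' nu : cone B nu -> nu Z = M -> cone B (nu' nu).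
  move=> cnu nuM; apply: cone_subtract; first by rewrite mulr_gt0.
    have := cone_push (cone_push_iter N cnu).
    congr cone; apply/funext => A.
    by rewrite (push_iterD N 1 nu) addn1.
  move=> A mA; rewrite -nuM.
  have mAZ : measurable (A `&` Z) by exact: measurableI.
  apply: le_trans (lo nu _ cnu mAZ _) _; first by move=> x [].
  apply: fmeas_le; first exact: cnu.1.
  - exact: measurable_restricted_iter.
  - exact: measurable_restricted_iter.
  - by move=> x [Zx [Ax _]].
have nu'Z nu : nu Z = M -> nu' nu Z = (1 - ka) * M.
  move=> nuM; rewrite /nu' setIid mZ1 (setIidl (_ : Z `<=` iter N.+1 F @^-1` Z)).
    by rewrite nuM /ka; field; rewrite gt_eqF.
  by move=> x Zx; exact: restricted_iter.
have nu'E nu : nu' nu (Z `&` iter (j * N.+1).+1 F @^-1` G) =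
    nu (Z `&` iter (j.+1 * N.+1).+1 F @^-1` G)
    - (dl * M) / (2 * B) * m ((Z `&` iter (j * N.+1).+1 F @^-1` G) `&` Z).
  by rewrite /nu' push_iterD addnS mulSn.
have := IH (nu' nu1) (nu' nu2) G (cnu' _ c1 erefl) (cnu' _ c2 (esym M12)).
rewrite !nu'Z// => /(_ erefl mG GZ); rewrite !nu'E.
rewrite exprS -/M; have -> : K * ((1 - ka) * M) * (1 - ka) ^+ j * m G =
  K * M * ((1 - ka) * (1 - ka) ^+ j) * m G by ring.
lra.
Qed.

Let push_total n nu : nu (Z `&` iter n F @^-1` Z) = nu Z.
Proof.
by rewrite setIidl// => x Zx; exact: restricted_iter.
Qed.

(** By contraction the iterates of [m] converge on every set. The limit [pi]
    dominates a multiple of [m], so the contraction of [nu] towards [nu Z * pi] can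
    be measured relatively to [pi] itself. *)
Lemma cone_invariant_measure : exists (pi : set X -> R) (dl : R),
  [/\ [/\ cone B pi, pi Z = 1 & 0 < dl],
      forall A, measurable A -> A `<=` Z -> pi (Z `&` F @^-1` A) = pi A,
      forall A, measurable A -> A `<=` Z -> dl * m A <= pi A <= K * m A &
      forall e, 0 < e -> exists g, forall nu G, cone B nu -> measurable G ->
        G `<=` Z ->
        `|nu (Z `&` iter g.+1 F @^-1` G) - nu Z * pi G| <= e * nu Z * pi G].
Proof.
have [N [r [dl [/andP[r0 r1] dl0 lo con]]]] := cone_contraction.
have K0 := sup_const_gt0.
pose nj j := (j * N.+1).+1.
pose a n A := m (Z `&` iter n F @^-1` A).
have ca n : cone B (a n) by apply: cone_push_iter; exact: cone_base.
have aZ n : a n Z = 1 by rewrite /a push_total.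
have aI n A : a n (A `&` Z) = a n A.
  rewrite /a; congr m; apply/seteqP; split => x [Zx].
    by case.
  by move=> Ax; split => //; split => //; exact: restricted_iter.
have apush n n' A : a (n + n')%N A = a n (Z `&` iter n' F @^-1` A).
  by rewrite /a push_iterD.
have aD j n n' A : (nj j <= n)%N -> (nj j <= n')%N -> measurable A ->
    a n A - a n' A <= K * r ^+ j * m (A `&` Z).
  move=> jn jn' mA; rewrite -(aI n) -(aI n').
  have mAZ : measurable (A `&` Z) by exact: measurableI.
  have := con j (a (n - nj j)%N) (a (n' - nj j)%N) _ (ca _) (ca _) _ mAZ (@subIsetr _ _ _).
  by rewrite -(apush (n - nj j)%N (nj j) (A `&` Z)) -(apush (n' - nj j)%N (nj j) (A `&` Z)) !subnK// !aZ mulr1; apply.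
have geo e : 0 < e -> exists j, K * r ^+ j < e.
  move=> e0; have : K * r ^+ j @[j --> \oo] --> (0 : R).
    rewrite -[X in _ --> X](mulr0 K); apply: cvgM; first exact: cvg_cst.
    by apply: cvg_expr; rewrite ger0_norm.
  by move=> /cvgr_lt /(_ _ e0) [j _ /(_ j (leqnn _))]; exists j.
have acv A : measurable A -> cvgn (a ^~ A).
  move=> mA; apply/cauchy_cvgP/cauchy_exP => e e0.
  have [j je] := geo e e0.
  exists (a (nj j) A); exists (nj j) => // n jn /=.
  have bnd : K * r ^+ j * m (A `&` Z) <= K * r ^+ j.
    apply: ler_piMr; first by apply: mulr_ge0; [exact: ltW|exact: exprn_ge0].
    by rewrite -[leRHS]mZ1; apply: fmeas_le => //; exact: measurableI.
  rewrite /ball /= ltr_norml; apply/andP; split.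
    rewrite ltrNl opprB; apply: le_lt_trans je; apply: le_trans bnd.
    exact: aD.
  by apply: le_lt_trans je; apply: le_trans bnd; exact: aD.
pose pi A := limn (a ^~ A).
have acvl A : measurable A -> a n A @[n --> \oo] --> pi A by move=> /acv.
have alo A n : measurable A -> A `<=` Z -> (N.+1 <= n)%N -> dl * m A <= a n A.
  move=> mA AZ Nn; have := lo _ A (ca (n - N.+1)%N) mA AZ.
  by rewrite aZ mulr1 -(apush (n - N.+1)%N N.+1 A) subnK.
have aup A n : measurable A -> (1 <= n)%N -> a n A <= K * m (A `&` Z).
  move=> mA n1; rewrite -aI.
  have aT : adapted 1 Z.
    split => // k; exists Z; first by left.
    by rewrite (setIidl (@cZ k)) (setIidl (_ : c k `<=` F @^-1` Z))// => x /cZ/FZ.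
  have mAZ : measurable (A `&` Z) by exact: measurableI.
  have := cone_upper_adapted aT (ca (n - 1)%N) mAZ (@subIsetr _ _ _).
  by rewrite aZ mulr1 -(apush (n - 1)%N 1%N (A `&` Z)) subnK.
have piup A : measurable A -> pi A <= K * m (A `&` Z).
  by move=> mA; apply: limr_le; [exact: acv|exists 1%N => // n; exact: aup].
have pi0 A : measurable A -> 0 <= pi A.
  move=> mA; apply: limr_ge; first exact: acv.
  by exists 0%N => // n _; have [p _ _] := (ca n).1; exact: p.
have fpi : fmeas pi.
  split=> //.
  - move=> A A' mA mA' AA'; apply: cvg_lim => //.
    rewrite (_ : a ^~ (A `|` A') = (fun n => a n A + a n A')).
      by apply: cvgD; exact: acvl.
    by apply/funext => n; have [_ p _] := (ca n).1; exact: p.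
  - move=> A mA dA A0.
    apply: (@squeeze_cvgr _ _ _ _ (fun=> 0) (fun n => K * m (A n `&` Z))).
    + by exists 0%N => // n _; rewrite pi0//= piup.
    + exact: cvg_cst.
    + rewrite -[X in _ --> X](mulr0 K); apply: cvgM; first exact: cvg_cst.
      have [_ _ p] := fm; apply: p.
      * by move=> n; exact: measurableI.
      * by move=> n n' nn' x [Ax Zx]; split => //; exact: dA nn' _ Ax.
      * apply/seteqP; split => // x h.
        have : (\bigcap_n A n) x by move=> i _; have [] := h i I.
        by rewrite A0.
have cpi : cone B pi.
  split=> // q G G' q1 mG mG' GZ G'Z GG'.
  have l1 : a n G * m G' @[n --> \oo] --> pi G * m G'.
    by apply: cvgM; [exact: acvl|exact: cvg_cst].
  have l2 : expR (B * theta ^+ q) * a n G' * m G @[n --> \oo] -->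
      expR (B * theta ^+ q) * pi G' * m G.
    apply: cvgM; last exact: cvg_cst.
    by apply: cvgM; [exact: cvg_cst|exact: acvl].
  apply: (ler_cvg_to l1 l2).
  by exists 0%N => // n _; exact: (ca n).2.
have piZ : pi Z = 1.
  rewrite /pi (_ : a ^~ Z = fun=> 1); first exact: lim_cst.
  exact/funext.
have pinv n A : measurable A -> pi (Z `&` iter n F @^-1` A) = pi A.
  move=> mA; have mA' : measurable (Z `&` iter n F @^-1` A).
    by apply: measurable_restricted_iter.
  apply: (@cvg_unique _ (@Rhausdorff R) (a k (Z `&` iter n F @^-1` A) @[k --> \oo])).
    exact: acvl.
  rewrite (_ : (fun k => _) = (fun k => a (k + n)%N A)); first last.
    by apply/funext => k; rewrite apush.
  by have h := acvl A mA; rewrite -(cvg_shiftn n) in h; exact: h.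
have pilo A : measurable A -> A `<=` Z -> dl * m A <= pi A.
  move=> mA AZ; apply: limr_ge; first exact: acv.
  by exists N.+1 => // n; exact: alo.
exists pi, dl; split => //.
- by move=> A mA _; exact: (pinv 1%N).
- by move=> A mA AZ; rewrite pilo//=; have := piup A mA; rewrite setIidl.
move=> e e0; have [j je] := geo (e * dl) (mulr_gt0 e0 dl0).
exists (j * N.+1)%N => nu G cnu mG GZ.
have nuZ0 : 0 <= nu Z by have [p _ _] := cnu.1; exact: p.
have cs : cone B (fun A => nu Z * pi A) by apply: cone_scale.
have h1 := con j _ _ G cnu cs.
have h2 := con j _ _ G cs cnu.
move: h1 h2; rewrite piZ mulr1 pinv// => /(_ erefl mG GZ) h1 /(_ erefl mG GZ) h2.
have bnd : K * nu Z * r ^+ j * m G <= e * nu Z * pi G.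
  apply: le_trans (_ : e * nu Z * (dl * m G) <= _); last first.
    by rewrite ler_wpM2l ?mulr_ge0 ?(ltW e0)// pilo.
  have -> : K * nu Z * r ^+ j * m G = K * r ^+ j * (nu Z * m G) by ring.
  have -> : e * nu Z * (dl * m G) = e * dl * (nu Z * m G) by ring.
  by rewrite ler_wpM2r ?mulr_ge0 ?m_ge0// ltW.
rewrite ler_norml; apply/andP; split; last exact: le_trans h1 bnd.
by rewrite lerNl opprB; exact: le_trans h2 bnd.
Qed.

End gibbs_markov_cone.

(** * The first return map and its partition *)

Section first_return_combinatorics.
Context {X : Type}.
Implicit Types (S : set nat) (x y : X).

Lemma inf_natP S n : inf_nat S = Some n <-> S n /\ forall k, (k < n)%N -> ~ S k.
Proof.
rewrite /inf_nat; case: pselect => [h|h]; last first.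
  by split => // -[Sn _]; exfalso; apply: h; exists n; rewrite inE.
case: ex_minnP => k; rewrite inE => Sk kmin; split => [[<-]|[Sn nmin]].
  by split => // j jk Sj; have := kmin j; rewrite inE leqNgt jk => /(_ Sj).
congr Some; apply/eqP; rewrite eqn_leq kmin ?inE//= leqNgt.
by apply/negP => /nmin.
Qed.

Lemma inf_nat_None S : inf_nat S = None <-> forall n, ~ S n.
Proof.
rewrite /inf_nat; case: pselect => [h|h]; split => //.
  by move=> nS; have [n] := h; rewrite inE => /nS.
by move=> _ n Sn; apply: h; exists n; rewrite inE.
Qed.

Variables (f : X -> X) (Y : set X).

Lemma tauP y n : tau f Y y = Some n <->
  [/\ (1 <= n)%N, Y (iter n f y) & forall k, (1 <= k < n)%N -> ~ Y (iter k f y)].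
Proof.
rewrite /tau inf_natP /=; split => [[[n1 Yn] h]|[n1 Yn h]]; split => //.
  by move=> k /andP[k1 kn] Yk; apply: (h k kn).
by move=> k kn [k1 Yk]; apply: (h k) => //; rewrite k1.
Qed.

Lemma tau_le y n : (1 <= n)%N -> Y (iter n f y) ->
  exists2 k, tau f Y y = Some k & (1 <= k <= n)%N.
Proof.
move=> n1 Yn; case E : (tau f Y y) => [k|]; last first.
  by move/inf_nat_None : E => /(_ n) /=; case.
exists k => //; have /tauP[k1 _ h] := E; rewrite k1 /= leqNgt; apply/negP => nk.
by apply: (h n) => //; rewrite n1.
Qed.

Lemma first_returnE y n : tau f Y y = Some n -> first_return f Y y = iter n f y.
Proof. by rewrite /first_return => ->. Qed.

Local Notation Z := (recurrent_part f Y).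
Local Notation F := (first_return f Y).

Lemma recurrent_iter y n : Z y -> Y (iter n f y) -> Z (iter n f y).
Proof.
move=> [_ h] Yn; split => // N; have [k Nk Yk] := h (N + n)%N.
exists (k - n)%N; first by rewrite leq_subRL ?(leq_trans (leq_addl _ _) Nk)// addnC.
by rewrite -iterD subnK// (leq_trans (leq_addl _ _) Nk).
Qed.

Lemma recurrent_iter_inv y n : Y y -> Z (iter n f y) -> Z y.
Proof.
move=> Yy [_ h]; split => // N; have [k Nk Yk] := h N.
by exists (k + n)%N; [exact: leq_trans (leq_addr _ _)|rewrite iterD].
Qed.

Lemma recurrent_tau y : Z y -> exists n, tau f Y y = Some n.
Proof.
by move=> [_ /(_ 1%N)[n n1 Yn]]; have [k ? _] := tau_le n1 Yn; exists k.
Qed.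

Lemma recurrent_first_return y : Z y -> Z (F y).
Proof.
move=> Zy; have [n tn] := recurrent_tau Zy; rewrite (first_returnE tn).
by apply: recurrent_iter => //; have /tauP[] := tn.
Qed.

End first_return_combinatorics.

Section induced_partition_combinatorics.
Context {X : Type}.
Variables (f : X -> X) (P : set (set X)) (Y : set X).
Hypotheses (P_part : partition P id [set: X]).
Hypothesis P_markov : forall a, P a -> set_inj a f /\ union_of P (f @` a).
Hypothesis Y_union : union_of P Y.

Lemma partition_meet a b x : P a -> P b -> a x -> b x -> a = b.
Proof.
by move=> Pa Pb ax bx; have [_ tP _] := P_part; apply: (tP a b Pa Pb); exists x.
Qed.

Lemma partition_cover x : exists2 a, P a & a x.
Proof.
have [cP _ _] := P_part.
by have : [set: X] x by []; rewrite -cP => -[a Pa ax]; exists a.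
Qed.

Lemma union_of_sub B a x : union_of P B -> P a -> a x -> B x -> a `<=` B.
Proof.
move=> [S SP ->] Pa ax [b Sb bx].
have -> : a = b by apply: (partition_meet Pa _ ax bx); exact: SP.
by move=> y by_; exists b.
Qed.

(** As soon as one orbit passes from a letter to the next, the image of the former
    contains the latter; so the word can be followed backwards from every end
    point. *)
Lemma cylinder_onto n (a : nat -> set X) x y : (forall j, (j <= n)%N -> P (a j)) ->
  (forall j, (j <= n)%N -> a j (iter j f x)) -> (f @` a n) y ->
  exists2 x', (forall j, (j <= n)%N -> a j (iter j f x')) & iter n.+1 f x' = y.
Proof.
move=> Pa ax [z az <-] {y}.
suff [x' ax' <-] : exists2 x', (forall j, (j <= n)%N -> a j (iter j f x'))
    & iter n f x' = z by exists x'.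
elim: n z Pa ax az => [|n IH] z Pa ax az.
  by exists z => // j; rewrite leqn0 => /eqP ->.
have [|_ u] := P_markov (_ : P (a n)); first exact: Pa.
have zf : (f @` a n) z.
  apply: (union_of_sub u _ (ax n.+1 (leqnn _))) => //; first exact: Pa.
  by exists (iter n f x) => //; exact: ax.
have [z' az' fz'] := zf.
have [||x' ax' x'z] := IH z' _ _ az'.
- by move=> j jn; apply: Pa; exact: leqW.
- by move=> j jn; apply: ax; exact: leqW.
exists x'; last by rewrite iterS x'z.
move=> j; rewrite leq_eqVlt ltnS => /orP[/eqP ->|/ax'//].
by rewrite iterS x'z fz'.
Qed.

Lemma cylinder_inj n (a : nat -> set X) x y : (forall j, (j < n)%N -> P (a j)) ->
  (forall j, (j < n)%N -> a j (iter j f x)) ->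
  (forall j, (j < n)%N -> a j (iter j f y)) -> iter n f x = iter n f y -> x = y.
Proof.
elim: n => // n IH Pa ax ay /= fxy; apply: IH => [j jn|j jn|j jn|].
- by apply: Pa; exact: leqW.
- by apply: ax; exact: leqW.
- by apply: ay; exact: leqW.
have [|inj _] := P_markov (_ : P (a n)); first exact: Pa.
by apply: (inj _ _ _ _ fxy); rewrite inE; [exact: ax|exact: ay].
Qed.

Local Notation Z := (recurrent_part f Y).
Local Notation F := (first_return f Y).
Local Notation PY := (induced_partition f P Y).

Lemma sub_Y a x : P a -> a x -> Y x -> a `<=` Y.
Proof. by move=> Pa ax Yx; exact: union_of_sub Y_union Pa ax Yx. Qed.

Lemma sub_notY a x : P a -> a x -> ~ Y x -> a `<=` ~` Y.
Proof. by move=> Pa ax nY y ay Yy; apply: nY; exact: sub_Y Yy _ ax. Qed.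

Lemma induced_cell_exists y n : Y y -> tau f Y y = Some n -> exists2 b, PY b & b y.
Proof.
move=> Yy /tauP[n1 Yn h].
have /choice[a Ha] : forall j, exists a, P a /\ a (iter j f y).
  by move=> j; have [a Pa aj] := partition_cover (iter j f y); exists a.
exists ((\bigcap_(j in [set j | (j < n)%N]) (iter j f @^-1` a j)) `&` (iter n f @^-1` Y)).
  split; first by exists y; split => // j _; exact: (Ha j).2.
  exists n, a; split => //.
  - by move=> j _; exact: (Ha j).1.
  - exact: (sub_Y (Ha 0%N).1 (Ha 0%N).2).
  - by move=> j jn; apply: (sub_notY (Ha j).1 (Ha j).2); exact: h.
by split => // j _; exact: (Ha j).2.
Qed.

(** An element of the induced partition with its word [a] of length [n.+1], which
    its points share. *)
Lemma induced_cellP b : PY b -> exists n a,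
  [/\ b = [set x | (forall j, (j <= n)%N -> a j (iter j f x)) /\ Y (iter n.+1 f x)],
      forall j, (j <= n)%N -> P (a j), b `<=` Y,
      forall x, b x -> tau f Y x = Some n.+1 &
      F @` b = (f @` a n) `&` Y].
Proof.
move=> [[x0 bx0] [n' [a [n1 Pa aY aYC bE]]]].
case: n' n1 Pa aYC bE => // n _ Pa aYC bE; exists n, a.
have bE' : b = [set x | (forall j, (j <= n)%N -> a j (iter j f x)) /\ Y (iter n.+1 f x)].
  rewrite bE; apply/seteqP; split => x [h Yx]; split => //.
have bt x : b x -> tau f Y x = Some n.+1.
  rewrite bE' => -[h Yx]; apply/tauP; split => // k /andP[k1 kn].
  by apply: (aYC k); rewrite ?k1//; exact: h.
split => //.
- by move=> x; rewrite bE' => -[h _]; apply: aY; exact: (h 0%N).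
apply/seteqP; split => [_ [x bx <-]|y [fy Yy]].
  rewrite (first_returnE (bt x bx)); move: bx; rewrite bE' => -[h Yx].
  by split => //; exists (iter n f x) => //; exact: h.
move: (bx0); rewrite bE' => -[h0 _].
have [x' ax' xy] := cylinder_onto Pa h0 fy.
have bx' : b x' by rewrite bE'; split => //=; rewrite -iterS xy.
exists x'; first by rewrite -bE'.
by rewrite (first_returnE (bt _ bx')).
Qed.

Lemma induced_inj b : PY b -> set_inj b F.
Proof.
move=> Pb; have [n [a [bE Pa _ bt _]]] := induced_cellP Pb.
move=> x y; rewrite !inE => bx by_.
rewrite (first_returnE (bt _ bx)) (first_returnE (bt _ by_)).
by move: bx by_; rewrite bE => -[hx _] [hy _]; exact: (@cylinder_inj n.+1 a x y Pa hx hy).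
Qed.

Lemma induced_meet b b' x : PY b -> PY b' -> b x -> b' x -> b = b'.
Proof.
move=> Pb Pb' bx b'x.
have [n [a [bE Pa _ bt _]]] := induced_cellP Pb.
have [n' [a' [bE' Pa' _ bt' _]]] := induced_cellP Pb'.
have nn' : n = n' by have := bt _ bx; rewrite (bt' _ b'x) => -[].
rewrite -nn' in bE' Pa' => {bt bt' nn' Pb Pb'}.
have aa' j : (j <= n)%N -> a j = a' j.
  move=> jn; move: bx b'x; rewrite bE bE' => -[h _] [h' _].
  by apply: (partition_meet (Pa j jn) (Pa' j jn) (h j jn) (h' j jn)).
rewrite bE bE'; apply/seteqP; split => y [h Yy]; split => // j jn.
  by rewrite -aa'//; exact: h.
by rewrite aa'//; exact: h.
Qed.

Lemma induced_markov b b' y : PY b -> PY b' -> (F @` b) y -> b' y -> b' `<=` F @` b.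
Proof.
move=> Pb Pb' Fy b'y.
have [n [a [_ Pa _ _ FE]]] := induced_cellP Pb.
have [n' [a' [bE' Pa' b'Y _ _]]] := induced_cellP Pb'.
move=> z b'z; rewrite FE; split; last exact: b'Y.
have [|_ u] := P_markov (_ : P (a n)); first exact: Pa.
have a0 w : b' w -> a' 0%N w by rewrite bE' => -[h _]; exact: (h 0%N).
apply: (union_of_sub u (Pa' 0%N _) (a0 _ b'y)) => //; last exact: a0.
by move: Fy; rewrite FE => -[].
Qed.

(** By the Markov property the end point can be pulled back through the cells one
    by one. *)
Lemma induced_follow n (b : nat -> set X) x z : (forall i, (i <= n)%N -> PY (b i)) ->
  (forall i, (i <= n)%N -> b i (iter i F x)) -> b n z ->
  exists2 x', b 0%N x' & iter n F x' = z.
Proof.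
elim: n z => [|n IH] z Pb bx bz; first by exists z.
have bz' : (F @` b n) z.
  apply: (@induced_markov (b n) (b n.+1) (iter n.+1 F x)) => //.
  - exact: Pb.
  - exact: Pb.
  - by exists (iter n F x) => //; exact: bx.
  - exact: bx.
have [w bw Fw] := bz'.
have [||x' bx' xw] := IH w _ _ bw.
- by move=> i ni; apply: Pb; exact: leqW.
- by move=> i ni; apply: bx; exact: leqW.
by exists x' => //; rewrite iterS xw.
Qed.

(** An orbit that ends in a cell has not met a point without return, where [F] is
    the identity. *)
Lemma induced_orbit_cells n x b : PY b -> b (iter n F x) -> Y x ->
  exists bs : nat -> set X, forall i, (i <= n)%N -> PY (bs i) /\ bs i (iter i F x).
Proof.
move=> Pb bn Yx.
have [k [a [_ _ _ bt _]]] := induced_cellP Pb.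
have tnn i : (i <= n)%N -> tau f Y (iter i F x) <> None.
  move=> ni ti; have FE : F (iter i F x) = iter i F x by rewrite /first_return ti.
  have : iter n F x = iter i F x.
    rewrite -(subnK ni) iterD; elim: (n - i)%N => //= j ->; exact: FE.
  by move=> E; have := bt _ bn; rewrite E ti.
have Yi i : (i <= n)%N -> Y (iter i F x).
  elim: i => // i IH ni; rewrite iterS.
  have := tnn i (ltnW ni); case E : (tau f Y (iter i F x)) => [j|]// _.
  by rewrite (first_returnE E); have /tauP[] := E.
have /choice[bs Hbs] : forall i, exists b, (i <= n)%N -> PY b /\ b (iter i F x).
  move=> i; have [ni|_] := boolP (i <= n)%N; last by exists set0.
  have := tnn i ni; case E : (tau f Y (iter i F x)) => [j|]// _.
  by have [b' Pb' bi] := induced_cell_exists (Yi i ni) E; exists b'.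
by exists bs.
Qed.

End induced_partition_combinatorics.

(** * Measurability and densities of the induced map *)

Lemma measurable_tau {d : measure_display} {R : realType}
    {X : measurableMetricType d R} (f : X -> X) (Y : set X) :
  measurable_fun setT f -> measurable Y ->
  forall n, measurable [set x | tau f Y x = Some n].
Proof.
move=> f_meas mY [|n]; have mi k := measurable_iter_preimage f_meas k mY.
  rewrite (_ : [set _ | _] = set0); first exact: measurable0.
  by apply/seteqP; split => x //= /tauP[].
rewrite (_ : [set _ | _] = (iter n.+1 f @^-1` Y) `&`
    \bigcap_(k in [set k | (1 <= k < n.+1)%N]) ~` (iter k f @^-1` Y)).
  apply: measurableI; first exact: mi.
  rewrite bigcap_mkcond; apply: bigcapT_measurable => k; case: ifP => _ //.
  exact/measurableC/mi.
by apply/seteqP; split => x /= => [/tauP[_ Yn h]|[Yn h]]; [split|apply/tauP; split].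
Qed.

Section induced_measurability.
Context {d : measure_display} {R : realType} {X : measurableMetricType d R}.
Variables (m : probability X R) (f : X -> X) (P : set (set X)) (Y : set X).
Hypotheses (f_meas : measurable_fun setT f) (f_cons : conservative_map m f).
Hypotheses (f_markov : markov_map m f P).
Hypotheses (Y_nonempty : Y !=set0) (Y_union : union_of P Y).

Local Notation Z := (recurrent_part f Y).
Local Notation F := (first_return f Y).
Local Notation PY := (induced_partition f P Y).

Lemma markov_partition : partition P id [set: X].
Proof. by case: f_markov. Qed.

Lemma markov_branches a : P a -> set_inj a f /\ union_of P (f @` a).
Proof. by case: f_markov => _ _ _; exact. Qed.

Lemma measurable_partition a : P a -> measurable a.
Proof. by case: f_markov => _ _ h _ /h[]. Qed.

Lemma union_of_measurable B : union_of P B -> measurable B.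
Proof.
move=> [S SP ->]; have [/countable_injP[g ginj] _ _ _] := f_markov.
pose e k := xget set0 [set a | S a /\ g a = k].
have eE k : e k = set0 \/ S (e k).
  by rewrite /e; case: xgetP => [a _ [Sa _]|_]; [right|left].
rewrite (_ : \bigcup_(a in S) a = \bigcup_k e k).
  apply: bigcup_measurable => k _; have [->|/SP] := eE k; first exact: measurable0.
  exact: measurable_partition.
apply/seteqP; split => [x [a Sa ax]|x [k _ ekx]].
  exists (g a) => //; suff -> : e (g a) = a by [].
  rewrite /e; case: xgetP => [b _ [Sb gb]|/(_ a)]; last by case.
  by apply: ginj => //; rewrite inE; exact: SP.
by have [ek0|Sek] := eE k; [move: ekx; rewrite ek0|exists (e k)].
Qed.

Lemma measurable_Y : measurable Y. Proof. exact: union_of_measurable. Qed.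

Lemma Y_cell : exists2 a, P a & a `<=` Y.
Proof.
have [y Yy] := Y_nonempty; have [a Pa ay] := partition_cover markov_partition y.
by exists a => //; exact: (union_of_sub markov_partition Y_union Pa ay Yy).
Qed.

Lemma measurable_recurrent : measurable Z.
Proof.
rewrite (_ : Z = Y `&` \bigcap_N \bigcup_(n in [set n | (N <= n)%N]) (iter n f @^-1` Y)).
  apply: measurableI; first exact: measurable_Y.
  apply: bigcap_measurable; first by exists 0%N.
  move=> N _; apply: bigcup_measurable => n _.
  by apply: measurable_iter_preimage => //; exact: measurable_Y.
apply/seteqP; split => x [Yx h]; split => // N.
  by move=> _; have [n Nn Yn] := h N; exists n.
by have [n Nn Yn] := h N I; exists n.
Qed.

Lemma cell_pos a : P a -> (0 < m a)%E.
Proof. by case: f_markov => _ _ h _ /h[]. Qed.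

Lemma nonrecurrent_null : m (Y `\` Z) = 0%E.
Proof.
have mD : measurable (Y `\` Z).
  by apply: measurableD; [exact: measurable_Y|exact: measurable_recurrent].
have Y0 : (0 < m Y)%E.
  have [a Pa aY] := Y_cell; apply: lt_le_trans (cell_pos Pa) _.
  apply: le_measure => //; rewrite inE; first exact: measurable_partition.
  exact: measurable_Y.
have [N [mN N0 sN]] := f_cons measurable_Y Y0.
apply: (subset_measure0 mD mN _ N0).
move=> x [Yx nZ]; apply: sN => /= h; apply: nZ; split => //; exact: h.
Qed.

Lemma measure_recurrent A : measurable A -> A `<=` Y -> m (A `&` Z) = m A.
Proof.
move=> mA AY; rewrite -[in RHS](setUIDK A Z) measureU.
- rewrite [X in (_ + X)%E](_ : _ = 0%E) ?adde0//.
  apply: (@subset_measure0 _ _ _ m _ (Y `\` Z)).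
  + by apply: measurableD => //; exact: measurable_recurrent.
  + by apply: measurableD; [exact: measurable_Y|exact: measurable_recurrent].
  + by move=> x [/AY].
  + exact: nonrecurrent_null.
- by apply: measurableI => //; exact: measurable_recurrent.
- by apply: measurableD => //; exact: measurable_recurrent.
- by apply/seteqP; split => // x [[_ Zx] [_ /(_ Zx)]].
Qed.

Lemma induced_countable : countable PY.
Proof.
have [/countable_injP[g ginj] _ _ _] := f_markov.
have /choice[w Hw] : forall b, exists na : nat * (nat -> set X), PY b ->
    b = [set x | (forall j, (j <= na.1)%N -> na.2 j (iter j f x)) /\ Y (iter na.1.+1 f x)]
    /\ forall j, (j <= na.1)%N -> P (na.2 j).
  move=> b; have [Pb|nPb] := pselect (PY b); last by exists (0%N, fun=> set0).
  have [n [a [bE Pa _ _ _]]] := induced_cellP markov_partition markov_branches Pb.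
  by exists (n, a).
apply/countable_injP.
exists (fun b => pickle [seq g ((w b).2 j) | j <- iota 0 (w b).1.+1]).
move=> b b'; rewrite !inE => Pb Pb' /(pcan_inj pickleK) e.
have [bE Pa] := Hw b Pb; have [bE' Pa'] := Hw b' Pb'.
have nn : (w b).1 = (w b').1.
  by have := congr1 size e; rewrite !size_map !size_iota => -[].
have aa j : (j <= (w b).1)%N -> (w b).2 j = (w b').2 j.
  move=> jn; apply: ginj; rewrite ?inE; [exact: Pa|by apply: Pa'; rewrite -nn|].
  have := congr1 (fun s => nth 0%N s j) e.
  by rewrite !(nth_map 0%N) ?size_iota -?nn ?nth_iota// ?add0n -?nn.
rewrite bE bE' -nn; apply/seteqP; split => x [h Yx]; split => // j jn.
  by rewrite -aa//; exact: h.
by rewrite aa//; exact: h.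
Qed.

Lemma induced_measurable b : PY b -> measurable b.
Proof.
move=> Pb; have [n [a [-> Pa _ _ _]]] := induced_cellP markov_partition markov_branches Pb.
rewrite (_ : [set x | _] = (\bigcap_(j in [set j | (j <= n)%N]) (iter j f @^-1` a j))
    `&` (iter n.+1 f @^-1` Y)).
  apply: measurableI; last by apply: measurable_iter_preimage => //; exact: measurable_Y.
  apply: bigcap_measurable; first by exists 0%N.
  move=> j jn; apply: measurable_iter_preimage => //.
  by apply: measurable_partition; exact: Pa.
by apply/seteqP; split => x [h Yx]; split => // j jn; exact: h.
Qed.

(** The cells of the induced map, numbered so that the empty set fills the unused
    numbers, and restricted to the points that return infinitely often. *)
Lemma induced_enumeration : exists c : nat -> set X,
  [/\ forall k, c k = set0 \/ exists2 b, PY b & c k = b `&` Z,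
      forall b, PY b -> exists k, c k = b `&` Z,
      trivIset setT c & \bigcup_k c k = Z].
Proof.
have /countable_injP[g ginj] := induced_countable.
pose c k := [set x | exists b, [/\ PY b, g b = k, b x & Z x]].
have cE b : PY b -> c (g b) = b `&` Z.
  move=> Pb; apply/seteqP; split => [x [b' [Pb' gb' b'x Zx]]|x [bx Zx]].
    by split => //; have <- : b' = b by apply: ginj; rewrite ?inE.
  by exists b.
exists c; split.
- move=> k; have [[b [Pb gb]]|nb] := pselect (exists b, PY b /\ g b = k).
    by right; exists b => //; rewrite -gb cE.
  left; apply/seteqP; split => // x [b [Pb gb _ _]]; apply: nb; by exists b.
- by move=> b Pb; exists (g b); exact: cE.
- move=> k l _ _ [x [[b [Pb <- bx _]] [b' [Pb' <- b'x _]]]].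
  by rewrite (induced_meet markov_partition markov_branches Pb Pb' bx b'x).
apply/seteqP; split => [x [k _ [b []]]//|x Zx].
have [n tn] := recurrent_tau Zx.
have [b Pb bx] := induced_cell_exists markov_partition Y_union Zx.1 tn.
by exists (g b) => //; exists b.
Qed.

Hypothesis X_borel : @measurable d X = <<s [set U : set X | open U] >>.
Hypothesis X_compact : compact [set: X].

(** On a cell, [F] is an injective iterate of [f] with a Borel image, so it maps
    Borel sets to Borel sets. *)
Lemma measurable_image_F b A : PY b -> measurable A -> A `<=` b ->
  measurable (F @` A).
Proof.
move=> Pb mA Ab.
have [n [a [bE Pa _ bt FE]]] := induced_cellP markov_partition markov_branches Pb.
have imE (S : set X) : S `<=` b -> F @` S = iter n.+1 f @` S.
  move=> Sb; apply/seteqP; split => [_ [x Sx <-]|_ [x Sx <-]]; exists x => //.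
    by rewrite (first_returnE (bt _ (Sb _ Sx))).
  by rewrite (first_returnE (bt _ (Sb _ Sx))).
rewrite imE//; apply: (measurable_image_inj X_borel X_compact (b := b)) => //.
- exact: measurable_iter.
- exact: induced_measurable.
- move=> x y; rewrite !inE bE => -[hx _] [hy _].
  exact: (@cylinder_inj _ f P markov_branches n.+1 a x y Pa hx hy).
- rewrite -imE// FE; apply: measurableI; last exact: measurable_Y.
  by apply: union_of_measurable; have [|//] := markov_branches (_ : P (a n)); exact: Pa.
Qed.

Lemma image_measure_measure b : PY b ->
  exists im : {measure set X -> \bar R}, (im : set X -> \bar R) = image_measure m F b.
Proof.
move=> Pb; have mb := induced_measurable Pb.
pose im := image_measure m F b.
have im0 : im set0 = 0%E by rewrite /im /image_measure set0I image_set0 measure0.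
have im_ge0 A : (0 <= im A)%E by rewrite /im /image_measure measure_ge0.
have im_sigma : semi_sigma_additive im.
  move=> A mA tA mUA; rewrite /im /image_measure.
  have -> : F @` (\bigcup_n A n `&` b) = \bigcup_n (F @` (A n `&` b)).
    by rewrite setI_bigcupl image_bigcup.
  have mFA n : measurable (F @` (A n `&` b)).
    by apply: (measurable_image_F Pb); [exact: measurableI|move=> x []].
  apply: measure_semi_sigma_additive => //; last exact: bigcupT_measurable.
  move=> i j _ _ [_ [[x [Ax bx] <-] [y [Ay by_] xy]]].
  apply: (tA i j I I); exists x; split => //.
  by rewrite -(induced_inj markov_partition markov_branches Pb _ _ xy) ?inE.
pose ime := isMeasure.Build _ _ _ im im0 im_ge0 im_sigma.
by exists (HB.pack_for {measure set X -> \bar R} im ime).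
Qed.

Lemma fine_measure_ge0 (A : set X) : 0 <= fine (m A).
Proof. exact/fine_ge0/measure_ge0. Qed.

Lemma density_le b u A (s : R) : PY b ->
  is_density m (image_measure m F b) b u -> measurable A -> A `<=` b ->
  (forall x, A x -> u x <= s) -> fine (m A) <= s * fine (m (F @` A)).
Proof.
move=> Pb [mu u0 uE] mA Ab us.
have [[x Ax]|A0] := pselect (A !=set0); last first.
  have -> : A = set0 by apply/seteqP; split => // x Ax; apply: A0; exists x.
  by rewrite image_set0 measure0 mulr0.
have s0 : 0 <= s by apply: le_trans (us _ Ax); exact/u0/Ab.
have [im imE] := image_measure_measure Pb.
have mFA := measurable_image_F Pb mA Ab.
rewrite -lee_fin EFinM !fineK ?fin_num_measure//.
rewrite (uE A mA Ab) -imE.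
apply: (@le_trans _ _ (\int[im]_(x in A) (cst s%:E x))%E).
  apply: ge0_le_integral => //.
  - by move=> y Ay; rewrite lee_fin; exact/u0/Ab.
  - by apply/measurable_EFinP; exact: measurable_funS (induced_measurable Pb) Ab mu.
rewrite integral_cst// imE /image_measure (setIidl Ab).
by [].
Qed.

Lemma density_ge b u A (s : R) : PY b ->
  is_density m (image_measure m F b) b u -> measurable A -> A `<=` b -> 0 <= s ->
  (forall x, A x -> s <= u x) -> s * fine (m (F @` A)) <= fine (m A).
Proof.
move=> Pb [mu u0 uE] mA Ab s0 us.
have [im imE] := image_measure_measure Pb.
have mFA := measurable_image_F Pb mA Ab.
rewrite -lee_fin EFinM !fineK ?fin_num_measure//.
rewrite (uE A mA Ab) -imE.
apply: (@le_trans _ _ (\int[im]_(x in A) (cst s%:E x))%E).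
  by rewrite integral_cst// imE /image_measure (setIidl Ab).
apply: ge0_le_integral => //.
by apply/measurable_EFinP; exact: measurable_funS (induced_measurable Pb) Ab mu.
Qed.

Hypothesis F_gibbs_markov : gibbs_markov m f P Y.

(** Points of one cell whose images follow the same cells for [q] steps separate
    after time [q], so their distance is at most [theta ^+ q]. *)
Lemma density_ratio : exists theta C : R, [/\ 0 < theta < 1, 0 < C &
  forall b, PY b -> exists u, [/\ is_density m (image_measure m F b) b u,
    forall x, b x -> 0 < u x &
    forall x y q, (b `&` Z) x -> (b `&` Z) y ->
      (forall i b', PY b' -> (i < q)%N -> b' (iter i.+1 F x) -> b' (iter i.+1 F y)) ->
      u x <= expR (C * theta ^+ q) * u y]].
Proof.
have [_ [theta [C [t01 C0 h]]]] := F_gibbs_markov.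
exists theta, C; split => // b Pb; have [u [du u0 Lu]] := h b Pb.
exists u; split => // x y q bx by_ xy.
rewrite -[u x]lnK ?posrE; last by apply: u0; case: bx.
rewrite -[u y in leRHS]lnK ?posrE; last by apply: u0; case: by_.
rewrite -expRD ler_expR -lerBlDr.
apply: le_trans (ler_norm _) _; apply: le_trans (Lu x y bx by_) _.
rewrite ler_wpM2l ?(ltW C0)// /return_dist /d_theta.
have /andP[t0 t1] := t01.
case E : (separation_time F PY x y) => [n|]; last by rewrite exprn_ge0// ltW.
have /inf_natP[[b1 [b2 [Pb1 Pb2 b12 b1x b2y]]] _] := E.
apply: ler_wiXn2l; [exact: ltW|exact: ltW|].
rewrite leqNgt; apply/negP => nq; apply: b12.
case: n nq b1x b2y {E} => [|n] nq b1x b2y.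
  rewrite (induced_meet markov_partition markov_branches Pb1 Pb b1x bx.1).
  by rewrite (induced_meet markov_partition markov_branches Pb2 Pb b2y by_.1).
apply: (induced_meet markov_partition markov_branches Pb1 Pb2) b2y.
by apply: (xy n b1 Pb1) => //; exact: ltnW.
Qed.

Lemma measurable_first_return A : measurable A -> measurable (Z `&` F @^-1` A).
Proof.
move=> mA.
rewrite (_ : _ `&` _ = \bigcup_n (Z `&` ([set x | tau f Y x = Some n] `&` iter n f @^-1` A))).
  apply: bigcup_measurable => n _; apply: measurableI; first exact: measurable_recurrent.
  by apply: measurableI; [exact: (measurable_tau f_meas measurable_Y)|exact: measurable_iter_preimage].
apply/seteqP; split => [x [Zx Ax]|x [n _ [Zx [tn Ax]]]].
  have [n tn] := recurrent_tau Zx; exists n => //; split => //; split => //.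
  by move: Ax; rewrite /preimage /= (first_returnE tn).
by split => //; rewrite /preimage /= (first_returnE tn).
Qed.

End induced_measurability.

(** * The induced map is a Gibbs-Markov system on the recurrent part *)

Lemma cone_add (d : measure_display) (R : realType) (X : measurableType d)
    (Z : set X) (F : X -> X) (c : nat -> set X) (m : set X -> R) (theta B : R) nu1 nu2 :
  fmeas m -> cone Z F c m theta B nu1 -> cone Z F c m theta B nu2 ->
  cone Z F c m theta B (fun A => nu1 A + nu2 A).
Proof.
move=> fm [f1 c1] [f2 c2]; split; first exact: fmeasD.
move=> q G G' q1 mG mG' GZ G'Z GG'.
rewrite mulrDl mulrDr mulrDl; apply: lerD; [exact: c1|exact: c2].
Qed.

Section return_times.
Context {X : Type}.
Variables (f : X -> X) (Y : set X).

Local Notation Z := (recurrent_part f Y).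
Local Notation F := (first_return f Y).

(** The time of the [g]-th return; for points that return only finitely often the
    missing returns count for 0. *)
Fixpoint return_time (g : nat) (x : X) : nat :=
  if g is g'.+1 then (odflt 0 (tau f Y x) + return_time g' (F x))%N else 0%N.

Lemma iter_first_return g x : iter g F x = iter (return_time g x) f x.
Proof.
elim: g x => [//|g IH] x; rewrite iterSr IH /= addnC iterD; congr (iter _ _ _).
by rewrite /first_return; case: (tau f Y x).
Qed.

Lemma iter_return_recurrent g x : Z x -> Z (iter g F x).
Proof. by move=> Zx; elim: g => // g; exact: recurrent_first_return. Qed.

Lemma iter_return_recurrent_inv g x : Y x -> Z (iter g F x) -> Z x.
Proof. by move=> Yx; rewrite iter_first_return; exact: recurrent_iter_inv. Qed.

End return_times.

Section restricted_measure.
Context {d : measure_display} {R : realType} {X : measurableType d}.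

Lemma fmeas_measure (mu : {measure set X -> \bar R}) (W : set X) :
  measurable W -> (mu W < +oo)%E -> fmeas (fun A => fine (mu (A `&` W))).
Proof.
move=> mW Wfin.
have fin A : measurable A -> mu (A `&` W) \is a fin_num.
  move=> mA; rewrite ge0_fin_numE ?measure_ge0//; apply: le_lt_trans Wfin.
  by apply: le_measure => //; rewrite ?inE//; exact: measurableI.
split.
- by move=> A mA; exact/fine_ge0/measure_ge0.
- move=> A B mA mB AB; rewrite setIUl measureU ?fineD ?fin//.
  + exact: measurableI.
  + exact: measurableI.
  + by rewrite setIACA AB set0I.
- move=> A mA dA A0; suff : mu (A n `&` W) @[n --> \oo] --> (0%:E : \bar R) by move=> /fine_cvg.
  have -> : 0%:E = mu (\bigcap_n (A n `&` W)).
    rewrite (_ : \bigcap_n _ = set0) ?measure0//; apply/seteqP; split => // x h.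
    have : (\bigcap_n A n) x by move=> n _; have [] := h n I.
    by rewrite A0.
  apply: nonincreasing_cvg_mu.
  + by have := fin _ (mA 0%N); rewrite ge0_fin_numE ?measure_ge0.
  + by move=> n; exact: measurableI.
  + by apply: bigcap_measurable; [exists 0%N|move=> n _; exact: measurableI].
  + move=> n n' nn'; apply/subsetPset => x [Ax Wx]; split => //.
    exact: dA nn' _ Ax.
Qed.

End restricted_measure.

Section induced_regularity.
Context {d : measure_display} {R : realType} {X : measurableMetricType d R}.
Variables (m : probability X R) (f : X -> X) (P : set (set X)) (Y : set X).
Hypotheses (f_meas : measurable_fun setT f) (f_cons : conservative_map m f).
Hypotheses (f_markov : markov_map m f P).
Hypotheses (Y_nonempty : Y !=set0) (Y_union : union_of P Y).
Hypothesis X_borel : @measurable d X = <<s [set U : set X | open U] >>.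
Hypothesis X_compact : compact [set: X].
Hypothesis F_gibbs_markov : gibbs_markov m f P Y.
Hypothesis F_mixing :
  topologically_mixing (first_return f Y) (induced_partition f P Y).

Local Notation Z := (recurrent_part f Y).
Local Notation F := (first_return f Y).
Local Notation PY := (induced_partition f P Y).
Local Notation S := (return_time f Y).

Let Ppart := markov_partition f_markov.
Let Pbr := markov_branches f_markov.
Let mY := measurable_Y f_markov Y_union.
Let mZ := measurable_recurrent f_meas f_markov Y_union.
Let mb := induced_measurable f_meas f_markov Y_union.

Lemma measure_Y_pos : 0 < fine (m Y).
Proof.
have [a Pa aY] := Y_cell f_markov Y_nonempty Y_union.
rewrite fine_gt0//; apply/andP; split; last first.
  by rewrite ltey_eq fin_num_measure.
apply: lt_le_trans (cell_pos f_markov Pa) _.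
by apply: le_measure => //; rewrite inE//; exact: measurable_partition f_markov _ Pa.
Qed.

Lemma measure_recurrent_part : m Z = m Y.
Proof.
have := measure_recurrent f_meas f_cons f_markov Y_nonempty Y_union mY (@subset_refl _ _).
by rewrite setIidr// => x [].
Qed.

(** The cone of the induced map is taken with respect to this measure because its
    cells are restricted to the recurrent part, where all iterates stay. *)
Definition reference (A : set X) : R := fine (m (A `&` Z)) / fine (m Z).

Let mZ_pos : 0 < fine (m Z).
Proof. by rewrite measure_recurrent_part measure_Y_pos. Qed.

Lemma fmeas_reference : fmeas reference.
Proof.
rewrite (_ : reference = fun A => (fine (m Z))^-1 * fine (m (A `&` Z))).
  apply: fmeasZ; first by rewrite invr_ge0 ltW.
  by apply: fmeas_measure => //; rewrite ltey_eq fin_num_measure.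
by apply/funext => A; rewrite mulrC.
Qed.

Lemma reference_total : reference Z = 1.
Proof. by rewrite /reference setIid divff// gt_eqF. Qed.

Lemma referenceE A : A `<=` Z -> reference A = fine (m A) / fine (m Z).
Proof. by move=> AZ; rewrite /reference setIidl. Qed.

(** The image of a cell contains an element of [P], which has positive measure. *)
Lemma induced_cell_image_pos b : PY b -> 0 < fine (m (F @` (b `&` Z))).
Proof.
move=> Pb; have [n [a [_ Pa bY bt FE]]] := induced_cellP Ppart Pbr Pb.
have [[x bx] _] := Pb.
have : (F @` b) (F x) by exists x.
rewrite FE => -[fFx YFx].
have [a' Pa' a'x] := partition_cover Ppart (F x).
have a'Y := union_of_sub Ppart Y_union Pa' a'x YFx.
have [_ u] := Pbr (Pa n (leqnn _)).
have a'f := union_of_sub Ppart u Pa' a'x fFx.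
have mFb : measurable (F @` (b `&` Z)).
  apply: (measurable_image_F f_meas f_markov Y_union X_borel X_compact Pb).
    by apply: measurableI => //; exact: mb.
  by move=> ? [].
have ma' := measurable_partition f_markov Pa'.
rewrite fine_gt0//; apply/andP; split; last by rewrite ltey_eq fin_num_measure.
apply: lt_le_trans (cell_pos f_markov Pa') _.
rewrite -(measure_recurrent f_meas f_cons f_markov Y_nonempty Y_union ma' a'Y).
apply: le_measure; rewrite ?inE//; first exact: measurableI.
move=> y [a'y Zy].
have : (F @` b) y by rewrite FE; split; [exact: a'f|exact: a'Y].
move=> [z bz zy]; exists z => //; split => //.
apply: (@iter_return_recurrent_inv _ f Y 1) => /=; first exact: bY.
by rewrite zy.
Qed.

Lemma induced_cell_pos b : PY b -> 0 < fine (m (b `&` Z)).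
Proof.
move=> Pb; have pos := induced_cell_image_pos Pb.
have [x0 bx0] : b `&` Z !=set0.
  apply/set0P/negP => /eqP b0; move: pos.
  by rewrite b0 image_set0 measure0 ltxx.
have [th [C [_ _ h]]] := density_ratio f_markov F_gibbs_markov.
have [u [du u0 ratio]] := h b Pb.
have s0 : 0 < expR (- C) * u x0 by rewrite mulr_gt0 ?expR_gt0// u0//; case: bx0.
apply: lt_le_trans (_ : expR (- C) * u x0 * fine (m (F @` (b `&` Z))) <= _).
  by rewrite mulr_gt0.
apply: (density_ge f_meas f_markov Y_union X_borel X_compact Pb du) => //.
- by apply: measurableI => //; exact: mb.
- exact: ltW.
move=> x bx; have /(_ _) := ratio x0 x 0%N bx0 bx.
rewrite expr0 mulr1 => /(_ (fun _ _ _ h => False_ind _ (notF h))) => ux.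
by rewrite expRN ler_pdivrMl ?expR_gt0.
Qed.

(** What renewal theory uses of the Gibbs-Markov property. The set [reg] is the
    cone of regular measures, hidden behind its closure properties: sums, and
    conditioning on the time of the [g]-th return followed by [g] steps of the
    induced map. The constant [K] bounds densities relatively to [pi] after at
    least one step, and the last clause is loss of memory. *)
Lemma induced_regular : exists (reg : (set X -> R) -> Prop) (pi : set X -> R)
    (K dl : R),
  [/\ [/\ 0 < K, 0 < dl, reg pi & pi Z = 1],
      [/\ forall nu, reg nu -> fmeas nu,
          forall nu1 nu2, reg nu1 -> reg nu2 -> reg (fun A => nu1 A + nu2 A) &
          forall g (I : set nat) nu, reg nu ->
            reg (fun A => nu ([set z | Z z /\ I (S g z)] `&` iter g F @^-1` A))],
      [/\ forall A, measurable A -> A `<=` Z -> pi (Z `&` F @^-1` A) = pi A &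
          forall A, measurable A -> A `<=` Z ->
            dl * reference A <= pi A <= K * reference A],
      forall g (I : set nat) nu G, reg nu -> measurable G -> G `<=` Z ->
        nu ([set z | Z z /\ I (S g.+1 z)] `&` iter g.+1 F @^-1` G) <=
        K * nu [set z | Z z /\ I (S g.+1 z)] * pi G &
      forall e, 0 < e -> exists g, forall nu G, reg nu -> measurable G ->
        G `<=` Z ->
        `|nu (Z `&` iter g.+1 F @^-1` G) - nu Z * pi G| <= e * nu Z * pi G].
Proof.
have [c [cP Pc tc Zc]] := induced_enumeration f_markov Y_union.
have [th [C [t01 C0 ratio]]] := density_ratio f_markov F_gibbs_markov.
have FZ x : Z x -> Z (F x) by exact: recurrent_first_return.
have mbZ b : PY b -> measurable (b `&` Z).
  by move=> Pb; apply: measurableI => //; exact: mb.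
have mc k : measurable (c k).
  by have [->|[b Pb ->]] := cP k; [exact: measurable0|exact: mbZ].
have cZ k : c k `<=` Z by move=> x cx; rewrite -Zc; exists k.
have taucell k : exists n, forall x, c k x -> tau f Y x = Some n.
  have [->|[b Pb ->]] := cP k; first by exists 0%N.
  have [n [a [_ _ _ bt _]]] := induced_cellP Ppart Pbr Pb.
  by exists n.+1 => x [bx _]; exact: bt.
have mF A : measurable A -> measurable (Z `&` F @^-1` A).
  exact: measurable_first_return f_meas f_markov Y_union _.
have mcF k A : measurable A -> measurable (c k `&` F @^-1` A).
  move=> mA; rewrite -[c k](setIidl (@cZ k)) -setIA.
  by apply: measurableI => //; exact: mF.
have mJ k : measurable (F @` c k).
  have [->|[b Pb ->]] := cP k; first by rewrite image_set0; exact: measurable0.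
  apply: (measurable_image_F f_meas f_markov Y_union X_borel X_compact Pb); first exact: mbZ.
  by move=> ? [].
have imZ b : PY b -> F @` (b `&` Z) = (F @` b) `&` Z.
  move=> Pb; have [_ [_ [_ _ bY _ _]]] := induced_cellP Ppart Pbr Pb.
  apply/seteqP; split => [_ [x [bx Zx] <-]|_ [[x bx <-] ZFx]].
    by split; [exists x|exact: FZ].
  exists x => //; split => //.
  by apply: (@iter_return_recurrent_inv _ f Y 1) => //; exact: bY.
have markov k l : F @` c k `&` c l !=set0 -> c l `<=` F @` c k.
  have [->|[b Pb ->]] := cP k; first by rewrite image_set0 => -[x []].
  have [->|[b' Pb' ->]] := cP l; first by move=> _ x.
  rewrite imZ// => -[y [[Fby _] [b'y _]]] z [b'z Zz]; split => //.
  exact: (induced_markov Ppart Pbr Pb Pb' Fby b'y).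
have c_pos k : c k !=set0 -> 0 < reference (c k).
  move=> [x cx]; rewrite referenceE//; apply: divr_gt0 => //.
  have [ck|[b Pb ->]] := cP k; first by move: cx; rewrite ck.
  exact: induced_cell_pos.
have J_pos k : c k !=set0 -> 0 < reference (F @` c k).
  move=> [x cx]; rewrite referenceE; last by move=> _ [z /cZ/FZ ? <-].
  apply: divr_gt0 => //.
  have [ck|[b Pb ->]] := cP k; first by move: cx; rewrite ck.
  exact: induced_cell_image_pos.
have finJ : finite_set [set F @` c k | k in [set k | c k !=set0]].
  have [fin _] := F_gibbs_markov.
  apply: sub_finite_set (finite_image (fun A => A `&` Z) fin).
  move=> _ [k [x cx] <-]; have [ck|[b Pb ckb]] := cP k.
    by move: cx; rewrite ck.
  by exists (F @` b); [exists b|rewrite ckb imZ].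
have [eta eta0 J_big] : exists2 eta : R, 0 < eta &
    forall k, c k !=set0 -> eta <= reference (F @` c k).
  have [s [k ck <-]|N HN] := @finite_eventually _ _
      (fun s n => n.+1%:R^-1 <= reference s) finJ.
    have [N] := ltr_add_invr (J_pos k ck); rewrite add0r => Nk.
    exists N => n Nn; apply: le_trans (ltW Nk).
    by rewrite lef_pV2 ?posrE// ler_nat.
  exists N.+1%:R^-1; first by rewrite invr_gt0.
  by move=> k ck; apply: HN => //; exists k.
have distortion k q G G' : measurable G -> measurable G' ->
    G `<=` F @` c k -> G' `<=` F @` c k -> cylinder_close F c q G G' ->
    reference (c k `&` F @^-1` G) * reference G' <=
    expR (C * th ^+ q) * reference (c k `&` F @^-1` G') * reference G.
  move=> mG mG' GJ G'J GG'.
  have JZ : F @` c k `<=` Z by move=> _ [z /cZ/FZ ? <-].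
  have sub (H : set X) : c k `&` F @^-1` H `<=` Z by move=> x [/cZ].
  have im (H : set X) : H `<=` F @` c k -> F @` (c k `&` F @^-1` H) = H.
    move=> HJ; apply/seteqP; split => [_ [x [_ ?] <-]//|y Hy].
    by have [x cx xy] := HJ _ Hy; exists x => //; split => //; rewrite /preimage /= xy.
  rewrite !referenceE//; [|exact: subset_trans JZ|exact: subset_trans JZ].
  suff key : fine (m (c k `&` F @^-1` G)) * fine (m G') <=
      expR (C * th ^+ q) * fine (m (c k `&` F @^-1` G')) * fine (m G).
    have w0 : 0 <= (fine (m Z))^-1 * (fine (m Z))^-1 by rewrite mulr_ge0 ?invr_ge0 ?ltW.
    by rewrite mulrACA [X in _ <= X * _]mulrA [leRHS]mulrACA; exact: ler_wpM2r.
  have [ck0|[b Pb ckb]] := cP k.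
    by rewrite ck0 !set0I measure0 !(mul0r, mulr0).
  have [u [du u0 rat]] := ratio b Pb.
  have Ab (H : set X) : c k `&` F @^-1` H `<=` b by rewrite ckb => x [[]].
  have [G'0|[y0 G'y0]] : G' = set0 \/ G' !=set0.
    by have [->|/set0P] := eqVneq G' set0; [left|right].
    by rewrite G'0 measure0 mulr0 !mulr_ge0 ?expR_ge0 ?fine_measure_ge0.
  have up y : (c k `&` F @^-1` G') y -> fine (m (c k `&` F @^-1` G)) <=
      expR (C * th ^+ q) * u y * fine (m G).
    move=> [cy G'y]; rewrite -[in leRHS](im _ GJ).
    apply: (density_le f_meas f_markov Y_union X_borel X_compact Pb du) => //.
      exact: mcF.
    move=> x [cx Gx]; apply: rat; rewrite -?ckb//.
    move=> i b' Pb' iq b'x.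
    have [l cl] := Pc b' Pb'.
    have : c l (iter i F (F y)).
      apply: (GG' (F x) (F y) i l) => //.
      rewrite cl; split; first by rewrite -iterSr.
      by rewrite -iterSr; apply: iter_return_recurrent; exact: cZ cx.
    by rewrite cl iterSr => -[].
  have [mG0|mGpos] := leP (fine (m G)) 0.
    have [x0 cx0 Fx0] := G'J _ G'y0.
    have Gz : fine (m G) = 0 by apply/eqP; rewrite eq_le mG0 fine_measure_ge0.
    have := up x0 (conj cx0 _); rewrite Gz mulr0 => /(_ _) h.
    have h0 : fine (m (c k `&` F @^-1` G)) <= 0.
      by apply: h; rewrite /preimage /= Fx0.
    rewrite mulr0; apply: mulr_le0_ge0 => //; exact: fine_measure_ge0.
  pose s := fine (m (c k `&` F @^-1` G)) / (expR (C * th ^+ q) * fine (m G)).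
  have den : 0 < expR (C * th ^+ q) * fine (m G) by rewrite mulr_gt0 ?expR_gt0.
  have s0 : 0 <= s by rewrite divr_ge0 ?fine_measure_ge0// ltW.
  have lo : s * fine (m G') <= fine (m (c k `&` F @^-1` G')).
    rewrite -[in leLHS](im _ G'J).
    apply: (density_ge f_meas f_markov Y_union X_borel X_compact Pb du) => //.
      exact: mcF.
    move=> y /up; rewrite /s ler_pdivrMr// => h; apply: le_trans h _.
    by rewrite le_eqVlt; apply/orP; left; apply/eqP; ring.
  move: lo; rewrite /s mulrAC ler_pdivrMr// => lo; apply: le_trans lo _.
  by rewrite le_eqVlt; apply/orP; left; apply/eqP; ring.
have mix k l : c k !=set0 -> c l !=set0 -> exists N,
    forall n, (N <= n)%N -> exists x, c k x /\ c l (iter n F x).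
  move=> [x0 ckx0] [z clz].
  have [ck|[b Pb ckb]] := cP k; first by move: ckx0; rewrite ck.
  have [cl|[b' Pb' clb]] := cP l; first by move: clz; rewrite cl.
  have [N _ HN] := F_mixing Pb Pb'.
  exists N => n Nn; have [_ [[x bx <-] b'x]] := HN n Nn.
  have [_ [_ [_ _ bY _ _]]] := induced_cellP Ppart Pbr Pb.
  have [bs Hbs] := induced_orbit_cells Ppart Pbr Y_union Pb' b'x (bY _ bx).
  have bs0 : bs 0%N = b.
    exact: (induced_meet Ppart Pbr (Hbs 0%N isT).1 Pb (Hbs 0%N isT).2 bx).
  have bsn : bs n = b'.
    exact: (induced_meet Ppart Pbr (Hbs n (leqnn _)).1 Pb' (Hbs n (leqnn _)).2 b'x).
  have [|x' bx' x'z] := @induced_follow _ f P Y Ppart Pbr n bs x z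
    (fun i ni => (Hbs i ni).1) (fun i ni => (Hbs i ni).2).
    by move: clz; rewrite clb bsn => -[].
  exists x'; rewrite clb ckb x'z.
  move: clz; rewrite clb => -[b'z Zz]; rewrite bs0 in bx'.
  do 2 split => //.
  by apply: (@iter_return_recurrent_inv _ f Y n); [exact: bY|rewrite x'z].
have [pi [dl [[regpi piZ dl0] piinv pibd pimix]]] := cone_invariant_measure mZ FZ mF
  mc tc Zc fmeas_reference reference_total t01 (ltW C0) eta0 mJ markov c_pos J_big
  distortion finJ mix.
pose K0 := sup_const th C eta.
have K00 : 0 < K0 by exact: sup_const_gt0.
have adap g (I : set nat) : adapted Z F c g [set z | Z z /\ I (S g z)].
  elim: g I => [|g IH] I.
    have [I0|nI0] := pselect (I 0%N); [left|right].
      by apply/seteqP; split => x // [].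
    by apply/seteqP; split => // x [].
  have step k : exists2 E', adapted Z F c g E' &
      c k `&` [set z | Z z /\ I (S g.+1 z)] = c k `&` F @^-1` E'.
    have [n tn] := taucell k.
    exists [set z | Z z /\ [set i | I (n + i)%N] (S g z)]; first exact: IH.
    apply/seteqP; split => x [cx]; rewrite /preimage /= (tn _ cx) /= => -[Zx Ix].
      by split => //; split => //; exact: FZ.
    by split => //; split => //; exact: cZ cx.
  split => //; last by move=> x [].
  rewrite (_ : [set z | _] = \bigcup_k (c k `&` [set z | Z z /\ I (S g.+1 z)])).
    apply: bigcup_measurable => k _; have [E' aE' ->] := step k.
    by apply: mcF; have [] := adapted_measurable mZ aE'.
  by rewrite -setI_bigcupl Zc; apply/seteqP; split => [x [Zx Ix]|x [_]].
(* dividing by [dl] makes bounds with respect to [reference] relative to [pi] *)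
exists (cone Z F c reference th (cone_const th C)), pi, (Num.max K0 (K0 / dl)), dl.
split; [split|split|split|..] => //.
- by rewrite lt_max K00.
- by move=> nu [].
- by move=> nu1 nu2; exact: cone_add fmeas_reference.
- move=> g I nu rnu.
  exact: (cone_push_adapted mZ FZ mF mc tc Zc fmeas_reference t01 (ltW C0) mJ markov
    c_pos distortion (adap g I) rnu).
- move=> A mA AZ; have /andP[-> h] := pibd A mA AZ; apply: le_trans h _.
  apply: ler_wpM2r; first by have [p _ _] := fmeas_reference; exact: p.
  by rewrite le_max lexx.
- move=> g I nu G rnu mG GZ.
  have := cone_upper_adapted mZ FZ mF mc tc Zc fmeas_reference t01 (ltW C0) eta0 mJ markov
    c_pos J_big distortion (adap g.+1 I) rnu mG GZ.
  rewrite -/K0 => h; apply: le_trans h _.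
  have /andP[lo _] := pibd G mG GZ.
  have nu0 : 0 <= nu [set z | Z z /\ I (S g.+1 z)].
    by have [p _ _] := rnu.1; apply: p; have [] := adapted_measurable mZ (adap g.+1 I).
  have pi0 : 0 <= pi G by have [p _ _] := regpi.1; exact: p.
  apply: (@le_trans _ _ (K0 / dl * nu [set z | Z z /\ I (S g.+1 z)] * pi G)).
    rewrite [leLHS](_ : _ = K0 / dl * nu [set z | Z z /\ I (S g.+1 z)] *
        (dl * reference G)); last by field; rewrite gt_eqF.
    by rewrite ler_wpM2l// mulr_ge0// divr_ge0// ltW.
  by do 2 (apply: ler_wpM2r => //); rewrite le_max lexx orbT.
Qed.

End induced_regularity.

(** * Uniqueness of the invariant measure of the induced map *)

Section fmeas_continuity.
Context {d : measure_display} {R : realType} {X : measurableType d}.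
Implicit Types (nu pi : set X -> R) (A B D : set X).

Lemma fmeas_cvg_dec nu (A : nat -> set X) : fmeas nu -> (forall n, measurable (A n)) ->
  (forall n n', (n <= n')%N -> A n' `<=` A n) ->
  nu (A n) @[n --> \oo] --> nu (\bigcap_n A n).
Proof.
move=> fnu mA dA.
have mI : measurable (\bigcap_n A n) by apply: bigcap_measurable => //; exists 0%N.
have E n : nu (A n) = nu (\bigcap_n A n) + nu (A n `\` \bigcap_n A n).
  rewrite (fmeas_split fnu (mA n) mI) setIidr// => x; exact.
rewrite (_ : (fun n => _) = (fun n => nu (\bigcap_n A n) + nu (A n `\` \bigcap_n A n))).
  rewrite -[X in _ --> X]addr0; apply: cvgD; first exact: cvg_cst.
  have [_ _ cnt] := fnu; apply: cnt.
  - by move=> n; exact: measurableD.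
  - by move=> n n' nn' x [Ax nI]; split => //; exact: dA nn' _ Ax.
  - apply/seteqP; split => // x h; have [_] := h 0%N I; apply => n _.
    by have [] := h n I.
exact/funext.
Qed.

Lemma fmeas_cvg_inc nu (A : nat -> set X) : fmeas nu -> (forall n, measurable (A n)) ->
  (forall n n', (n <= n')%N -> A n `<=` A n') ->
  nu (A n) @[n --> \oo] --> nu (\bigcup_n A n).
Proof.
move=> fnu mA dA.
have mU : measurable (\bigcup_n A n) by exact: bigcupT_measurable.
have E n : nu (A n) = nu (\bigcup_n A n) - nu (\bigcup_n A n `\` A n).
  rewrite (fmeas_split fnu mU (mA n)) setIidr ?addrK// => x Ax; exact: bigcup_sup Ax.
rewrite (_ : (fun n => _) = (fun n => nu (\bigcup_n A n) - nu (\bigcup_n A n `\` A n))).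
  rewrite -[X in _ --> X]subr0; apply: cvgB; first exact: cvg_cst.
  have [_ _ cnt] := fnu; apply: cnt.
  - by move=> n; exact: measurableD.
  - by move=> n n' nn' x [Ux nA]; split => // Ax; exact/nA/(dA _ _ nn').
  - apply/seteqP; split => // x h; have [[n _ An] _] := h 0%N I.
    by have [_] := h n I; apply.
exact/funext.
Qed.

Lemma fmeas_modular nu (A B : set X) : fmeas nu -> measurable A -> measurable B ->
  nu (A `|` B) + nu (A `&` B) = nu A + nu B.
Proof.
move=> fnu mA mB.
rewrite (fmeas_split fnu (measurableU _ _ mA mB) mB) (fmeas_split fnu mA mB).
rewrite (_ : (A `|` B) `&` B = B); last first.
  by apply/seteqP; split => [x []//|x Bx]; split => //; right.
rewrite (_ : (A `|` B) `\` B = A `\` B); first by ring.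
apply/seteqP; split => x; first by case=> -[].
by case=> Ax nB; split => //; left.
Qed.

Section difference.
Variables (nu pi : set X -> R) (Z : set X).
Hypotheses (fnu : fmeas nu) (fpi : fmeas pi) (mZ : measurable Z).

Let s (A : set X) := nu A - pi A.

Let s_modular (A B : set X) : measurable A -> measurable B ->
  s (A `|` B) + s (A `&` B) = s A + s B.
Proof.
move=> mA mB; rewrite /s; have := fmeas_modular fnu mA mB.
by have := fmeas_modular fpi mA mB; lra.
Qed.

(** Half of a Hahn decomposition. The defects of near-maximal sets with respect to
    the supremum add up under intersection, by modularity; if they are summable,
    late intersections are near-maximal, and their increasing union is maximal. *)
Lemma fmeas_maximal_set : exists D, [/\ measurable D, D `<=` Z &
  forall A, measurable A -> A `<=` Z -> s A <= s D].
Proof.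
pose V := [set r | exists A, [/\ measurable A, A `<=` Z & r = s A]].
have ubV : has_ubound V.
  exists (nu Z) => _ [A [mA AZ ->]].
  have : nu A <= nu Z by exact: fmeas_le.
  have [p _ _] := fpi; have := p A mA; rewrite /s; lra.
have supV : has_sup V.
  by split => //; exists (s set0), set0; split => //; exact: sub0set.
pose t := sup V.
have st A : measurable A -> A `<=` Z -> s A <= t.
  by move=> mA AZ; apply: ub_le_sup => //; exists A.
have e0 k : 0 < 2 ^- k :> R by rewrite invr_gt0 exprn_gt0.
have /choice[D HD] : forall k, exists D, [/\ measurable D, D `<=` Z & t - 2 ^- k <= s D].
  move=> k; have [_ [D [mD DZ ->]] tD] := sup_adherent (e0 k) supV.
  by exists D; split => //; exact: ltW.
have mD k : measurable (D k) by have [] := HD k.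
have DZ k : D k `<=` Z by have [] := HD k.
pose I_ n N := \bigcap_(k in [set k | (n <= k <= n + N)%N]) D k.
have mI n N : measurable (I_ n N).
  by apply: bigcap_measurable => //; exists n => /=; rewrite leqnn leq_addr.
have IZ n N : I_ n N `<=` Z.
  by move=> x h; apply: (DZ n); apply: h; rewrite /= leqnn leq_addr.
have IS n N : I_ n N.+1 = I_ n N `&` D (n + N).+1.
  apply/seteqP; split => x.
    move=> h; split; last by apply: h; rewrite /= addnS leqnn andbT (leq_trans (leq_addr N n)).
    by move=> k /= /andP[nk kN]; apply: h; rewrite /= nk (leq_trans kN)// addnS.
  move=> [h Dx] k /= /andP[nk]; rewrite addnS leq_eqVlt => /orP[/eqP ->//|kN].
  by apply: h; rewrite /= nk.
have sI n N : t - 2 * 2 ^- n + 2 ^- (n + N) <= s (I_ n N).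
  elim: N => [|N IH].
    have -> : I_ n 0 = D n.
      apply/seteqP; split => x; first by apply; rewrite /= addn0 leqnn.
      by move=> Dx k /= /andP[nk]; rewrite addn0 => kn; have -> : k = n by apply/eqP; rewrite eqn_leq nk kn.
    by have [_ _] := HD n; rewrite addn0; lra.
  rewrite IS; have := s_modular (mI n N) (mD (n + N).+1).
  have UZ : I_ n N `|` D (n + N).+1 `<=` Z by move=> x [/IZ|/DZ].
  have := st _ (measurableU _ _ (mI n N) (mD (n + N).+1)) UZ.
  have [_ _] := HD (n + N).+1; rewrite addnS.
  move: IH; have -> : 2 ^- (n + N) = 2 * 2 ^- (n + N).+1 :> R.
    by rewrite exprS invfM mulrA divff// mul1r.
  lra.
pose W n := \bigcap_N I_ n N.
have mW n : measurable (W n) by apply: bigcap_measurable => //; exists 0%N.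
have sW n : t - 2 * 2 ^- n <= s (W n).
  have lim : s (I_ n N) @[N --> \oo] --> s (W n).
    have dI N N' : (N <= N')%N -> I_ n N' `<=` I_ n N.
      move=> NN' x h k /= /andP[nk kN]; apply: h; rewrite /= nk.
      by rewrite (leq_trans kN)// leq_add2l.
    by apply: cvgB; exact: fmeas_cvg_dec.
  rewrite -(cvg_lim _ lim)//; apply: limr_ge; first by apply: cvgP lim.
  exists 0%N => // N _; apply: le_trans (sI n N).
  by rewrite lerDl ltW.
have WS n n' : (n <= n')%N -> W n `<=` W n'.
  move=> nn' x h N _ k /= /andP[nk kN].
  by apply: (h (n' + N)%N I) => /=; rewrite (leq_trans nn' nk) (leq_trans kN)// leq_addl.
exists (\bigcup_n W n); split; first exact: bigcupT_measurable.
  by move=> x [n _ h]; apply: (IZ n 0%N); exact: h.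
move=> A mA AZ; apply: le_trans (st A mA AZ) _.
have lim : s (W n) @[n --> \oo] --> s (\bigcup_n W n).
  by apply: cvgB; exact: fmeas_cvg_inc.
have lim2 : t - 2 * 2 ^- n @[n --> \oo] --> t - 2 * 0.
  apply: cvgB; first exact: cvg_cst.
  apply: cvgM; first exact: cvg_cst.
  under eq_fun do rewrite -exprVn.
  by apply: cvg_expr; rewrite ger0_norm; lra.
rewrite mulr0 subr0 in lim2.
apply: (ler_cvg_to lim2 lim).
by exists 0%N => // n _; exact: sW.
Qed.

End difference.
End fmeas_continuity.

Section return_time_theory.
Context {X : Type}.
Variables (f : X -> X) (Y : set X).

Local Notation Z := (recurrent_part f Y).
Local Notation F := (first_return f Y).
Local Notation S := (return_time f Y).

Lemma return_timeD j k x : S (j + k)%N x = (S j x + S k (iter j F x))%N.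
Proof.
elim: j x => [//|j IH] x; rewrite addSn /= IH addnA; congr (_ + S k _)%N.
by rewrite -iterS iterSr.
Qed.

Lemma return_time_lt k x : Z x -> (S k x < S k.+1 x)%N.
Proof.
move=> Zx; have -> : S k.+1 x = (S k x + S 1 (iter k F x))%N.
  by rewrite -return_timeD addn1.
rewrite -[X in (X < _)%N]addn0 ltn_add2l /= addn0.
have [n tn] := recurrent_tau (iter_return_recurrent k Zx).
by rewrite tn /=; have /tauP[] := tn.
Qed.

Lemma return_time_mono j k x : Z x -> (j <= k)%N -> (S j x <= S k x)%N.
Proof.
move=> Zx; elim: k => [|k IH]; first by rewrite leqn0 => /eqP ->.
rewrite leq_eqVlt ltnS => /orP[/eqP ->//|/IH jk].
exact: leq_trans jk (ltnW (return_time_lt k Zx)).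
Qed.

Lemma return_time_ge k x : Z x -> (k <= S k x)%N.
Proof.
by move=> Zx; elim: k => // k IH; exact: leq_ltn_trans IH (return_time_lt k Zx).
Qed.

Lemma return_time_visit n x : Z x -> Y (iter n f x) -> exists k, S k x = n.
Proof.
elim/ltn_ind: n x => -[|n] IH x Zx Yn; first by exists 0%N.
have [t tx /andP[t1 tn]] := tau_le (isT : 0 < n.+1)%N Yn.
have [|||k kE] := IH (n.+1 - t)%N _ (F x).
- by rewrite ltn_subrL t1.
- exact: recurrent_first_return.
- by rewrite (first_returnE tx) -iterD subnK.
by exists k.+1; rewrite /= tx kE /= subnKC.
Qed.

(** Every visit of the orbit under [f] to [Y] is a return, hence belongs to the
    orbit under [F]. *)
Lemma limsup_first_return (D : set X) x : D `<=` Y -> Z x ->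
  (forall N, exists2 n, (N <= n)%N & D (iter n f x)) <->
  (forall N, exists2 n, (N <= n)%N & D (iter n F x)).
Proof.
move=> DY Zx; split => h N.
  have [n Nn Dn] := h (S N x); have [k kE] := return_time_visit Zx (DY _ Dn).
  exists k; last by rewrite iter_first_return kE.
  rewrite leqNgt; apply/negP => kN.
  have := return_time_mono Zx kN; have := return_time_lt k Zx; rewrite kE; lia.
have [n Nn Dn] := h N; exists (S n x); last by rewrite -iter_first_return.
exact: leq_trans Nn (return_time_ge n Zx).
Qed.

End return_time_theory.

Section uniqueness.
Context {d : measure_display} {R : realType} {X : measurableMetricType d R}.
Variables (m : probability X R) (f : X -> X) (Y : set X).
Hypotheses (f_meas : measurable_fun setT f) (f_exact : exact_map m f).

Local Notation Z := (recurrent_part f Y).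
Local Notation F := (first_return f Y).

Hypotheses (mY : measurable Y) (mZ : measurable Z).
Hypothesis mF : forall A, measurable A -> measurable (Z `&` F @^-1` A).

Lemma exact_limsup (D : set X) : measurable D ->
  let E := [set x | forall N, exists2 n, (N <= n)%N & D (iter n f x)] in
  measurable E /\ (m E = 0%E \/ m E = 1%E).
Proof.
move=> mD E.
have mE : measurable E.
  rewrite (_ : E = \bigcap_N \bigcup_(n in [set n | (N <= n)%N]) (iter n f @^-1` D)).
    apply: bigcap_measurable; first by exists 0%N.
    by move=> N _; apply: bigcup_measurable => n _; exact: measurable_iter_preimage.
  apply/seteqP; split => x h N.
    by move=> _; have [n Nn Dn] := h N; exists n.
  by have [n Nn Dn] := h N I; exists n.
split=> //; apply: f_exact => n; exists E => //.
apply/seteqP; split => x h N.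
  have [k Nk Dk] := h (N + n)%N; exists (k - n)%N.
    by rewrite leq_subRL ?(leq_trans (leq_addl _ _) Nk)// addnC.
  by rewrite -iterD subnK// (leq_trans (leq_addl _ _) Nk).
have [k Nk Dk] := h N; exists (k + n)%N; last by rewrite iterD.
exact: leq_trans (leq_addr _ _).
Qed.

(** If [nu] and [pi] are invariant, the set where [nu - pi] is maximal may be
    replaced by the set of points visiting it infinitely often, which exactness
    makes trivial. *)
Lemma invariant_measure_unique (nu pi : set X -> R) : fmeas nu -> fmeas pi ->
  (forall A, measurable A -> A `<=` Z -> m A = 0%E -> nu A = 0) ->
  (forall A, measurable A -> A `<=` Z -> m A = 0%E -> pi A = 0) ->
  (forall A, measurable A -> A `<=` Z -> nu (Z `&` F @^-1` A) = nu A) ->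
  (forall A, measurable A -> A `<=` Z -> pi (Z `&` F @^-1` A) = pi A) ->
  nu Z = pi Z -> forall A, measurable A -> A `<=` Z -> nu A = pi A.
Proof.
move=> fnu fpi nu_ac pi_ac nu_inv pi_inv nupiZ.
have [D [mD DZ Dmax]] := fmeas_maximal_set fnu fpi mZ.
pose s (A : set X) := nu A - pi A.
pose T k := Z `&` iter k F @^-1` D.
have TS k : T k.+1 = Z `&` F @^-1` (T k).
  apply/seteqP; split => x [Zx].
    rewrite /preimage/= -iterS iterSr => Dx.
    by split => //; split => //; exact: recurrent_first_return.
  by case=> _ Dx; split => //; move: Dx; rewrite /preimage /= -iterSr.
have mT k : measurable (T k).
  elim: k => [|k IH]; last by rewrite TS; exact: mF.
  by apply: measurableI.
have TZ k : T k `<=` Z by move=> x [].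
have sT k : s (T k) = s D.
  elim: k => [|k IH]; last by rewrite TS /s nu_inv// pi_inv.
  by rewrite /T setIidr.
have smax (A B : set X) : measurable A -> measurable B -> A `<=` Z -> B `<=` Z ->
    s A = s D -> s B = s D -> s (A `|` B) = s D.
  move=> mA mB AZ BZ sA sB.
  have h1 := Dmax _ (measurableU _ _ mA mB) (fun x => or_ind (@AZ x) (@BZ x)).
  have h2 := Dmax _ (measurableI _ _ mA mB) (fun x ABx => AZ x ABx.1).
  have := fmeas_modular fnu mA mB; have := fmeas_modular fpi mA mB.
  by move: sA sB h1 h2; rewrite /s; lra.
pose U n N := \bigcup_(k in [set k | (n <= k <= n + N)%N]) T k.
have mU n N : measurable (U n N) by apply: bigcup_measurable.
have UZ n N : U n N `<=` Z by move=> x [k _ /TZ].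
have sU n N : s (U n N) = s D.
  elim: N => [|N IH].
    rewrite -(sT n); congr s; apply/seteqP; split => [x [k /= ]|x Tx].
      by rewrite addn0 -eqn_leq => /eqP ->.
    by exists n => //=; rewrite addn0 leqnn.
  have -> : U n N.+1 = U n N `|` T (n + N).+1.
    apply/seteqP; split => [x [k /= /andP[nk]]|x [[k /= /andP[nk kN] Tx]|Tx]].
    - rewrite addnS leq_eqVlt => /orP[/eqP ->|kN] Tx; [by right|left].
      by exists k => //=; rewrite nk.
    - by exists k => //=; rewrite nk addnS ltnW.
    - by exists (n + N).+1 => //=; rewrite addnS leqnn andbT (leq_trans (leq_addr N n)).
  exact: smax.
pose V n := \bigcup_N U n N.
have mV n : measurable (V n) by exact: bigcupT_measurable.
have VE n x : V n x <-> exists2 k, (n <= k)%N & T k x.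
  split=> [[N _ [k /= /andP[nk _] Tx]]|[k nk Tx]]; first by exists k.
  by exists k => //; exists k => //=; rewrite nk leq_addl.
have sV n : s (V n) = s D.
  have lim : s (U n N) @[N --> \oo] --> s (V n).
    have iU N N' : (N <= N')%N -> U n N `<=` U n N'.
      move=> NN' x [k /= /andP[nk kN] Tx]; exists k => //=.
      by rewrite nk (leq_trans kN)// leq_add2l.
    by apply: cvgB; exact: fmeas_cvg_inc.
  apply: (cvg_unique (@Rhausdorff R) lim).
  by rewrite (_ : (fun N => _) = (fun=> s D)); [exact: cvg_cst|exact/funext].
have sW : s (\bigcap_n V n) = s D.
  have lim : s (V n) @[n --> \oo] --> s (\bigcap_n V n).
    have dV n n' : (n <= n')%N -> V n' `<=` V n.
      by move=> nn' x /VE[k nk Tx]; apply/VE; exists k => //; exact: leq_trans nk.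
    by apply: cvgB; exact: fmeas_cvg_dec.
  apply: (cvg_unique (@Rhausdorff R) lim).
  by rewrite (_ : (fun N => _) = (fun=> s D)); [exact: cvg_cst|exact/funext].
have DY : D `<=` Y by move=> x /DZ[].
have [mE E01] := exact_limsup mD.
set E := (X in measurable X) in mE E01.
have WE : \bigcap_n V n = Z `&` E.
  apply/seteqP; split => [x h|x [Zx /(limsup_first_return DY Zx) h] n _].
    have Zx : Z x by have /VE[k _ []] := h 0%N I.
    split => //; apply/(limsup_first_return DY Zx) => N.
    by have /VE[k Nk [_ Dk]] := h N I; exists k.
  by apply/VE; have [k nk Dk] := h n; exists k.
have sD0 : s D = 0.
  rewrite -sW WE; case: E01 => mE0.
    have mZE0 : m (Z `&` E) = 0%E.
      by apply: (subset_measure0 _ mE _ mE0); [exact: measurableI|move=> x []].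
    by rewrite /s nu_ac ?pi_ac ?subrr//; (exact: measurableI || exact: subIsetl).
  have mZE0 : m (Z `\` E) = 0%E.
    apply: (@subset_measure0 _ _ _ m _ (~` E)); [exact: measurableD|exact: measurableC| |].
      by move=> x [].
    by have /= -> := probability_setC m mE; move: mE0 => /= ->; rewrite subee.
  have mZE : measurable (Z `\` E) by exact: measurableD.
  have := fmeas_split fnu mZ mE; rewrite (nu_ac _ mZE (@subDsetl _ _ _) mZE0).
  by have := fmeas_split fpi mZ mE; rewrite (pi_ac _ mZE (@subDsetl _ _ _) mZE0) /s; lra.
move=> A mA AZ.
have h1 := Dmax A mA AZ.
have h2 := Dmax (Z `\` A) (measurableD mZ mA) (@subDsetl _ _ _).
have := fmeas_split fnu mZ mA; have := fmeas_split fpi mZ mA; rewrite !setIidr//.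
by move: sD0 h1 h2; rewrite /s; lra.
Qed.

End uniqueness.

Section induced_invariance.
Context {d : measure_display} {R : realType} {X : measurableMetricType d R}.
Variables (mu : {measure set X -> \bar R}) (f : X -> X) (Y : set X).
Hypotheses (f_meas : measurable_fun setT f).
Hypothesis mu_inv : forall A, measurable A -> mu (f @^-1` A) = mu A.

Local Notation Z := (recurrent_part f Y).
Local Notation F := (first_return f Y).

Hypotheses (mY : measurable Y) (mZ : measurable Z) (muZ : (mu Z < +oo)%E).
Hypothesis mF : forall A, measurable A -> measurable (Z `&` F @^-1` A).

(** Pulling back [A] repeatedly under [f], the part that falls in [Y] at step [n]
    is where the [n]-th iterate is the first return; what never falls in [Y] can
    only lose mass, and the total masses agree. *)
Lemma induced_invariant (A : set X) : measurable A -> A `<=` Z ->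
  fine (mu ((Z `&` F @^-1` A) `&` Z)) = fine (mu (A `&` Z)).
Proof.
pose nu (A : set X) := fine (mu (A `&` Z)).
have fnu : fmeas nu by exact: fmeas_measure.
have le_nu (B : set X) : measurable B -> B `<=` Z -> nu (Z `&` F @^-1` B) <= nu B.
  move=> mB BZ.
  pose E n := [set x | (forall j, (j < n)%N -> ~ Y (iter j f x)) /\ B (iter n f x)].
  have mE n : measurable (E n).
    rewrite (_ : E n = (\bigcap_(j in [set j | (j < n)%N]) (iter j f @^-1` (~` Y)))
      `&` (iter n f @^-1` B)); last by apply/seteqP; split => x [h Bx]; split.
    apply: measurableI; last exact: measurable_iter_preimage.
    case: n => [|n].
      by rewrite (_ : [set j | (j < 0)%N] = set0) ?bigcap_set0//; apply/seteqP; split.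
    apply: bigcap_measurable; first by exists 0%N.
    by move=> j _; apply: measurable_iter_preimage => //; exact: measurableC.
  pose T n := f @^-1` E n `&` Y.
  have mfE n : measurable (f @^-1` E n) by apply: (measurable_iter_preimage f_meas 1).
  have mT n : measurable (T n) by exact: measurableI.
  have fE n : f @^-1` E n = T n `|` E n.+1.
    apply/seteqP; split => x.
      move=> Ex; have [Yx|nYx] := pselect (Y x); [by left|right].
      case: Ex => h Bx; split; last by rewrite iterSr.
      by move=> [|j] jn //; rewrite iterSr; exact: h.
    case=> [[]//|[h Bx]]; split; last by rewrite -iterSr.
    by move=> j jn; rewrite -iterSr; exact: h.
  have TE n : T n `&` E n.+1 = set0.
    by apply/seteqP; split => // x [[_ Yx] [h _]]; exact: (h 0%N).
  pose D n := \bigcup_(i in [set i | (i < n)%N]) T i.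
  have mD n : measurable (D n) by apply: bigcup_measurable.
  have DS n : D n.+1 = D n `|` T n.
    apply/seteqP; split => x.
      by move=> [i /=]; rewrite ltnS leq_eqVlt => /orP[/eqP ->|ni] Tx; [right|left; exists i].
    by case=> [[i /= ni Tx]|Tx]; [exists i => //=; exact: ltnW|exists n => /=].
  have DT n : D n `&` T n = set0.
    apply/seteqP; split => // x [[i /= ni [[_ Bi] _]] [[h _] _]].
    by apply: (h i ni); have [] := BZ _ Bi.
  have mass n : (mu (D n) + mu (E n) = mu B)%E.
    elim: n => [|n IH].
      rewrite (_ : D 0%N = set0); last by apply/seteqP; split => // x [].
      by rewrite measure0 add0e; congr (mu _); apply/seteqP; split => [x []//|x Bx]; split.
    rewrite DS measureU// -addeA -measureU//.
    by rewrite -fE -IH; congr (_ + _)%E; exact: mu_inv.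
  have DB n : (mu (D n) <= mu B)%E by rewrite -(mass n) leeDl.
  have sub : Z `&` F @^-1` B `<=` \bigcup_n (D n).
    move=> x [Zx BFx]; have [n tn] := recurrent_tau Zx.
    move: BFx; rewrite /preimage /= (first_returnE tn).
    have /tauP[n1 _ h] := tn; case: n n1 h {tn} => // n _ h Bx.
    exists n.+1 => //; exists n => //=; split; last by case: Zx.
    split; last by rewrite -iterSr.
    by move=> j jn; rewrite -iterSr; apply: h.
  have muB : mu B \is a fin_num.
    rewrite ge0_fin_numE ?measure_ge0//; apply: le_lt_trans muZ.
    by apply: le_measure => //; rewrite inE.
  have lim := fmeas_cvg_inc fnu mD (_ : forall n n', (n <= n')%N -> D n `<=` D n').
  apply: le_trans (_ : nu (\bigcup_n D n) <= _).
    by apply: fmeas_le => //; [exact: mF|exact: bigcupT_measurable].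
  rewrite -(cvg_lim _ (lim _))//; last first.
    by move=> n n' nn' x [i /= ni Tx]; exists i => //=; exact: leq_trans nn'.
  apply: limr_le.
    apply: cvgP (lim _).
    by move=> n n' nn' x [i /= ni Tx]; exists i => //=; exact: leq_trans nn'.
  exists 0%N => // n _; rewrite /nu (setIidl BZ); apply: fine_le => //.
    rewrite ge0_fin_numE ?measure_ge0//; apply: le_lt_trans muZ.
    by apply: le_measure => //; rewrite inE//; exact: measurableI.
  apply: le_trans (DB n).
  by apply: le_measure => //; rewrite inE//; exact: measurableI.
move=> mA AZ; rewrite -/(nu A) -/(nu (Z `&` F @^-1` A)).
have h1 := le_nu A mA AZ.
have mZA : measurable (Z `\` A) by exact: measurableD.
have h2 := le_nu _ mZA (@subDsetl _ _ _).
have e1 : Z `&` (Z `&` F @^-1` A) = Z `&` F @^-1` A by rewrite setIA setIid.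
have e2 : Z `\` (Z `&` F @^-1` A) = Z `&` F @^-1` (Z `\` A).
  apply/seteqP; split => x [Zx h]; split => //.
    split; first exact: recurrent_first_return.
    by move=> Ax; apply: h.
  by move=> [_ Ax]; case: h => _; apply.
have := fmeas_split fnu mZ mA; have := fmeas_split fnu mZ (mF mA).
by rewrite e1 e2 (setIidr AZ); move: h1 h2; lra.
Qed.

End induced_invariance.

(** * Renewal estimates *)

Section finite_unions.
Context {d : measure_display} {R : realType} {X : measurableType d}.
Variables (nu : set X -> R) (B : nat -> set X).
Hypotheses (fnu : fmeas nu) (mB : forall q, measurable (B q)).

Let U n := \bigcup_(q in [set q | (q < n)%N]) B q.

Let mU n : measurable (U n). Proof. exact: bigcup_measurable. Qed.

Let U0 : U 0 = set0.
Proof. by apply/seteqP; split => // x []. Qed.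

Let US n : U n.+1 = U n `|` B n.
Proof.
apply/seteqP; split => x.
  by move=> [q /=]; rewrite ltnS leq_eqVlt => /orP[/eqP ->|qn] Bx; [right|left; exists q].
by case=> [[q /= qn Bx]|Bx]; [exists q => //=; exact: ltnW|exists n => /=].
Qed.

Lemma fmeas_sum_disjoint n : (forall q q' x, B q x -> B q' x -> q = q') ->
  \sum_(q < n) nu (B q) = nu (U n).
Proof.
move=> tB; elim: n => [|n IH]; first by rewrite big_ord0 U0 (fmeas_set0 fnu).
rewrite big_ord_recr /= IH US; have [_ add _] := fnu; rewrite add//.
apply/seteqP; split => // x [[q /= qn Bq] Bn].
by move: qn; rewrite (tB _ _ _ Bq Bn) ltnn.
Qed.

Lemma fmeas_union_le n : nu (U n) <= \sum_(q < n) nu (B q).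
Proof.
elim: n => [|n IH]; first by rewrite big_ord0 U0 (fmeas_set0 fnu).
rewrite big_ord_recr /= US.
have := fmeas_modular fnu (mU n) (mB n).
have : 0 <= nu (U n `&` B n) by have [p _ _] := fnu; apply: p; exact: measurableI.
lra.
Qed.

End finite_unions.

Section renewal.
Context {d : measure_display} {R : realType} {X : measurableMetricType d R}.
Variables (f : X -> X) (Y : set X).
Hypotheses (f_meas : measurable_fun setT f).

Local Notation Z := (recurrent_part f Y).
Local Notation F := (first_return f Y).
Local Notation S := (return_time f Y).

Hypotheses (mY : measurable Y) (mZ : measurable Z).
Hypothesis mF : forall A, measurable A -> measurable (Z `&` F @^-1` A).

Definition return_time_in (g : nat) (I : set nat) : set X :=
  [set z | Z z /\ I (S g z)].

Local Notation V := return_time_in.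

Variables (reg : (set X -> R) -> Prop) (pi : set X -> R) (K : R).
Hypotheses (reg_fmeas : forall nu, reg nu -> fmeas nu).
Hypothesis reg_add :
  forall nu1 nu2, reg nu1 -> reg nu2 -> reg (fun A => nu1 A + nu2 A).
Hypothesis reg_push : forall g (I : set nat) nu, reg nu ->
  reg (fun A => nu (V g I `&` iter g F @^-1` A)).
Hypothesis reg_upper : forall g (I : set nat) nu G, reg nu -> measurable G ->
  G `<=` Z -> nu (V g.+1 I `&` iter g.+1 F @^-1` G) <= K * nu (V g.+1 I) * pi G.
Hypotheses (reg_pi : reg pi) (pi_total : pi Z = 1).

Let FZ x : Z x -> Z (F x). Proof. exact: recurrent_first_return. Qed.

Let mpull g E A : measurable E -> E `<=` Z -> measurable A ->
  measurable (E `&` iter g F @^-1` A).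
Proof. by move=> *; apply: (measurable_restricted_iter mZ FZ mF). Qed.

Lemma return_time_in_measurable g I : measurable (V g I).
Proof.
have mt t : measurable (Z `&` [set z | tau f Y z = Some t]).
  by apply: measurableI => //; exact: measurable_tau.
elim: g I => [|g IH] I.
  have [I0|nI0] := pselect (I 0%N).
    by rewrite (_ : V 0 I = Z)//; apply/seteqP; split => x // [].
  rewrite (_ : V 0 I = set0); first exact: measurable0.
  by apply/seteqP; split => // x [].
rewrite (_ : V g.+1 I = \bigcup_t ((Z `&` [set z | tau f Y z = Some t]) `&`
    (Z `&` F @^-1` (V g [set i | I (t + i)%N])))).
  apply: bigcup_measurable => t _; apply: measurableI => //; exact: mF.
apply/seteqP; split => x.
  move=> [Zx Ix]; have [t tx] := recurrent_tau Zx.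
  exists t => //; split => //; split => //; split; first exact: FZ.
  by move: Ix; rewrite /= tx.
by move=> [t _ [[Zx tx] [_ [_ Ix]]]]; split => //; move: Ix; rewrite /= tx.
Qed.

Local Notation mV := return_time_in_measurable.

Let VZ g I : V g I `<=` Z. Proof. by move=> x []. Qed.

Let pi_fmeas : fmeas pi. Proof. exact: reg_fmeas. Qed.

Let reg_ge0 nu A : reg nu -> measurable A -> 0 <= nu A.
Proof. by move=> /reg_fmeas[p _ _]; exact: p. Qed.

Lemma upper_const_ge1 : 1 <= K.
Proof.
have := reg_upper 0 setT reg_pi mZ (@subset_refl _ _).
rewrite (_ : V 1 setT = Z); last by apply/seteqP; split => x // [].
rewrite (setIidl (_ : Z `<=` iter 1 F @^-1` Z)); last by move=> x /FZ.
by rewrite pi_total !mulr1.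
Qed.

(** The part of the law at time [j] that lies in [Z], when the initial law is
    [pi]; split according to the number of returns so far. *)
Definition occupation (j : nat) (A : set X) : R :=
  \sum_(q < j.+1) pi (V q [set j] `&` iter q F @^-1` A).

Local Notation u := occupation.

Lemma reg_occupation j : reg (u j).
Proof.
suff H n : (0 < n)%N -> reg (fun A => \sum_(q < n) pi (V q [set j] `&` iter q F @^-1` A)).
  exact: H.
elim: n => // n IH _; have [->|n0] := posnP n.
  rewrite (_ : (fun A => _) = (fun A => pi (V 0 [set j] `&` iter 0 F @^-1` A))).
    exact: reg_push.
  by apply/funext => A; rewrite big_ord1.
rewrite (_ : (fun A => _) = (fun A =>
    \sum_(q < n) pi (V q [set j] `&` iter q F @^-1` A)
    + pi (V n [set j] `&` iter n F @^-1` A))).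
  by apply: reg_add; [exact: IH|exact: reg_push].
by apply/funext => A; rewrite big_ord_recr.
Qed.

Lemma occupationE j A : measurable A -> A `<=` Z ->
  u j A = pi (Z `&` iter j f @^-1` A).
Proof.
move=> mA AZ; rewrite /occupation.
rewrite (fmeas_sum_disjoint (B := fun q => V q [set j] `&` iter q F @^-1` A) pi_fmeas).
- congr (pi _); apply/seteqP; split => x.
    move=> [q /= _ [[Zx Sx] Ax]]; split => //.
    by move: Ax; rewrite /preimage /= iter_first_return Sx.
  move=> [Zx Ax]; have [q Sq] := return_time_visit Zx (AZ _ Ax).1.
  exists q => /=; first by rewrite ltnS -[leqRHS]Sq; exact: return_time_ge.
  by split => //; rewrite /preimage /= iter_first_return Sq.
- by move=> q; apply: mpull; [exact: mV|exact: VZ|].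
- move=> q q' x [[Zx Sq] _] [[_ Sq'] _].
  apply/eqP; rewrite eqn_leq; apply/andP; split; rewrite leqNgt; apply/negP => lt.
    have := return_time_mono Zx lt; have := return_time_lt q' Zx.
    by rewrite Sq Sq'; lia.
  have := return_time_mono Zx lt; have := return_time_lt q Zx.
  by rewrite Sq Sq'; lia.
Qed.

Lemma occupation_upper j A : measurable A -> A `<=` Z ->
  u j A <= K * u j Z * pi A.
Proof.
move=> mA AZ; rewrite /occupation mulr_sumr mulr_suml; apply: ler_sum => -[[|q] qj] _ /=.
  rewrite (setIidl (_ : V 0 [set j] `<=` id @^-1` Z)); last by move=> x [].
  have piA := reg_ge0 reg_pi mA.
  have [j0|nj0] := eqVneq 0%N j.
    rewrite (_ : V 0 [set j] = Z); last by apply/seteqP; split => x // [].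
    rewrite pi_total mulr1 (setIidr (_ : id @^-1` A `<=` Z))//.
    by rewrite ler_peMl// upper_const_ge1.
  rewrite (_ : V 0 [set j] = set0); last first.
    by apply/seteqP; split => // x [_ /= e]; rewrite e eqxx in nj0.
  by rewrite set0I (fmeas_set0 pi_fmeas) mulr0 mul0r.
have := reg_upper q [set j] reg_pi mA AZ.
rewrite (setIidl (_ : V q.+1 [set j] `<=` iter q.+1 F @^-1` Z))//.
by move=> x [Zx _]; exact: iter_return_recurrent.
Qed.

Definition tail (i : nat) : set X := V 1 [set s | (i < s)%N].

(** For a given orbit, only one visit to [Z] has its [g]-th following return at or
    before time [n] and the next return after it; so the events summed here are
    disjoint. *)
Lemma occupation_disjoint g n (B : nat -> set X) : (forall j, measurable (B j)) ->
  (forall j z, (j <= n)%N -> B j z -> Z z /\ (S g z <= n - j < S g.+1 z)%N) ->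
  \sum_(j < n.+1) u j (B j) <= 1.
Proof.
move=> mB HB.
pose B' j := if (j <= n)%N then Z `&` iter j f @^-1` B j else set0.
have mB' j : measurable (B' j).
  rewrite /B'; case: ifP => _; last exact: measurable0.
  by apply: measurableI => //; exact: measurable_iter_preimage.
have -> : \sum_(j < n.+1) u j (B j) = \sum_(j < n.+1) pi (B' j).
  apply: eq_bigr => j _; have jn : (j <= n)%N by rewrite -ltnS.
  rewrite occupationE//; first by rewrite /B' jn.
  by move=> z /(HB _ _ jn)[].
rewrite (fmeas_sum_disjoint pi_fmeas mB').
  rewrite -pi_total; apply: fmeas_le => //.
    by apply: bigcup_measurable.
  by move=> x [j _]; rewrite /B'; case: ifP => // _ [].
have key j x : B' j x -> exists q, [/\ S q x = j & (S (q + g)%N x <= n < S (q + g)%N.+1 x)%N].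
  rewrite /B'; case: ifP => // jn [Zx Bx].
  have [Zz /andP[h1 h2]] := HB _ _ jn Bx.
  have [q Sq] := return_time_visit Zx Zz.1.
  have Sg : S (q + g)%N x = (j + S g (iter j f x))%N.
    by rewrite return_timeD iter_first_return Sq.
  have Sg1 : S (q + g)%N.+1 x = (j + S g.+1 (iter j f x))%N.
    by rewrite -addnS return_timeD iter_first_return Sq.
  by exists q; rewrite Sg1 Sg; split; lia.
have ZB j x : B' j x -> Z x by rewrite /B'; case: ifP => // _ [].
move=> j j' x Bj Bj'; have Zx := ZB _ _ Bj.
have [q [<- /andP[a1 a2]]] := key _ _ Bj; have [q' [<- /andP[b1 b2]]] := key _ _ Bj'.
suff -> : q = q' by [].
apply/eqP; rewrite eqn_leq; apply/andP; split; rewrite leqNgt; apply/negP => lt.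
  have := return_time_mono Zx (_ : (q' + g).+1 <= q + g)%N; rewrite ltn_add2r => /(_ lt).
  by move: a1 b2; lia.
have := return_time_mono Zx (_ : (q + g).+1 <= q' + g)%N; rewrite ltn_add2r => /(_ lt).
by move: b1 a2; lia.
Qed.

Hypothesis reg_mixing : forall e, 0 < e -> exists g, forall nu G, reg nu ->
  measurable G -> G `<=` Z ->
  `|nu (Z `&` iter g.+1 F @^-1` G) - nu Z * pi G| <= e * nu Z * pi G.

Let w i := pi (tail i).

Let u_total j : 0 <= u j Z <= 1.
Proof.
rewrite (reg_ge0 (reg_occupation j) mZ)/= occupationE// -pi_total.
apply: fmeas_le => //; apply: measurableI => //; exact: measurable_iter_preimage.
Qed.

Let w_unit i : 0 <= w i <= 1.
Proof.
rewrite /w (reg_ge0 reg_pi (mV 1 _))/= -pi_total.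
by apply: fmeas_le => //; [exact: mV|exact: VZ].
Qed.

Let u_ge0 j A : measurable A -> 0 <= u j A.
Proof. by move=> mA; apply: reg_ge0 => //; exact: reg_occupation. Qed.

Let K_ge0 : 0 <= K. Proof. exact: le_trans ler01 upper_const_ge1. Qed.

Lemma tail_time g i z : Z z -> tail i (iter g F z) -> (S g z + i < S g.+1 z)%N.
Proof.
move=> Zz [_ h].
have -> : S g.+1 z = (S g z + S 1 (iter g F z))%N by rewrite -return_timeD addn1.
by rewrite ltn_add2l.
Qed.

(** A visit whose following [g.+1] excursions are short is nearly independent of
    the excursion after them. *)
Lemma short_excursions_lower e g L j i : 0 < e ->
  (forall nu G, reg nu -> measurable G -> G `<=` Z ->
    `|nu (Z `&` iter g.+1 F @^-1` G) - nu Z * pi G| <= e * nu Z * pi G) ->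
  (1 - e - K * K * pi (V g.+1 [set s | (L < s)%N])) * (u j Z * w i) <=
    u j (V g.+1 [set s | (s <= L)%N] `&` iter g.+1 F @^-1` tail i).
Proof.
move=> e0 mix.
have mt : measurable (tail i) by exact: mV.
have VZ' g' I : V g' I `<=` Z by exact: VZ.
have tZ : tail i `<=` Z by exact: VZ.
have h1 := mix _ _ (reg_occupation j) mt tZ.
have h2 := reg_upper g [set s | (L < s)%N] (reg_occupation j) mt tZ.
have h3 := occupation_upper j (mV g.+1 [set s | (L < s)%N]) (VZ' _ _).
have split : u j (Z `&` iter g.+1 F @^-1` tail i) =
    u j (V g.+1 [set s | (s <= L)%N] `&` iter g.+1 F @^-1` tail i) +
    u j (V g.+1 [set s | (L < s)%N] `&` iter g.+1 F @^-1` tail i).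
  have [_ add _] := reg_fmeas (reg_occupation j); rewrite -add.
  - congr (u j _); apply/seteqP; split => x.
      by move=> [Zx tx]; case: (leqP (S g.+1 x) L) => h; [left|right].
    by case=> -[[Zx _] tx].
  - by apply: mpull; [exact: mV|exact: VZ|].
  - by apply: mpull; [exact: mV|exact: VZ|].
  - apply/seteqP; split => // x [[[_ /= a] _] [[_ /= b] _]].
    by move: a; rewrite leqNgt b.
have /andP[w0 _] := w_unit i.
have h4 : K * u j (V g.+1 [set s | (L < s)%N]) * w i <=
    K * K * pi (V g.+1 [set s | (L < s)%N]) * (u j Z * w i).
  rewrite [leRHS](_ : _ = K * (K * u j Z * pi (V g.+1 [set s | (L < s)%N])) * w i); last ring.
  by rewrite ler_wpM2r// ler_wpM2l.
move: h1; rewrite ler_norml split => /andP[h1 _].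
move: h1 h2 h4; rewrite -/(w i); lra.
Qed.

(** If the [g.+1] excursions that follow a visit take at most [L] in total and the
    next one outlasts the time left until [n], then [n] falls into that excursion.
    The lower bound on the probability of this must sum up to at most 1. *)
Lemma renewal_mass e g L n : 0 < e ->
  (forall nu G, reg nu -> measurable G -> G `<=` Z ->
    `|nu (Z `&` iter g.+1 F @^-1` G) - nu Z * pi G| <= e * nu Z * pi G) ->
  (1 - e - K * K * pi (V g.+1 [set s | (L < s)%N])) *
    (\sum_(i < n.+1 | (L <= i)%N) u (n - i)%N Z * w i) <= 1.
Proof.
move=> e0 mix.
pose B j := if (L <= n - j)%N then
  V g.+1 [set s | (s <= L)%N] `&` iter g.+1 F @^-1` tail (n - j) else set0.
have mB j : measurable (B j).
  rewrite /B; case: ifP => _; last exact: measurable0.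
  by apply: mpull; [exact: mV|exact: VZ|exact: mV].
have := @occupation_disjoint g.+1 n B mB.
have HB j z : (j <= n)%N -> B j z -> Z z /\ (S g.+1 z <= n - j < S g.+2 z)%N.
  rewrite /B; case: ifP => // Lnj jn [[Zz zL] tz]; split => //.
  rewrite (leq_trans zL Lnj)/=; have := tail_time Zz tz.
  by apply: leq_trans; rewrite ltnS leq_addl.
move=> /(_ HB); apply: le_trans.
rewrite mulr_sumr big_mkcond (reindex_inj rev_ord_inj) /=; apply: ler_sum => j _.
have jn : (j <= n)%N by rewrite -ltnS.
rewrite subSS /B; case: ifP => _; last exact: u_ge0.
by rewrite subKn//; exact: short_excursions_lower.
Qed.

Let age_sum n : R := \sum_(i < n.+1) u (n - i)%N Z * w i.

Let recent L n : R := \sum_(i < n.+1 | (i < L)%N) u (n - i)%N Z.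

Let recent_le L n : recent L n <= L%:R.
Proof.
rewrite /recent; apply: le_trans (_ : \sum_(i < n.+1 | (i < L)%N) 1 <= _).
  by apply: ler_sum => i _; have /andP[] := u_total (n - i)%N.
have [nL|Ln] := leqP n.+1 L.
  rewrite big_mkcond; apply: (@le_trans _ _ (\sum_(i < n.+1) 1)).
    by apply: ler_sum => i _; case: ifP.
  by rewrite sumr_const card_ord ler_nat.
by rewrite -(big_ord_widen n.+1 (fun=> 1) (ltnW Ln)) sumr_const card_ord.
Qed.

Lemma fmeas_tail_cvg g :
  pi (V g.+1 [set s | (L < s)%N]) @[L --> \oo] --> (0 : R).
Proof.
have [_ _ cnt] := pi_fmeas; apply: cnt => [n|n n' nn' x [Zx /= h]|].
- exact: mV.
- by split => //=; exact: leq_ltn_trans h.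
- apply/seteqP; split => // x h.
  by have [_ /=] := h (S g.+1 x) Logic.I; rewrite ltnn.
Qed.

(** A crude form of [renewal_mass], with the terms [i < L] bounded trivially. *)
Lemma age_sum_bounded : exists2 zeta, 0 <= zeta & forall n, age_sum n <= zeta.
Proof.
have [g mix] := reg_mixing (ltac:(lra) : 0 < 4^-1 :> R).
have K20 : 0 <= K * K by exact: mulr_ge0.
have [L hL] : exists L, K * K * pi (V g.+1 [set s | (L < s)%N]) <= 4^-1.
  have lim : K * K * pi (V g.+1 [set s | (L < s)%N]) @[L --> \oo] --> K * K * (0 : R).
    by apply: cvgM; [exact: cvg_cst|exact: fmeas_tail_cvg].
  rewrite mulr0 in lim.
  have [L _ /(_ L (leqnn _))] := cvgr_le _ lim _ (ltac:(lra) : 0 < 4^-1 :> R).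
  by exists L.
exists (2 + L%:R); first by rewrite addr_ge0.
move=> n; rewrite /age_sum (bigID (fun i : 'I_n.+1 => (L <= i)%N)) /=; apply: lerD.
  have := renewal_mass L n (ltac:(lra) : 0 < 4^-1 :> R) mix.
  have : 0 <= \sum_(i < n.+1 | (L <= i)%N) u (n - i)%N Z * w i.
    apply: sumr_ge0 => i _; apply: mulr_ge0; first exact: u_ge0.
    by have /andP[] := w_unit i.
  by move: hL; nra.
apply: le_trans (recent_le L n).
rewrite /recent (eq_bigl (fun i : 'I_n.+1 => (i < L)%N)); last by move=> i; rewrite ltnNge.
apply: ler_sum => i _; apply: ler_piMr; first exact: u_ge0.
by have /andP[] := w_unit i.
Qed.

Lemma sum_triangle (G : nat -> nat -> R) n :
  \sum_(i < n.+1) \sum_(s < i.+1) G i s =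
  \sum_(s < n.+1) \sum_(i < (n - s).+1) G (i + s)%N s.
Proof.
elim: n => [|n IH]; first by rewrite big_ord1 [RHS]big_ord1 /= sub0n !big_ord1.
rewrite big_ord_recr /= IH [RHS]big_ord_recr /= subnn big_ord1 add0n.
rewrite [X in _ + X]big_ord_recr /= addrA; congr (_ + _).
rewrite -big_split /=; apply: eq_bigr => s _.
have sn : (s <= n)%N by rewrite -ltnS.
by rewrite subSn// [RHS]big_ord_recr /= addSn subnK.
Qed.

(** Visits followed by a long stretch of [g.+1] excursions: conditioning on its
    length leaves the same sum at an earlier time. *)
Lemma long_excursions_upper g L n zeta : 0 <= zeta ->
  (forall n, age_sum n <= zeta) ->
  \sum_(i < n.+1) u (n - i)%N
    [set z | Z z /\ (L < S g.+1 z <= i)%N /\ (i < S g.+2 z)%N] <=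
  K * K * zeta * pi (V g.+1 [set s | (L < s)%N]).
Proof.
move=> zeta0 hz.
pose G i s := (K * K) * (if (L < s)%N then
  pi (V g.+1 [set s]) * (u (n - i)%N Z * w (i - s)%N) else 0).
have w0 i : 0 <= w i by have /andP[] := w_unit i.
have pV s : 0 <= pi (V g.+1 [set s]) by apply: reg_ge0 => //; exact: mV.
apply: (@le_trans _ _ (\sum_(i < n.+1) \sum_(s < i.+1) G i s)).
  apply: ler_sum => i _.
  pose Bs s := if (L < s)%N then V g.+1 [set s] `&` iter g.+1 F @^-1` tail (i - s) else set0.
  have mBs s : measurable (Bs s).
    rewrite /Bs; case: ifP => _; last exact: measurable0.
    by apply: mpull; [exact: mV|exact: VZ|exact: mV].
  have fu := reg_fmeas (reg_occupation (n - i)%N).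
  have sub : [set z | Z z /\ (L < S g.+1 z <= i)%N /\ (i < S g.+2 z)%N] =
      \bigcup_(s in [set s | (s < i.+1)%N]) Bs s.
    apply/seteqP; split => z.
      move=> [Zz [/andP[Lz zi] iz]]; exists (S g.+1 z); first by rewrite /= ltnS.
      rewrite /Bs Lz; split => //; split; first exact: iter_return_recurrent.
      have E : S g.+2 z = (S g.+1 z + S 1 (iter g.+1 F z))%N.
        by rewrite -return_timeD addn1.
      by move: iz; rewrite E -ltn_subLR.
    move=> [s /= si]; rewrite /Bs; case: ifP => // Ls [[Zz zs] tz].
    have {}zs : S g.+1 z = s := zs.
    have := tail_time Zz tz; rewrite zs => lt.
    have E : (L < S g.+1 z <= i)%N by rewrite zs Ls -ltnS.
    have E' : (i < S g.+2 z)%N by apply: leq_ltn_trans lt; move: si; lia.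
    by split.
  rewrite sub; apply: le_trans (fmeas_union_le fu mBs i.+1) _.
  apply: ler_sum => s _; rewrite /Bs /G; case: ifP => _; last first.
    by rewrite (fmeas_set0 fu) mulr0.
  have h := @reg_upper g [set val s] _ (tail (i - s)) (reg_occupation (n - i)%N)
    (mV 1 _) (@VZ _ _). apply: le_trans h _; rewrite -/(w (i - s)%N).
  rewrite [leRHS](_ : _ = K * (K * u (n - i)%N Z * pi (V g.+1 [set val s])) * w (i - s)%N);
    last ring.
  rewrite ler_wpM2r// ler_wpM2l//.
  by apply: occupation_upper; [exact: mV|exact: VZ].
rewrite sum_triangle.
apply: (@le_trans _ _ (\sum_(s < n.+1) K * K * zeta *
    (if (L < s)%N then pi (V g.+1 [set val s]) else 0))).
  apply: ler_sum => s _; rewrite /G.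
  case: ifP => Ls; last first.
    by rewrite big1 ?mulr0// => i _; rewrite mulr0.
  rewrite (_ : \sum_(i < _) _ = K * K * pi (V g.+1 [set val s]) * age_sum (n - s)).
    rewrite [leRHS]mulrAC; apply: ler_wpM2l => //.
    by rewrite !mulr_ge0.
  rewrite /age_sum mulr_sumr; apply: eq_bigr => i _.
  by rewrite addnK subnDA mulrA [(n - i - s)%N]subnAC.
rewrite -mulr_sumr; apply: ler_wpM2l; first by rewrite !mulr_ge0.
pose Bs s := if (L < s)%N then V g.+1 [set s] else set0.
have mBs s : measurable (Bs s).
  by rewrite /Bs; case: ifP => _; [exact: mV|exact: measurable0].
have -> : \sum_(s < n.+1) (if (L < s)%N then pi (V g.+1 [set val s]) else 0) =
    \sum_(s < n.+1) pi (Bs s).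
  by apply: eq_bigr => s _; rewrite /Bs; case: ifP => //; rewrite (fmeas_set0 pi_fmeas).
rewrite (fmeas_sum_disjoint pi_fmeas mBs).
  apply: fmeas_le => //; first by apply: bigcup_measurable.
    exact: mV.
  move=> x [s _]; rewrite /Bs; case: ifP => // Ls [Zx zs].
  have {}zs : S g.+1 x = s := zs.
  have E : (L < S g.+1 x)%N by rewrite zs.
  by split.
move=> s s' x; rewrite /Bs; case: ifP => // _ [_ xs]; case: ifP => // _ [_ xs'].
have {}xs : S g.+1 x = s := xs; have {}xs' : S g.+1 x = s' := xs'.
by rewrite -xs -xs'.
Qed.

Section one_channel.
Variables (T : set X) (p : R).
Hypotheses (mT : measurable T) (p01 : 0 <= p <= 1).

Definition channel (i : nat) : set X := tail i `&` iter i f @^-1` T.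

Hypothesis channel_stay : forall i i' z, (1 <= i <= i')%N -> channel i' z -> channel i z.

Let mchannel i : measurable (channel i).
Proof. by apply: measurableI; [exact: mV|exact: measurable_iter_preimage]. Qed.

(** An orbit in [T] at time [n] has made fewer than [g.+1] returns, or is followed
    from the visit [g.+1] returns before the last one. That visit may be recent,
    or separated from the last one by more than [L], or else it leads to an
    excursion that is in [T] up to a delay of at most [L]. *)
Lemma channel_decomposition g L n :
  pi (Z `&` iter n f @^-1` T) <= pi (V g.+1 [set s | (n < s)%N]) +
    \sum_(i < n.+1) u (n - i)%N
      [set z | Z z /\ (L < S g.+1 z <= i)%N /\ (i < S g.+2 z)%N] +
    \sum_(i < n.+1) (if (i <= L)%N then u (n - i)%N Z
      else u (n - i)%N (Z `&` iter g.+1 F @^-1` channel (i - L))).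
Proof.
pose C1 i := [set z | Z z /\ (L < S g.+1 z <= i)%N /\ (i < S g.+2 z)%N].
pose C2 i := if (i <= L)%N then Z else Z `&` iter g.+1 F @^-1` channel (i - L).
have mC1 i : measurable (C1 i).
  rewrite (_ : C1 i = V g.+1 [set s | (L < s <= i)%N] `&` V g.+2 [set s | (i < s)%N]).
    by apply: measurableI; exact: mV.
  apply/seteqP; split => z; first by move=> [Zz [a b]].
  by move=> [[Zz a] [_ b]].
have mC2 i : measurable (C2 i).
  rewrite /C2; case: ifP => _ //; apply: mpull => //; exact: mchannel.
have C2Z i : C2 i `<=` Z by rewrite /C2; case: ifP => _ z // [].
have C1Z i : C1 i `<=` Z by move=> z [].
pose B i := Z `&` iter (n - i) f @^-1` (C1 i `|` C2 i).
have mB i : measurable (B i).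
  by apply: measurableI => //; apply: measurable_iter_preimage => //; exact: measurableU.
have cover : Z `&` iter n f @^-1` T `<=` V g.+1 [set s | (n < s)%N] `|`
    \bigcup_(i in [set i | (i < n.+1)%N]) B i.
  move=> y [Zy Ty].
  have [nS|Sn] := ltnP n (S g.+1 y); first by left.
  right.
  (* the index of the last return before time [n] *)
  have [q Sq Sq1] : exists2 q, (S q y <= n)%N & (n < S q.+1 y)%N.
    have h : exists q, (n < S q y)%N by exists n.+1; exact: return_time_ge.
    case: (ex_minnP h) => -[//|q] nq qmin; exists q => //.
    by rewrite leqNgt; apply/negP => /qmin; rewrite ltnn.
  have gq : (g.+1 <= q)%N.
    rewrite leqNgt; apply/negP => qg.
    by have := leq_trans (leq_trans Sq1 (return_time_mono Zy qg)) Sn; rewrite ltnn.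
  pose j := S (q - g.+1)%N y.
  have jn : (j <= n)%N by apply: leq_trans Sq; apply: return_time_mono => //; exact: leq_subr.
  pose z := iter j f y.
  have zE : z = iter (q - g.+1) F y by rewrite iter_first_return.
  have Zz : Z z by rewrite zE; exact: iter_return_recurrent.
  have S1 : (j + S g.+1 z = S q y)%N by rewrite zE -return_timeD subnK.
  have S2 : (j + S g.+2 z = S q.+1 y)%N.
    by rewrite zE -return_timeD addnS subnK.
  have E : (S g.+1 z <= n - j)%N by rewrite leq_subRL// S1.
  have E' : (n - j < S g.+2 z)%N by rewrite ltn_subLR// S2.
  exists (n - j)%N; first by rewrite /= ltnS leq_subr.
  split => //; rewrite subKn// /preimage /= -/z.
  have [LS|SL] := ltnP L (S g.+1 z).
    by left; split => //; split => //; rewrite LS.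
  right; rewrite /C2; case: leqP => // Li; split => //.
  have dly : channel (n - j - S g.+1 z) (iter g.+1 F z).
    split.
      split; first exact: iter_return_recurrent.
      have E2 : S g.+2 z = (S g.+1 z + S 1 (iter g.+1 F z))%N by rewrite -return_timeD addn1.
      by move: E'; rewrite E2 -ltn_subLR.
    rewrite /preimage /mkset (iter_first_return f Y g.+1 z) -iterD subnK// /z -iterD.
    by rewrite subnK.
  apply: channel_stay dly.
  by rewrite subn_gt0 Li leq_sub2l.
have fsum : pi (Z `&` iter n f @^-1` T) <= pi (V g.+1 [set s | (n < s)%N]) +
    \sum_(i < n.+1) pi (B i).
  apply: le_trans (fmeas_le pi_fmeas _ _ cover) _.
  - by apply: measurableI => //; exact: measurable_iter_preimage.
  - by apply: measurableU; [exact: mV|exact: bigcup_measurable].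
  have mU : measurable (\bigcup_(i in [set i | (i < n.+1)%N]) B i) by exact: bigcup_measurable.
  have := fmeas_modular pi_fmeas (mV g.+1 [set s | (n < s)%N]) mU.
  have := fmeas_union_le pi_fmeas mB n.+1.
  have : 0 <= pi (V g.+1 [set s | (n < s)%N] `&` \bigcup_(i in [set i | (i < n.+1)%N]) B i).
    by apply: reg_ge0 => //; apply: measurableI => //; exact: mV.
  lra.
apply: le_trans fsum _; rewrite -addrA lerD2l -big_split /=.
apply: ler_sum => i _.
have CZ : C1 i `|` C2 i `<=` Z by move=> z [/C1Z|/C2Z].
rewrite /B -(occupationE _ _ CZ); last exact: measurableU.
have fu := reg_fmeas (reg_occupation (n - i)%N).
have := fmeas_modular fu (mC1 i) (mC2 i).
have := u_ge0 (n - i)%N (measurableI _ _ (mC1 i) (mC2 i)).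
have -> : (if (i <= L)%N then u (n - i)%N Z
   else u (n - i)%N (Z `&` iter g.+1 F @^-1` channel (i - L))) = u (n - i)%N (C2 i).
  by rewrite /C2; case: ifP.
rewrite -/(C1 i); lra.
Qed.

Hypothesis occupation_cvg0 : u j Z @[j --> \oo] --> (0 : R).
Hypothesis channel_tail : forall L e, 0 < e -> exists I0, forall i, (I0 <= i)%N ->
  pi (channel (i - L)) <= (p + e) * w i.

Let recent_cvg0 L : recent L n @[n --> \oo] --> (0 : R).
Proof.
have lim : \sum_(i < L) u (n - i)%N Z @[n --> \oo] --> (0 : R).
  elim: L => [|L IH].
    rewrite (_ : (fun n => _) = (fun=> 0)); first exact: cvg_cst.
    by apply/funext => n; rewrite big_ord0.
  rewrite (_ : (fun n => _) = (fun n =>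
      \sum_(i < L) u (n - i)%N Z + u (n - L)%N Z)); last first.
    by apply/funext => n; rewrite big_ord_recr.
  rewrite -[X in _ --> X]addr0; apply: cvgD => //.
  rewrite -(cvg_shiftn L).
  rewrite (_ : (fun n => _) = (u ^~ Z))//.
  by apply/funext => n /=; rewrite addnK.
apply: cvg_trans lim; apply: near_eq_cvg; exists L => // n /= Ln.
by rewrite /recent (big_ord_widen n.+1 (fun i => u (n - i)%N Z))// leqW.
Qed.

(** In [channel_decomposition] the first sum is small for [L] large, and the second
    is compared with [renewal_mass]: by mixing the excursion behind the delay is
    nearly independent of the visit, and [channel_tail] gives the proportion of
    excursions in [T]. *)
Theorem channel_limsup e : 0 < e ->
  \forall n \near \oo, pi (Z `&` iter n f @^-1` T) <= p + e.
Proof.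
move=> e0; have /andP[p0 p1] := p01.
(* the errors of the final estimate add up to less than [15 * e1] *)
pose e1 : R := Num.min (8^-1) (e / 15).
have e10 : 0 < e1 by rewrite lt_min invr_gt0 divr_gt0//= ltr0n.
have e18 : e1 <= 8^-1 by rewrite ge_min lexx.
have e15 : 15 * e1 <= e by rewrite mulrC -ler_pdivlMr// ge_min lexx orbT.
have [g mix] := reg_mixing e10.
have [zeta zeta0 hz] := age_sum_bounded.
have K20 : 0 <= K * K by exact: mulr_ge0.
have [L hL] : exists L, K * K * (zeta + 1) * pi (V g.+1 [set s | (L < s)%N]) <= e1.
  have lim : K * K * (zeta + 1) * pi (V g.+1 [set s | (L < s)%N]) @[L --> \oo]
      --> K * K * (zeta + 1) * (0 : R).
    by apply: cvgM; [exact: cvg_cst|exact: fmeas_tail_cvg].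
  rewrite mulr0 in lim.
  by have [L _ /(_ L (leqnn _))] := cvgr_le _ lim _ e10; exists L.
have piL : 0 <= pi (V g.+1 [set s | (L < s)%N]) by apply: reg_ge0 => //; exact: mV.
have hL1 : K * K * zeta * pi (V g.+1 [set s | (L < s)%N]) <= e1.
  apply: le_trans hL; apply: ler_wpM2r => //; apply: ler_wpM2l => //; lra.
have hL2 : K * K * pi (V g.+1 [set s | (L < s)%N]) <= e1.
  apply: le_trans hL; apply: ler_wpM2r => //; apply: ler_peMr => //; lra.
have [I0 hI0] := channel_tail L e10.
pose M := maxn I0 L.+1.
near=> n.
have t1 : pi (V g.+1 [set s | (n < s)%N]) <= e1.
  by near: n; exact: cvgr_le (@fmeas_tail_cvg g) e1 e10.
have t2 : recent L.+1 n <= e1.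
  by near: n; exact: cvgr_le (@recent_cvg0 _) e1 e10.
have t3 : recent M n <= e1.
  by near: n; exact: cvgr_le (@recent_cvg0 _) e1 e10.
have main : \sum_(i < n.+1) (if (i <= L)%N then u (n - i)%N Z
      else u (n - i)%N (Z `&` iter g.+1 F @^-1` channel (i - L))) <=
    recent L.+1 n + (1 + e1) * (recent M n +
      (p + e1) * \sum_(i < n.+1 | (L <= i)%N) u (n - i)%N Z * w i).
  have r1 N : recent N n = \sum_(i < n.+1) (if (i < N)%N then u (n - i)%N Z else 0).
    by rewrite /recent big_mkcond.
  rewrite !r1 [in X in _ <= X](big_mkcond (fun i : 'I_n.+1 => (L <= i)%N)) /=.
  rewrite (mulr_sumr _ _ _ (p + e1)) -big_split /= (mulr_sumr _ _ _ (1 + e1)).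
  rewrite -big_split /=.
  apply: ler_sum => i _.
  have uZ := u_ge0 (n - i)%N mZ.
  have /andP[w0 w1] := w_unit i.
  have uw : 0 <= u (n - i)%N Z * w i by exact: mulr_ge0.
  have q0 : 0 <= p + e1 by lra.
  have q1 : 0 <= 1 + e1 by lra.
  rewrite ltnS; case: (leqP i L) => iL.
    rewrite lerDl; apply: mulr_ge0 => //; apply: addr_ge0; first by case: ifP.
    by apply: mulr_ge0 => //; case: ifP.
  rewrite add0r (ltnW iL).
  have mc := mchannel (i - L).
  have cZ : channel (i - L) `<=` Z by move=> z [/VZ].
  have := mix _ _ (reg_occupation (n - i)%N) mc cZ.
  rewrite ler_norml => /andP[_ up].
  have pc0 : 0 <= pi (channel (i - L)) by exact: reg_ge0.
  have pc1 : pi (channel (i - L)) <= 1 by rewrite -pi_total; exact: fmeas_le.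
  apply: (@le_trans _ _ ((1 + e1) * (u (n - i)%N Z * pi (channel (i - L))))).
    by move: up; lra.
  apply: ler_wpM2l => //.
  case: (ltnP i M) => iM.
    apply: (@le_trans _ _ (u (n - i)%N Z)); first exact: ler_piMr.
    by rewrite lerDl mulr_ge0.
  rewrite add0r mulrCA; apply: ler_wpM2l => //.
  by apply: hI0; apply: leq_trans iM; exact: leq_maxl.
have dec := channel_decomposition g L n.
have long := long_excursions_upper g L n zeta0 hz.
have mass := renewal_mass L n e10 mix.
pose A := \sum_(i < n.+1 | (L <= i)%N) u (n - i)%N Z * w i.
rewrite -/A in main mass.
have A0 : 0 <= A.
  apply: sumr_ge0 => i _; apply: mulr_ge0; first exact: u_ge0.
  by have /andP[] := w_unit i.
have A_le : (1 - 2 * e1) * A <= 1.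
  apply: le_trans mass; apply: ler_wpM2r => //; lra.
have pA : (p + e1) * A <= p + 8 * e1.
  have c0 : 0 < 1 - 2 * e1 by lra.
  rewrite -(ler_pM2l c0) mulrCA.
  apply: (@le_trans _ _ ((p + e1) * 1)); first by apply: ler_wpM2l => //; lra.
  by nra.
nra.
Unshelve. all: by end_near. Qed.

End one_channel.
End renewal.

(** * Mass escapes every set of finite invariant measure *)

Section spreading.
Context {d : measure_display} {R : realType} {X : measurableMetricType d R}.
Variables (m : probability X R) (f : X -> X).
Hypotheses (f_meas : measurable_fun setT f) (f_exact : exact_map m f).
Variables (mu : {sigma_finite_measure set X -> \bar R}).
Hypotheses (mu_ac : mu `<< m).
Hypotheses (mu_inv : forall A, measurable A -> mu (f @^-1` A) = mu A).

Lemma mu_null A : measurable A -> m A = 0%E -> mu A = 0%E.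
Proof. by move=> mA A0; move/null_content_dominatesP : mu_ac; exact. Qed.

Lemma mu_iter_preimage n A : measurable A -> mu (iter n f @^-1` A) = mu A.
Proof.
move=> mA; elim: n => // n <-.
rewrite (_ : iter n.+1 f @^-1` A = f @^-1` (iter n f @^-1` A)).
  by apply: mu_inv; exact: measurable_iter_preimage.
by apply/seteqP; split => x; rewrite /preimage /= -iterSr.
Qed.

Lemma normalized_probability W : measurable W -> (0 < mu W < +oo)%E ->
  exists2 l : probability X R, l `<< m &
    forall A, measurable A -> fine (l A) = fine (mu (A `&` W)) / fine (mu W).
Proof.
move=> mW /andP[W0 Woo].
have lE A : mnormalize (mrestr mu mW) m A = (mu (A `&` W) * (fine (mu W))^-1%:E)%E.
  rewrite /mnormalize /= /mrestr setTI ifF//.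
  by rewrite gt_eqF//= lt_eqF.
exists (mnormalize (mrestr mu mW) m).
  apply/null_content_dominatesP => A mA A0; apply: (etrans (lE A)).
  suff -> : mu (A `&` W) = 0%E by rewrite mul0e.
  apply: mu_null; first exact: measurableI.
  apply: (subset_measure0 _ mA) A0 => //; first exact: measurableI.
move=> A mA; apply: (etrans (congr1 fine (lE A))); rewrite fineM//.
rewrite ge0_fin_numE//; apply: le_lt_trans Woo.
by apply: le_measure; rewrite ?inE//; exact: measurableI.
Qed.

Hypothesis mu_infinite : mu setT = +oo%E.

Lemma large_finite_set (M : R) :
  exists2 W, measurable W & (M%:E < mu W)%E /\ (mu W < +oo)%E.
Proof.
have /sigma_finiteP[W [UW Wmono mW]] := sigma_finiteT mu.
have : (mu (W n)) @[n --> \oo] --> +oo%E.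
  rewrite -mu_infinite UW; apply: nondecreasing_cvg_mu Wmono; last by rewrite -UW.
  by move=> i; have [] := mW i.
move=> /cvgey_gt/(_ M)[N _ NM].
by exists (W N); [exact: (mW N).1|split; [exact: NM (leqnn N)|exact: (mW N).2]].
Qed.

(** Comparison with the normalized restriction of the invariant measure to a set of
    large measure: there the probability of the preimages is small at all times. *)
Lemma finite_measure_escape (l : probability X R) E : l `<< m -> measurable E ->
  (mu E < +oo)%E -> fine (l (iter n f @^-1` E)) @[n --> \oo] --> (0 : R).
Proof.
move=> lm mE Eoo; apply/cvgrPdist_lt => e e0.
have e20 : 0 < e / 2 by lra.
have [W mW [EW Woo]] := large_finite_set (Num.max 1 (2 * fine (mu E) / e + 1)).
have W1 : (0 < mu W)%E by apply: lt_trans EW; rewrite lte_fin lt_max ltr01.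
have [|l2 l2m l2E] := normalized_probability mW; first by rewrite W1.
have fW : fine (mu W) \is Num.pos by rewrite posrE fine_gt0// W1.
have := merging f_meas f_exact lm l2m (fun=> mE).
move=> /cvgrPdist_lt/(_ _ e20)[N _ HN]; exists N => // n Nn.
have := HN n Nn; rewrite /= !sub0r !normrN.
set a := fine (l _); set b := fine (l2 _) => ab.
have a0 : 0 <= a by apply: fine_ge0.
have b2 : b <= e / 2.
  rewrite /b l2E; last exact: measurable_iter_preimage.
  rewrite ler_pdivrMr//.
  apply: (@le_trans _ _ (fine (mu E))).
    have mn := measurable_iter_preimage f_meas n mE.
    rewrite -[in leRHS](mu_iter_preimage n mE) fine_le ?ge0_fin_numE ?mu_iter_preimage//.
      apply: le_lt_trans Woo; apply: le_measure; rewrite ?inE//; exact: measurableI.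
    rewrite -[leRHS](mu_iter_preimage n mE); apply: le_measure; rewrite ?inE//; exact: measurableI.
  have : 2 * fine (mu E) / e + 1 < fine (mu W).
    rewrite -lte_fin fineK ?ge0_fin_numE//; apply: le_lt_trans EW.
    by rewrite lee_fin le_max lexx orbT.
  by rewrite -ltrBrDr ltr_pdivrMr// => h; lra.
rewrite ger0_norm//; have := le_lt_trans (ler_norm _) ab; lra.
Qed.

End spreading.

(** * Tails of the visits to each channel *)

Lemma fmeas_sum_ord (disp : measure_display) (R : realType) (X : measurableType disp)
    (nu : set X -> R) (d : nat) (A : 'I_d -> set X) : fmeas nu ->
  (forall k, measurable (A k)) -> trivIset setT A ->
  nu (\bigcup_k A k) = \sum_(k < d) nu (A k).
Proof.
move=> fnu mA tA; pose B q := if insub q is Some k then A k else set0.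
have BE (k : 'I_d) : B k = A k by rewrite /B valK.
have mB q : measurable (B q) by rewrite /B; case: insubP => [k _ _|_].
under eq_bigr do rewrite -BE.
rewrite (fmeas_sum_disjoint fnu mB).
  congr nu; apply/seteqP; split => [x [k _ Akx]|x [q /= qd]].
    by exists (k : nat) => /=; rewrite ?BE.
  by rewrite -[q]/(nat_of_ord (Ordinal qd)) BE => Ax; exists (Ordinal qd).
move=> q q' x; rewrite /B; case: insubP => [k _ <-|_]; case: insubP => [k' _ <-|_] //.
by move=> kx k'x; congr nat_of_ord; apply: tA => //; exists x.
Qed.

Section excursions.
Context {disp : measure_display} {R : realType} {X : measurableMetricType disp R}.
Variables (f : X -> X) (Y : set X) (d : nat) (Xk : 'I_d -> set X).
Hypothesis Xk_partition : partition setT Xk (~` Y).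
Hypothesis Xk_pass : forall k l x n, k <> l -> Xk k x -> (1 <= n)%N ->
  Xk l (iter n f x) -> exists2 j, (0 < j < n)%N & Y (iter j f x).

Local Notation Z := (recurrent_part f Y).
Local Notation S := (return_time f Y).

Lemma part_outside k x : Xk k x -> ~ Y x.
Proof.
have [XY _ _] := Xk_partition => kx.
by have : (~` Y) x by rewrite -XY; exists k.
Qed.

Lemma part_cover x : ~ Y x -> exists k, Xk k x.
Proof.
have [XY _ _] := Xk_partition => nYx.
by have : (~` Y) x by []; rewrite -XY => -[k _]; exists k.
Qed.

Lemma part_inj k l x : Xk k x -> Xk l x -> k = l.
Proof. by have [_ tX _] := Xk_partition => kx lx; apply: tX => //; exists x. Qed.

Lemma part_trivIset : trivIset setT Xk.
Proof. by case: Xk_partition. Qed.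

(** Between two times of one excursion the orbit is outside [Y], so it cannot pass
    from one part to another. *)
Lemma excursion_same_part k z t j j' : tau f Y z = Some t -> (0 < j < t)%N ->
  (0 < j' < t)%N -> Xk k (iter j f z) -> Xk k (iter j' f z).
Proof.
move=> /tauP[_ _ tn] jt jt' kj; have [l lj'] := part_cover (tn _ jt').
suff -> : k = l by [].
apply: contrapT => kl.
have noY i : (minn j j' < i < maxn j j')%N -> ~ Y (iter i f z).
  by move=> ij; apply: tn; lia.
have [jj|jj|jj] := ltngtP j j'.
- have e : iter (j' - j) f (iter j f z) = iter j' f z by rewrite -iterD subnK// ltnW.
  have [||i ij] := @Xk_pass k l (iter j f z) (j' - j)%N kl kj; [lia|by rewrite e|].
  by rewrite -iterD; apply: noY; lia.
- have e : iter (j - j') f (iter j' f z) = iter j f z by rewrite -iterD subnK// ltnW.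
  have [||i ij] := @Xk_pass l k (iter j' f z) (j - j')%N (nesym kl) lj'; [lia|by rewrite e|].
  by rewrite -iterD; apply: noY; lia.
- by apply: kl; apply: part_inj kj _; rewrite jj.
Qed.

(** An excursion stays in one part, so it visits this part at all its times and the
    other parts never. *)
Lemma visits_gt k z n : (n < visits f Y (Xk k) z)%N <->
  exists2 t, tau f Y z = Some t & (n.+1 < t)%N /\ Xk k (iter n.+1 f z).
Proof.
rewrite /visits; case E : (tau f Y z) => [t|]; last by split => // -[].
have /tauP[t1 Yt _] := E.
rewrite big_nat_recr//= (memNset (fun h => part_outside h Yt)) addn0.
have [nt|tn] := ltnP n.+1 t; last first.
  split => [|[_ [<-] [+ _]]]; last by rewrite ltnNge tn.
  have : (\sum_(1 <= j < t) (iter j f z \in Xk k) <= \sum_(1 <= j < t) 1)%N.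
    by apply: leq_sum => j _; exact: leq_b1.
  by rewrite sum_nat_const_nat; lia.
rewrite (eq_big_nat _ _ (F2 := fun=> (iter n.+1 f z \in Xk k) : nat)); last first.
  move=> j jt; congr nat_of_bool; apply/idP/idP; rewrite !inE => h.
    by apply: excursion_same_part E jt _ h.
  by apply: excursion_same_part E _ jt h.
rewrite sum_nat_const_nat; case: (boolP (_ \in _)) => [|/negP]; rewrite inE => h.
  by split => [_|_]; [exists t|rewrite muln1; lia].
by rewrite muln0; split => // -[_ _ [_ /h]].
Qed.

Lemma tail_tau z t i : Z z -> tau f Y z = Some t -> tail f Y i z <-> (i < t)%N.
Proof.
by move=> Zz tz; rewrite /tail /return_time_in /= tz /= addn0; split => [[]//|].
Qed.

Lemma channel_stay k i i' z : (1 <= i <= i')%N ->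
  channel f Y (Xk k) i' z -> channel f Y (Xk k) i z.
Proof.
move=> ii [zi' kz]; have Zz : Z z by case: zi'.
have [t tz] := recurrent_tau Zz; move: zi' => /(tail_tau _ Zz tz) i't.
split; first by apply/(tail_tau _ Zz tz); lia.
by apply: excursion_same_part tz _ _ kz; lia.
Qed.

(** Visits are counted from time 1 and fill an initial segment of the excursion,
    hence the shift by one. *)
Lemma channel_visits k n : channel f Y (Xk k) n.+1 =
  [set y | Y y /\ (n < visits f Y (Xk k) y)%N] `&` Z.
Proof.
apply/seteqP; split => z.
  move=> [zn kz]; have Zz : Z z by case: zn.
  have [t tz] := recurrent_tau Zz; move: zn => /(tail_tau _ Zz tz) nt.
  by split => //; split; [case: Zz|apply/visits_gt; exists t].
move=> [[Yz /visits_gt[t tz [nt kz]]] Zz]; split => //.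
by apply/(tail_tau _ Zz tz).
Qed.

Lemma tail_channels n : tail f Y n.+1 = \bigcup_k channel f Y (Xk k) n.+1.
Proof.
apply/seteqP; split => [z zn|z [k _ []//]]; have Zz : Z z by case: zn.
have [t tz] := recurrent_tau Zz; have [_ _ h] := (tauP _ _ _ _).1 tz.
have nt := (tail_tau n.+1 Zz tz).1 zn.
by have [|k kz] := @part_cover (iter n.+1 f z); [exact: h|exists k].
Qed.

Lemma channel_trivIset n : trivIset setT (fun k => channel f Y (Xk k) n).
Proof. by move=> k l _ _ [z [[_ kz] [_ lz]]]; exact: part_inj kz lz. Qed.

End excursions.

Lemma powR_shift (R : realType) (alpha : R) (L : nat) (e : R) : 0 < alpha <= 1 ->
  0 < e -> \forall n \near \oo, n%:R `^ alpha <= (1 + e) * (n - L)%N%:R `^ alpha.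
Proof.
move=> /andP[a0 a1] e0.
pose N := (Num.truncn (L%:R / e)).+1.
have NL : L%:R / e < N%:R by rewrite truncnS_gt.
exists (N + L)%N => // n /= Nn.
apply: (@le_trans _ _ (((1 + e) * (n - L)%N%:R) `^ alpha)).
  apply: ge0_ler_powR; rewrite ?nnegrE ?mulr_ge0//; [exact: ltW|lra|].
  have Ln : (L <= n)%N by lia.
  have : N%:R <= n%:R - L%:R :> R by rewrite -natrB// ler_nat; lia.
  rewrite natrB// mulrDl mul1r; move: NL; rewrite ltr_pdivrMr// => NL h.
  suff : N%:R * e <= (n%:R - L%:R) * e by lra.
  by rewrite ler_wpM2r// ltW.
rewrite powRM//; last lra.
apply: ler_wpM2r; first exact: powR_ge0.
by rewrite -[leRHS]powRr1; [apply: ler_powR => //; lra|lra].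
Qed.

(** The common factor [n%:R `^ (- alpha)] is regularly varying, so that a bounded
    shift of [n] does not change it asymptotically and only the constants [c]
    remain. *)
Lemma tail_ratio (R : realType) (d : nat) (alpha : R) (c : 'I_d -> R)
    (a : 'I_d -> nat -> R) (L : nat) (e : R) k : 0 < alpha <= 1 -> (forall l, 0 < c l) ->
  (forall l, a l n * (c l * n%:R `^ (- alpha))^-1 @[n --> \oo] --> (1 : R)) -> 0 < e ->
  \forall n \near \oo, a k (n - L)%N <= (c k / (\sum_l c l) + e) * \sum_l a l n.
Proof.
move=> a01 c0 acvg e0; set s := \sum_l c l.
have s0 : 0 < s.
  rewrite /s (bigD1 k)//=; apply: ltr_pwDl => //; apply: sumr_ge0 => l _; exact: ltW.
have cs : c k <= s.
  by rewrite /s (bigD1 k)//= lerDl; apply: sumr_ge0 => l _; exact: ltW.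
set p := c k / s; have p0 : 0 < p by rewrite divr_gt0.
have p1 : p <= 1 by rewrite ler_pdivrMr// mul1r.
have ckE : c k = p * s by rewrite /p divfK// gt_eqF.
(* so that [(1 + dl) ^+ 2 * p <= (p + e) * (1 - dl)] for [p <= 1] *)
pose dl := e / (4 + e); have dl0 : 0 < dl by rewrite divr_gt0//; lra.
have dl1 : dl < 1 by rewrite ltr_pdivrMr; lra.
have dlE : dl * (4 + e) = e by rewrite divfK// gt_eqF//; lra.
have near l : \forall n \near \oo, (1 - dl) * c l <= a l n * n%:R `^ alpha <= (1 + dl) * c l.
  have /cvgrPdist_le/(_ _ dl0) [N _ HN] := acvg l.
  exists N => // n /HN /=; rewrite powRN invfM invrK ler_distl.
  have -> : a l n * ((c l)^-1 * n%:R `^ alpha) = a l n * n%:R `^ alpha / c l.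
    by rewrite mulrA mulrAC.
  move=> /andP[h1 h2]; rewrite -(ler_pdivlMr _ _ (c0 l)) -(ler_pdivrMr _ _ (c0 l)).
  by apply/andP; split; lra.
have near_all : \forall n \near \oo, forall l,
    (1 - dl) * c l <= a l n * n%:R `^ alpha <= (1 + dl) * c l.
  by apply: filter_forall => l; exact: near.
have [N _ HN] := near_all; have [M _ HM] := powR_shift L a01 dl0.
exists (M + N + L + 1)%N => // n /= Nn.
have nN : (N <= n)%N by lia.
have nLN : (N <= n - L)%N by lia.
have := HM n (leq_trans _ Nn); have /andP[_] := HN _ nLN k.
set b := n%:R `^ alpha; set b' := (n - L)%N%:R `^ alpha => ak /(_ _)/wrap[|bb']; first lia.
have b0 : 0 < b by rewrite powR_gt0// ltr0n; lia.
have b'0 : 0 < b' by rewrite powR_gt0// ltr0n; lia.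
have lo : (1 - dl) * s <= (\sum_l a l n) * b.
  rewrite mulr_sumr mulr_suml; apply: ler_sum => l _.
  by have /andP[] := HN n nN l.
rewrite -(ler_pM2r b0) -mulrA.
apply: (@le_trans _ _ ((p + e) * ((1 - dl) * s))); last first.
  by rewrite ler_wpM2l//; lra.
apply: (@le_trans _ _ ((1 + dl) * ((1 + dl) * c k))).
  have [ak0|/ltW ak0] := lerP 0 (a k (n - L)%N); last first.
    apply: (@le_trans _ _ 0); first by rewrite mulr_le0_ge0// ltW.
    by rewrite !mulr_ge0//; [lra|lra|exact: ltW].
  apply: (@le_trans _ _ (a k (n - L)%N * ((1 + dl) * b'))); first by rewrite ler_wpM2l.
  by rewrite mulrCA ler_wpM2l//; lra.
rewrite ckE (_ : _ * (_ * (p * s)) = (1 + dl) * ((1 + dl) * p) * s); last by rewrite !mulrA.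
rewrite [leRHS]mulrA ler_wpM2r ?(ltW s0)//.
move: p dl p0 p1 dl0 dl1 dlE {ckE near near_all HN HM ak bb' lo} => {}p {}dl p0 p1 dl0 dl1 dlE.
have h1 : 0 <= dl * p * (1 - dl) by rewrite !mulr_ge0//; lra.
have h2 : 0 <= dl * (1 - p) by rewrite mulr_ge0//; lra.
nra.
Qed.

(** * Asymptotic frequencies of the channels *)

(** The upper bounds add up to the total mass, so none of the terms can stay below
    its bound. *)
Lemma limsup_total_cvg (R : realType) (d : nat) (p : 'I_d -> R)
    (x : 'I_d -> nat -> R) (y : nat -> R) : \sum_k p k = 1 ->
  (forall n, \sum_k x k n + y n = 1) -> y n @[n --> \oo] --> (0 : R) ->
  (forall k e, 0 < e -> \forall n \near \oo, x k n <= p k + e) ->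
  forall k, x k n @[n --> \oo] --> p k.
Proof.
move=> p1 xy1 y0 xp k; apply/cvgrPdist_le => e e0.
pose e' := e / d.+1%:R; have e'0 : 0 < e' by rewrite divr_gt0.
have e'E : e = e' *+ d + e' by rewrite -mulrSr -[RHS]mulr_natr divfK// pnatr_eq0.
have xp_all : \forall n \near \oo, forall l, x l n <= p l + e'.
  by apply: filter_forall => l; exact: xp.
have [N _ HN] := xp_all; have /cvgrPdist_le/(_ _ e'0)[M _ HM] := y0.
exists (N + M)%N => // n /= Nn.
have xn := HN n (leq_trans (leq_addr _ _) Nn).
have := HM n (leq_trans (leq_addl _ _) Nn); rewrite /= sub0r normrN => yn.
have y_le := le_trans (ler_norm _) yn.
have : \sum_l (p l + e' - x l n) = e' *+ d + y n.
  rewrite sumrB big_split /= sumr_const card_ord p1.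
  by have := xy1 n; set a := \sum__ _; set b := e' *+ d => h; lra.
rewrite (bigD1 k)//= => sE.
have rest : 0 <= \sum_(l < d | l != k) (p l + e' - x l n).
  by apply: sumr_ge0 => l _; rewrite subr_ge0.
have xk := xn k; have d0 : 0 <= e' *+ d by rewrite mulrn_wge0// ltW.
have e'e : e' <= e by rewrite e'E lerDr.
by rewrite ler_norml; apply/andP; split; lra.
Qed.

Section metric_balls.
Context {disp : measure_display} {R : realType} {X : measurableMetricType disp R}.
Hypothesis X_borel : @measurable disp X = <<s [set U : set X | open U] >>.

Lemma open_ball (x : X) (e : R) : open (ball x e).
Proof.
rewrite openE => y; rewrite ballEmdist /= => xy; apply/nbhs_ballP.
exists (e - mdist x y) => /=; first by rewrite subr_gt0.
move=> z; rewrite !ballEmdist /= => yz.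
by apply: le_lt_trans (metric_triangle x y z) _; lra.
Qed.

Lemma measurable_far (d : nat) (xi : 'I_d -> X) (e : R) :
  measurable (~` \bigcup_k ball (xi k) e).
Proof.
apply/measurableC/(open_measurable_metric X_borel)/bigcup_open => k _.
exact: open_ball.
Qed.

Lemma balls_in_interior (d : nat) (xi : 'I_d -> X) (A : 'I_d -> set X) :
  (forall k, (A k)° (xi k)) -> exists2 e0 : R, 0 < e0 & forall k, ball (xi k) e0 `<=` A k.
Proof.
move=> Axi; have near : \forall n \near \oo, forall k, ball (xi k) (n.+1%:R^-1 : R) `<=` A k.
  apply: filter_forall => k; have /nbhs_ballP[e /= e0 eA] := Axi k.
  have [N] := ltr_add_invr e0; rewrite add0r => Ne.
  exists N => // n /= Nn; apply: subset_trans eA; apply: le_ball.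
  by apply: le_trans (ltW Ne); rewrite lef_pV2 ?posrE// ler_nat.
by have [N _ HN] := near; exists N.+1%:R^-1; [rewrite invr_gt0|exact: (HN N (leqnn N))].
Qed.

End metric_balls.

Section frequencies.
Context {disp : measure_display} {R : realType} {X : measurableMetricType disp R}.
Hypothesis X_borel : @measurable disp X = <<s [set U : set X | open U] >>.
Hypothesis X_compact : compact [set: X].
Variables (m : probability X R) (f : X -> X) (P : set (set X)) (Y : set X).
Hypotheses (f_meas : measurable_fun setT f) (f_cons : conservative_map m f).
Hypotheses (f_exact : exact_map m f) (f_markov : markov_map m f P).
Hypotheses (Y_nonempty : Y !=set0) (Y_union : union_of P Y).
Hypothesis F_gibbs_markov : gibbs_markov m f P Y.
Hypothesis F_mixing :
  topologically_mixing (first_return f Y) (induced_partition f P Y).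
Variables (mu : {sigma_finite_measure set X -> \bar R}).
Hypotheses (mu_ac : mu `<< m).
Hypotheses (mu_inv : forall A, measurable A -> mu (f @^-1` A) = mu A).
Hypothesis mu_infinite : mu setT = +oo%E.
Variables (d : nat) (alpha : R) (c : 'I_d -> R) (Xk : 'I_d -> set X).
Hypotheses (d_ge1 : (1 <= d)%N) (alpha_range : 0 < alpha <= 1).
Hypotheses (c_gt0 : forall k, 0 < c k) (Xk_meas : forall k, measurable (Xk k)).
Hypothesis Xk_partition : partition setT Xk (~` Y).
Hypothesis Xk_pass : forall k l x n, k <> l -> Xk k x -> (1 <= n)%N ->
  Xk l (iter n f x) -> exists2 j, (0 < j < n)%N & Y (iter j f x).
Hypothesis Xk_tail : forall k,
  (mu [set y | Y y /\ (n < visits f Y (Xk k) y)%N]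
     * ((c k * n%:R `^ (- alpha))^-1)%:E)%E @[n --> \oo] --> 1%E.
Hypothesis muY_finite : (mu Y < +oo)%E.

Local Notation Z := (recurrent_part f Y).
Local Notation F := (first_return f Y).

Let mY := measurable_Y f_markov Y_union.
Let mZ := measurable_recurrent f_meas f_markov Y_union.
Let mF := @measurable_first_return _ _ _ _ _ _ _ f_meas f_markov Y_union.

Let long k n := [set y | Y y /\ (n < visits f Y (Xk k) y)%N].

Lemma measurable_visits_gt k n : measurable (long k n).
Proof.
rewrite (_ : long k n = Y `&` \bigcup_(t in [set t | (n.+1 < t)%N])
    ([set y | tau f Y y = Some t] `&` iter n.+1 f @^-1` Xk k)).
  apply: measurableI => //; apply: bigcup_measurable => t _.
  apply: measurableI; first exact: measurable_tau.
  exact: measurable_iter_preimage.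
apply/seteqP; split => y [Yy].
  by move=> /(visits_gt Xk_partition Xk_pass)[t ty [nt ky]]; split => //; exists t.
move=> [t nt [ty ky]]; split => //.
by apply/(visits_gt Xk_partition Xk_pass); exists t.
Qed.

Lemma mu_recurrent A : measurable A -> A `<=` Y -> mu (A `&` Z) = mu A.
Proof.
move=> mA AY; rewrite (_ : mu A = mu (A `\` Z) + mu (A `&` Z))%E; last exact: measureDI.
suff -> : mu (A `\` Z) = 0%E by rewrite add0e.
have mAZ : measurable (A `\` Z) by exact: measurableD.
apply: (mu_null mu_ac mAZ).
have mYZ : measurable (Y `\` Z) by exact: measurableD.
apply: (subset_measure0 mAZ mYZ) (nonrecurrent_null f_meas f_cons f_markov Y_nonempty Y_union).
by move=> x [Ax nZx]; split => //; exact: AY.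
Qed.

Let muYZ : mu Z = mu Y.
Proof. by rewrite -(mu_recurrent mY)// setIidr// => x []. Qed.

Let mu_fin A : measurable A -> A `<=` Y -> mu A \is a fin_num.
Proof.
move=> mA AY; rewrite ge0_fin_numE//; apply: le_lt_trans muY_finite.
by apply: le_measure; rewrite ?inE.
Qed.

Let long_fin k n : mu (long k n) \is a fin_num.
Proof. by apply: mu_fin; [exact: measurable_visits_gt|move=> x []]. Qed.

Lemma visits_tail_cvg k :
  fine (mu (long k n)) * (c k * n%:R `^ (- alpha))^-1 @[n --> \oo] --> (1 : R).
Proof.
have /fine_cvg := Xk_tail k; apply: cvg_trans; apply: near_eq_cvg.
by apply: nearW => n /=; rewrite fineM// long_fin.
Qed.

Lemma muZ_gt0 : (0 < mu Z)%E.
Proof.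
rewrite muYZ lt0e measure_ge0 andbT; apply/eqP => Y0.
have := visits_tail_cvg (Ordinal d_ge1).
have l0 n : mu (long (Ordinal d_ge1) n) = 0%E.
  apply/eqP; rewrite eq_le measure_ge0 andbT -Y0.
  by apply: le_measure; rewrite ?inE//; [exact: measurable_visits_gt|move=> x []].
under eq_fun do rewrite l0 mul0r.
move=> /(cvg_unique _ (cvg_cst 0)) h.
by have := oner_neq0 R; rewrite -h ?eqxx//; exact: Rhausdorff.
Qed.

Let muZ_finite : (mu Z < +oo)%E. Proof. by rewrite muYZ. Qed.

Let M := fine (mu Z).
Let M0 : 0 < M. Proof. by rewrite fine_gt0// muZ_gt0. Qed.

(** The limit is computed for [mu] normalised on the recurrent part, which is the
    regular invariant measure by uniqueness, and merging transfers it to [l]. *)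
Lemma channel_frequencies (l : probability X R) k : l `<< m ->
  fine (l (iter n f @^-1` Xk k)) @[n --> \oo] --> c k / \sum_l c l.
Proof.
have [reg [pi [K [dl [[K0 dl0 reg_pi pi_total] [reg_fmeas reg_add reg_push]
  [pi_inv pi_ref] reg_upper reg_mixing]]]]] := induced_regular f_meas f_cons f_markov
    Y_nonempty Y_union X_borel X_compact F_gibbs_markov F_mixing.
have [|lZ lZm lZE] := normalized_probability mu_ac mZ.
  by rewrite muZ_gt0 muZ_finite.
pose nu A := M^-1 * fine (mu (A `&` Z)).
have fnu : fmeas nu.
  by apply: fmeasZ; [rewrite invr_ge0 ltW|exact: fmeas_measure].
have piE A : measurable A -> A `<=` Z -> pi A = nu A.
  move=> mA AZ; symmetry.
  apply: (invariant_measure_unique f_meas f_exact mZ mF fnu (reg_fmeas _ reg_pi)) => //.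
  - move=> B mB BZ B0; rewrite /nu setIidl// (mu_null mu_ac mB)//= ?mulr0//.
  - move=> B mB BZ B0; have := pi_ref B mB BZ.
    rewrite referenceE// B0 /= mul0r !mulr0 => h; apply/eqP.
    by rewrite eq_le andbC.
  - move=> B mB BZ; rewrite /nu; congr (_ * _).
    exact: (induced_invariant f_meas mu_inv mY mZ muZ_finite mF mB BZ).
  - by rewrite pi_total /nu setIid mulVf// gt_eqF.
have pi_lZ n A : measurable A -> pi (Z `&` iter n f @^-1` A) = fine (lZ (iter n f @^-1` A)).
  move=> mA; have mn := measurable_iter_preimage f_meas n mA.
  rewrite piE; [|exact: measurableI|by move=> x []].
  by rewrite lZE// mulrC /nu setIAC setIid [Z `&` _]setIC.
have pi_channel j n : pi (channel f Y (Xk j) n.+1) = M^-1 * fine (mu (long j n)).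
  rewrite (channel_visits Xk_partition Xk_pass).
  have mj := measurable_visits_gt j n.
  rewrite piE; [|exact: measurableI|by move=> x []].
  by rewrite /nu -setIA setIid mu_recurrent// => x [].
have pi_tail n : pi (tail f Y n.+1) = \sum_l pi (channel f Y (Xk l) n.+1).
  rewrite (tail_channels f Xk_partition); apply: fmeas_sum_ord; first exact: reg_fmeas.
    move=> j; rewrite (channel_visits Xk_partition Xk_pass).
    by apply: measurableI => //; exact: measurable_visits_gt.
  exact: channel_trivIset.
set s := \sum_l c l.
have s0 : 0 < s.
  rewrite /s (bigD1 k)//=; apply: ltr_pwDl => //; apply: sumr_ge0 => j _; exact: ltW.
have p01 j : 0 <= c j / s <= 1.
  rewrite divr_ge0 ?(ltW s0) ?(ltW (c_gt0 j))//= ler_pdivrMr// mul1r.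
  by rewrite /s (bigD1 j)//= lerDl; apply: sumr_ge0 => i _; exact: ltW.
have escape (l' : probability X R) E : l' `<< m -> measurable E -> (mu E < +oo)%E ->
    fine (l' (iter n f @^-1` E)) @[n --> \oo] --> (0 : R).
  exact: (finite_measure_escape f_meas f_exact mu_ac mu_inv mu_infinite).
have occ0 : occupation f Y pi j Z @[j --> \oo] --> (0 : R).
  have := escape lZ Z lZm mZ muZ_finite; apply: cvg_trans; apply: near_eq_cvg.
  apply: nearW => n /=.
  by rewrite (occupationE f_meas mY mZ mF reg_fmeas reg_pi)// pi_lZ.
have ch_tail j L e : 0 < e -> exists I0, forall i, (I0 <= i)%N ->
    pi (channel f Y (Xk j) (i - L)) <= (c j / s + e) * pi (tail f Y i).
  move=> e0; have [N _ HN] := @tail_ratio _ _ _ _ (fun k n => fine (mu (long k n)))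
    L e j alpha_range c_gt0 visits_tail_cvg e0.
  exists (N + L).+1 => -[//|i] Ni; rewrite subSn; last by lia.
  rewrite pi_channel pi_tail; under eq_bigr do rewrite pi_channel.
  rewrite -mulr_sumr mulrCA ler_pM2l ?invr_gt0//.
  by apply: HN => /=; lia.
have upper j e : 0 < e -> \forall n \near \oo,
    fine (lZ (iter n f @^-1` Xk j)) <= c j / s + e.
  move=> e0.
  have := channel_limsup f_meas mY mZ mF reg_fmeas reg_add reg_push reg_upper reg_pi
    pi_total reg_mixing (Xk_meas j) (p01 j)
    (fun i i' z => channel_stay Xk_partition Xk_pass (k := j) (i := i) (i' := i') (z := z))
    occ0 (ch_tail j) e0.
  by apply: filterS => n; rewrite pi_lZ.
move=> lm.
have lZ_cvg : fine (lZ (iter n f @^-1` Xk k)) @[n --> \oo] --> c k / s.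
  apply: (@limsup_total_cvg _ _ (fun j => c j / s)
    (fun j n => fine (lZ (iter n f @^-1` Xk j))) (fun n => fine (lZ (iter n f @^-1` Y)))).
  - by rewrite -mulr_suml divff// gt_eqF.
  - move=> n; rewrite -[RHS]pi_total.
    have mn A : measurable A -> measurable (Z `&` iter n f @^-1` A).
      by move=> mA; apply: measurableI => //; exact: measurable_iter_preimage.
    rewrite -[in RHS](setIT Z) (_ : [set: X] = iter n f @^-1` [set: X])//.
    rewrite (fmeas_split (reg_fmeas _ reg_pi) (mn _ measurableT) (mn Y mY)) addrC.
    rewrite -(pi_lZ _ Y)//; congr (pi _ + _); first by apply/seteqP; split => x [Zx Yx].
    under eq_bigr do rewrite -pi_lZ//.
    rewrite -fmeas_sum_ord; [|exact: reg_fmeas|by move=> j; exact: mn|].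
      congr pi; apply/seteqP; split => [x [j _ [Zx jx]]|x [[Zx _] nY]].
        by split => //; move=> -[_]; exact: (part_outside Xk_partition jx).
      have [|j jx] := part_cover Xk_partition (x := iter n f x).
        by move=> Yx; apply: nY.
      by exists j.
    move=> i j _ _ [x [[_ ix] [_ jx]]]; exact: (part_inj Xk_partition ix jx).
  - exact: escape.
  - exact: upper.
have -> : (fun n => fine (l (iter n f @^-1` Xk k))) =
    (fun n => fine (lZ (iter n f @^-1` Xk k))) \+
    (fun n => fine (l (iter n f @^-1` Xk k)) - fine (lZ (iter n f @^-1` Xk k))).
  by apply/funext => n /=; rewrite addrC subrK.
rewrite -[c k / s]addr0; apply: cvgD lZ_cvg _.
exact: (@merging _ _ _ m f f_meas f_exact l lZ (fun=> Xk k) lm lZm (fun=> Xk_meas k)).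
Qed.

End frequencies.

(** * From frequencies to weak convergence *)

Section continuous_observables.
Context {disp : measure_display} {R : realType} {X : measurableMetricType disp R}.
Hypothesis X_borel : @measurable disp X = <<s [set U : set X | open U] >>.
Implicit Types phi : X -> R.

Lemma continuous_measurable phi : continuous phi -> measurable_fun setT phi.
Proof.
move=> cphi; apply: (measurability _ (RGenOInfty.measurableE R)) => _ [_ [x ->] <-].
rewrite setTI; apply: (open_measurable_metric X_borel).
by apply: open_comp => // y _; exact: cphi.
Qed.

Lemma continuous_compact_bounded phi : compact [set: X] -> continuous phi ->
  exists M : R, forall x, `|phi x| <= M.
Proof.
move=> cX cphi.
have /compact_bounded[M [Mreal HM]] : compact (phi @` [set: X]).
  by apply: continuous_compact => //; apply: continuous_subspaceT.
exists (M + 1) => x; apply: (HM (M + 1)); [lra|by exists x].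
Qed.

Lemma atomic_integral (d : nat) (xi : 'I_d -> X) (p : 'I_d -> R) phi :
  (forall k, 0 <= p k) -> measurable_fun setT phi ->
  (\int[atomic_measure xi p]_x (phi x)%:E = (\sum_k p k * phi (xi k))%:E)%E.
Proof.
move=> p0 mphi.
have [nu nuE int_nu] : exists2 nu : {measure set X -> \bar R},
    (nu : set X -> \bar R) = atomic_measure xi p &
    forall g : X -> R, (forall x, 0 <= g x) -> measurable_fun setT g ->
      (\int[nu]_x (g x)%:E = (\sum_k p k * g (xi k))%:E)%E.
  case: d xi p p0 => [|n] xi p p0.
    exists mzero; first by apply/funext => A; rewrite /atomic_measure big_ord0.
    by move=> g _ _; rewrite integral_measure_zero big_ord0.
  pose w q : {nonneg R} := NngNum (p0 (inord q)).
  exists (msum (fun q => mscale (w q) \d_(xi (inord q))) n.+1).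
    apply/funext => A; rewrite /atomic_measure /msum /=; apply: eq_bigr => k _.
    change ((p (inord k))%:E * \d_(xi (inord k)) A = (p k)%:E * \d_(xi k) A)%E.
    by rewrite inord_val.
  move=> g g0 mg; have mEg : measurable_fun setT (EFin \o g) by exact/measurable_EFinP.
  rewrite ge0_integral_measure_sum//; last by move=> x _; rewrite lee_fin.
  rewrite -sumEFin; apply: eq_bigr => k _.
  rewrite ge0_integral_mscale//; last by move=> x _; rewrite lee_fin.
  by rewrite integral_dirac// diracT mul1e /= inord_val EFinM.
rewrite -nuE integralE.
have part (g : X -> R) : measurable_fun setT g ->
    (\int[nu]_x ((EFin \o g)^\+ x) = (\sum_k p k * Num.max (g (xi k)) 0)%:E)%E.
  move=> mg; rewrite -(int_nu (fun x => Num.max (g x) 0)).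
  - by apply: eq_integral => x _; rewrite funeposE /= EFin_max.
  - by move=> x; rewrite le_max lexx orbT.
  - exact: measurable_maxr.
rewrite (part _ mphi) -funeposN (part (fun x => - phi x)); last exact: measurableT_comp.
rewrite -EFinB -sumrB; congr EFin; apply: eq_bigr => k _; rewrite -mulrBr; congr (_ * _).
by case: (lerP (phi (xi k)) 0) => h; case: (lerP (- phi (xi k)) 0) => h'; lra.
Qed.

Lemma Rintegral_step (l : probability X R) (I : Type) (r : seq I) (v : I -> R)
    (A : I -> set X) : (forall i, measurable (A i)) ->
  [/\ measurable_fun setT (fun x => \sum_(i <- r) v i * \1_(A i) x),
      forall x, `|\sum_(i <- r) v i * \1_(A i) x| <= \sum_(i <- r) `|v i| &
      \int[l]_x (\sum_(i <- r) v i * \1_(A i) x) = \sum_(i <- r) v i * fine (l (A i))].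
Proof.
move=> mA; elim: r => [|i r [mr rM rE]].
  split; first by under eq_fun do rewrite big_nil; exact: measurable_cst.
    by move=> x; rewrite !big_nil normr0.
  by under eq_Rintegral do rewrite big_nil; rewrite big_nil Rintegral_cst// mul0r.
have m1 : measurable_fun setT (fun x => v i * \1_(A i) x).
  by apply: measurable_funM => //; exact: measurable_indic.
have v1 x : `|v i * \1_(A i) x| <= `|v i|.
  by rewrite normrM indicE normr_nat ler_piMr// lern1 leq_b1.
have iE : (fun x => \sum_(j <- i :: r) v j * \1_(A j) x) =
    (fun x => v i * \1_(A i) x + \sum_(j <- r) v j * \1_(A j) x).
  by apply/funext => x; rewrite big_cons.
split; first by rewrite iE; exact: measurable_funD.
  move=> x; rewrite !big_cons; apply: le_trans (ler_normD _ _) _.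
  by apply: lerD.
rewrite iE RintegralD//; [|exact: bounded_integrable v1|exact: bounded_integrable rM].
rewrite rE big_cons; congr (_ + _).
rewrite RintegralZl//; last exact/unit_integrable/unit_indic.
by rewrite Rintegral_indic.
Qed.

Variables (f : X -> X) (d : nat) (xi : 'I_d -> X) (Xk : 'I_d -> set X) (p : 'I_d -> R).
Variable l : probability X R.
Hypotheses (f_meas : measurable_fun setT f) (X_compact : compact [set: X]).
Hypotheses (Xk_meas : forall k, measurable (Xk k)) (Xk_triv : trivIset setT Xk).
Hypothesis xi_interior : forall k, (Xk k)° (xi k).
Hypothesis p_ge0 : forall k, 0 <= p k.
Hypothesis part_cvg : forall k, fine (l (iter n f @^-1` Xk k)) @[n --> \oo] --> p k.
Hypothesis far_cvg : forall e : R, 0 < e ->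
  fine (l (iter n f @^-1` (~` \bigcup_k ball (xi k) e))) @[n --> \oo] --> (0 : R).

(** Near the atoms a continuous function is close to the step function that takes
    on each part its value at the atom, and the mass away from the atoms vanishes. *)
Lemma weak_cvg_atomic :
  weak_cvg (fun n => pushforward l (iter n f)) (atomic_measure xi p).
Proof.
move=> phi cphi; have mphi := continuous_measurable cphi.
have [M phiM] := continuous_compact_bounded X_compact cphi.
have mfn n := measurable_iter f_meas n.
have mphin n : measurable_fun setT (phi \o iter n f) by exact: measurableT_comp.
have iphi n : l.-integrable setT (EFin \o (phi \o iter n f)).
  by apply: (bounded_integrable l (mphin n)) => x; exact: phiM.
rewrite (atomic_integral xi p_ge0 mphi).
have -> : (fun n => (\int[pushforward l (iter n f)]_x (phi x)%:E)%E) =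
    (fun n => (\int[l]_x phi (iter n f x))%:E).
  apply/funext => n; rewrite integral_pushforward//.
  - rewrite preimage_setT /Rintegral fineK//.
    exact: integrable_fin_num (iphi n).
  - exact/measurable_EFinP.
  - by rewrite preimage_setT; exact: iphi.
pose step n x := \sum_k phi (xi k) * \1_(iter n f @^-1` Xk k) x.
pose C := M + \sum_k `|phi (xi k)|.
have mX n k : measurable (iter n f @^-1` Xk k) by exact: measurable_iter_preimage.
have stepP n := Rintegral_step l (index_enum 'I_d) (fun k => phi (xi k)) (mX n).
have M0 : 0 <= M by exact: le_trans (normr_ge0 _) (phiM point).
have C0 : 0 <= C by rewrite addr_ge0// sumr_ge0.
apply: cvg_EFin; first exact: nearW.
apply/cvgrPdist_le => e e0 /=; have e3 : 0 < e / 3 by lra.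
have [dl dl0 near_xi] : exists2 dl : R, 0 < dl & forall k, ball (xi k) dl `<=`
    Xk k `&` [set y | `|phi (xi k) - phi y| <= e / 3].
  apply: balls_in_interior => k; apply: filterI; first exact: xi_interior.
  by have /cvgrPdist_le/(_ _ e3) := cphi (xi k).
pose B n := iter n f @^-1` (~` \bigcup_k ball (xi k) dl).
have mB n : measurable (B n).
  by apply: measurable_iter_preimage => //; exact: measurable_far.
have close n x : `|phi (iter n f x) - step n x| <= e / 3 + C * \1_(B n) x.
  rewrite indicE; have [Bx|nBx] := boolP (x \in B n); last first.
    have [k kx] : exists k, ball (xi k) dl (iter n f x).
      move: nBx; rewrite notin_setE /B /preimage /= => /contrapT[k _ kx]; by exists k.
    have [Xkx phix] := near_xi k _ kx.
    suff -> : step n x = phi (xi k) by rewrite mulr0 addr0 distrC.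
    rewrite /step (bigD1 k)//= big1 ?addr0; first by rewrite indicE mem_set ?mulr1.
    move=> j jk; rewrite indicE memNset ?mulr0// => jx.
    by move/eqP : jk; apply; apply: Xk_triv => //; exists (iter n f x).
  rewrite mulr1; apply: ler_wpDl; first exact: ltW.
  apply: le_trans (ler_normB _ _) _; apply: lerD => //.
  by have [_ + _] := stepP n; exact.
have int_close n : `|\int[l]_x phi (iter n f x) -
    \sum_k phi (xi k) * fine (l (iter n f @^-1` Xk k))| <= e / 3 + C * fine (l (B n)).
  have [ms sM <-] := stepP n.
  have i2 := bounded_integrable l ms sM.
  have mC : measurable_fun setT (fun x => e / 3 + C * \1_(B n) x).
    by apply: measurable_funD => //; apply: measurable_funM => //; exact: measurable_indic.
  have C1 x : `|C * \1_(B n) x| <= C.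
    by rewrite normrM indicE normr_nat (ger0_norm C0) ler_piMr// lern1 leq_b1.
  have i1B : l.-integrable setT (EFin \o (fun x => C * \1_(B n) x)).
    apply: (@bounded_integrable _ _ _ l _ C).
      by apply: measurable_funM => //; exact: measurable_indic.
    exact: C1.
  have iC x : `|e / 3 + C * \1_(B n) x| <= e / 3 + C.
    by apply: le_trans (ler_normD _ _) _; rewrite (ger0_norm (ltW e3)) lerD2l.
  have iB : l.-integrable setT (EFin \o (fun x => phi (iter n f x) - step n x)).
    apply: (@bounded_integrable _ _ _ l _ C); first by apply: measurable_funB => //; exact: mphin.
    by move=> x; apply: le_trans (ler_normB _ _) _; apply: lerD; [exact: phiM|exact: sM].
  rewrite -RintegralB//; last exact: iphi.
  apply: le_trans (le_normr_Rintegral measurableT iB) _.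
  rewrite (_ : _ + _ = \int[l]_x (e / 3 + C * \1_(B n) x)).
    apply: le_Rintegral; [by []|exact: integrable_norm iB|exact: bounded_integrable mC iC|].
    by move=> x _; exact: close.
  rewrite RintegralD//.
  - rewrite Rintegral_cst// RintegralZl//; last exact/unit_integrable/unit_indic.
    by rewrite Rintegral_indic//; have /= -> := probability_setT l; rewrite mulr1.
  - by apply: (@bounded_integrable _ _ _ l _ (e / 3)) => // x; rewrite ger0_norm// ltW.
have sum_cvg : \sum_k phi (xi k) * fine (l (iter n f @^-1` Xk k)) @[n --> \oo] -->
    \sum_k phi (xi k) * p k.
  by apply: cvg_big => [|k _]; [exact: add_continuous|apply: cvgMr; exact: part_cvg].
have far0 : C * fine (l (B n)) @[n --> \oo] --> (0 : R).
  by rewrite -(mulr0 C); apply: cvgMr; exact: far_cvg.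
have /cvgrPdist_le/(_ _ e3)[N1 _ H1] := sum_cvg.
have /cvgrPdist_le/(_ _ e3)[N2 _ H2] := far0.
exists (N1 + N2)%N => // n /= Nn.
have := H1 n (leq_trans (leq_addr _ _) Nn); have := H2 n (leq_trans (leq_addl _ _) Nn).
rewrite /= sub0r normrN => /(le_trans (ler_norm _)) h2 h1.
have h3 := int_close n.
under eq_bigr do rewrite mulrC.
apply: le_trans (ler_distD (\sum_k phi (xi k) * fine (l (iter n f @^-1` Xk k))) _ _) _.
by rewrite [X in _ + X]distrC; lra.
Qed.

End continuous_observables.

Theorem theoremC (disp : measure_display) (R : realType)
    (X : measurableMetricType disp R)
    (X_borel : @measurable disp X = <<s [set U : set X | open U] >>)
    (X_compact : compact [set: X])
    (m : probability X R) (f : X -> X)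
    (f_meas : measurable_fun setT f)
    (f_nonsing : nonsingular_map m f)
    (f_cons : conservative_map m f)
    (f_exact : exact_map m f)
    (P : set (set X))
    (f_markov : markov_map m f P)
    (P_separates : forall x y, separation_time f P x y = None <-> x = y)
    (f_mixing : topologically_mixing f P)
    (Y : set X) (Y_nonempty : Y !=set0) (Y_union : union_of P Y)
    (F_gibbs_markov : gibbs_markov m f P Y)
    (F_mixing :
       topologically_mixing (first_return f Y) (induced_partition f P Y))
    (mu : {sigma_finite_measure set X -> \bar R})
    (mu_ac : mu `<< m)
    (mu_inv : forall A, measurable A -> mu (f @^-1` A) = mu A)
    (mu_infinite : mu setT = +oo%E)
    (d : nat) (d_ge1 : (1 <= d)%N)
    (xi : 'I_d -> X)
    (xi_fixed : forall k, f (xi k) = xi k)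
    (mu_far : forall eps : R, 0 < eps ->
       (mu (~` \bigcup_k ball (xi k) eps) < +oo)%E)
    (alpha : R) (c : 'I_d -> R) (Xk : 'I_d -> set X)
    (alpha_range : 0 < alpha <= 1)
    (c_gt0 : forall k, 0 < c k)
    (Xk_meas : forall k, measurable (Xk k))
    (Xk_partition : partition setT Xk (~` Y))
    (xi_interior : forall k, (Xk k)° (xi k))
    (Xk_pass : forall k l x n, k <> l -> Xk k x -> (1 <= n)%N ->
       Xk l (iter n f x) -> exists2 j, (0 < j < n)%N & Y (iter j f x))
    (Xk_tail : forall k,
       (mu [set y | Y y /\ (n < visits f Y (Xk k) y)%N]
          * ((c k * n%:R `^ (- alpha))^-1)%:E)%E @[n --> \oo] --> 1%E)
    (Q_smooth : exists (theta : R) (K : set (X -> R)),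
       [/\ 0 < theta < 1, dense_L1 m K &
           forall rho r, K rho -> exists2 u, B_theta f P Y theta u &
             {ae m, forall y, Y y -> Q_op m f P Y r rho y = u y}])
    (tau_small : alpha <= 1 / 2 -> exists C : R, \forall n \near \oo,
       (mu [set y | Y y /\ tau f Y y = Some n]
          <= (C * n%:R `^ (- (1 + alpha)))%:E)%E)
    (lambda : probability X R) (lambda_ac : lambda `<< m) :
  weak_cvg (fun n => pushforward lambda (iter n f))
    (atomic_measure xi (fun k => c k / \sum_(l < d) c l)).
Proof.
have [e0 e0_gt0 ballX] := balls_in_interior xi_interior.
have muY_finite : (mu Y < +oo)%E.
  have := mu_far _ e0_gt0; apply: le_lt_trans; apply: le_measure; rewrite ?inE.
  - exact: measurable_Y f_markov Y_union.
  - exact: measurable_far.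
  by move=> y Yy [k _ /ballX ky]; exact: (part_outside Xk_partition ky).
have s0 : 0 <= \sum_(l < d) c l by apply: sumr_ge0 => l _; exact: ltW.
apply: (weak_cvg_atomic X_borel f_meas X_compact Xk_meas _ xi_interior).
- exact: part_trivIset Xk_partition.
- by move=> k; rewrite divr_ge0// ltW.
- move=> k; exact: (channel_frequencies X_borel X_compact f_meas f_cons f_exact f_markov
    Y_nonempty Y_union F_gibbs_markov F_mixing mu_ac mu_inv mu_infinite d_ge1 alpha_range
    c_gt0 Xk_meas Xk_partition Xk_pass Xk_tail muY_finite lambda_ac).
- move=> e e_gt0.
  apply: (finite_measure_escape f_meas f_exact mu_ac mu_inv mu_infinite lambda_ac).
    exact: measurable_far.
  exact: mu_far.
Qed.
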